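(* Let $G$ be a (possibly infinite) group which has a finite non-normal subgroup, and suppose that the intersection $\mathrm{R}(G)$ of all finite non-normal subgroups of $G$ is nontrivial. Let $R$ be a $G$-adapted ring and let $\mathcal{U}$ be the group of units of the group ring $RG$. Then $G$ has the normalizer property, that is, $\mathrm{N}_{\mathcal{U}}(G)=\mathrm{Z}(\mathcal{U})\,G$.
   Context: A $G$-adapted ring is an integral domain $R$ of characteristic zero in which a rational prime $p$ is not invertible whenever $G$ has an element of order $p$ (for example $R=\mathbb{Z}$). $G$ is regarded as a subgroup of $\mathcal{U}$, the unit group of $RG$; $\mathrm{N}_{\mathcal{U}}(G)$ denotes the normalizer of $G$ in $\mathcal{U}$ and $\mathrm{Z}(\mathcal{U})$ the center of $\mathcal{U}$. *)

(* Defs.v *)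
From HB Require Import structures.
From mathcomp Require Import all_boot all_order all_algebra.
From mathcomp Require Import finmap boolp classical_sets cardinality.
From mathcomp Require Import monalg.

Set Implicit Arguments.
Unset Strict Implicit.
Unset Printing Implicit Defensive.

Import GRing.Theory.

Local Open Scope classical_set_scope.
Local Open Scope ring_scope.

(* MathComp's [groupType] is the class of arbitrary, possibly infinite, groups;
   [{group gT}], ['N(A)], ['Z(A)], #[x] are only available for finite ones. *)
Section Groups.
Variable G : groupType.
Implicit Types (x g : G) (A B K : set G).

Definition elt_order x (n : nat) : Prop :=
  [/\ (0 < n)%N, (x ^+ n = 1)%g
    & forall m : nat, (0 < m < n)%N -> (x ^+ m)%g <> 1%g].

Definition conj_set A g : set G := [set (x ^ g)%g | x in A].

Definition mul_set A B : set G := [set (x * y)%g | x in A & y in B].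

Definition subgroup A : Prop := group_closed (mem A).

Definition normal_in_group A : Prop := forall g, conj_set A g = A.

Definition normalizer A : set G := [set g | conj_set A g = A].

Definition center : set G := [set z | forall g, commute z g].

Definition finite_nonnormal_subgroup K : Prop :=
  [/\ subgroup K, finite_set K & ~ normal_in_group K].

End Groups.

Arguments center : clear implicits.

Definition finite_nonnormal_core (G : groupType) : set G :=
  \bigcap_(K in [set K | finite_nonnormal_subgroup K]) K.

Arguments finite_nonnormal_core : clear implicits.

Definition G_adapted (G : groupType) (R : idomainType) : Prop :=
  [pchar R] =i pred0 /\
  (forall p : nat, prime p -> (exists x : G, elt_order x p) ->
     p%:R \isn't a @GRing.unit R).

(* [{malg R[G]}] is the R-module of finitely supported functions G -> R, but its
   library product is restricted to monoids without nontrivial units; hence the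
   alias, carrying the convolution product of the group ring. *)
Definition group_ring (R : nzRingType) (G : groupType) : Type := {malg R[G]}.

Section GroupRing.
Variables (R : nzRingType) (G : groupType).
Local Notation RG := (group_ring R G).

HB.instance Definition _ := GRing.Lmodule.copy RG {malg R[G]}.

Implicit Types (a b c : RG) (g h : G).

Definition gr_one : RG := << 1%g >>.

Definition gr_mul a b : RG :=
  \sum_(g <- msupp a) \sum_(h <- msupp b) << a@_g * b@_h *g (g * h)%g >>.

Lemma gr_mulw (d1 d2 : {fset G}) a b :
  (msupp a `<=` d1)%fset -> (msupp b `<=` d2)%fset ->
  gr_mul a b = \sum_(g <- d1) \sum_(h <- d2) << a@_g * b@_h *g (g * h)%g >>.
Proof.
move=> le_d1 le_d2; rewrite /gr_mul (big_fset_incl _ le_d1) /=.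
  apply/eq_bigr=> g _; apply/big_fset_incl => // h _ /mcoeff_outdom ->.
  by rewrite mulr0 monalgU0.
move=> g _ /mcoeff_outdom ag.
by rewrite big1 => // h _; rewrite ag mul0r monalgU0.
Qed.

Lemma gr_mulUU (r s : R) g h :
  gr_mul << r *g g >> << s *g h >> = << r * s *g (g * h)%g >>.
Proof. by rewrite (gr_mulw msuppU_le msuppU_le) !big_seq_fset1 !mcoeffUU. Qed.

Lemma gr_mulDl : left_distributive gr_mul +%R.
Proof.
move=> a b c.
rewrite (gr_mulw (msuppD_le a b) (fsubset_refl (msupp c))).
rewrite (gr_mulw (fsubsetUl (msupp a) (msupp b)) (fsubset_refl (msupp c))).
rewrite (gr_mulw (fsubsetUr (msupp a) (msupp b)) (fsubset_refl (msupp c))).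
rewrite -big_split /=; apply/eq_bigr=> g _.
rewrite -big_split /=; apply/eq_bigr=> h _.
by rewrite mcoeffD mulrDl monalgUD.
Qed.

Lemma gr_mulDr : right_distributive gr_mul +%R.
Proof.
move=> c a b.
rewrite (gr_mulw (fsubset_refl (msupp c)) (msuppD_le a b)).
rewrite (gr_mulw (fsubset_refl (msupp c)) (fsubsetUl (msupp a) (msupp b))).
rewrite (gr_mulw (fsubset_refl (msupp c)) (fsubsetUr (msupp a) (msupp b))).
rewrite -big_split /=; apply/eq_bigr=> g _.
rewrite -big_split /=; apply/eq_bigr=> h _.
by rewrite mcoeffD mulrDr monalgUD.
Qed.

Lemma gr_mul0l : left_zero 0 gr_mul.
Proof. by move=> a; rewrite /gr_mul msupp0 big_seq_fset0. Qed.

Lemma gr_mul0r : right_zero 0 gr_mul.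
Proof.
by move=> a; rewrite /gr_mul big1 // => g _; rewrite msupp0 big_seq_fset0.
Qed.

Lemma gr_ind (P : RG -> Prop) :
  P 0 -> (forall a b, P a -> P b -> P (a + b)) ->
  (forall (r : R) g, P << r *g g >>) -> forall a, P a.
Proof. by move=> P0 PD PU a; rewrite (monalgE a); apply: big_ind. Qed.

Lemma gr_mulA : associative gr_mul.
Proof.
move=> a b c; elim/gr_ind: a => [|a1 a2 IH1 IH2|r g].
- by rewrite !gr_mul0l.
- by rewrite !gr_mulDl IH1 IH2.
elim/gr_ind: b => [|b1 b2 IH1 IH2|s h].
- by rewrite gr_mul0l !gr_mul0r gr_mul0l.
- by rewrite gr_mulDl !gr_mulDr gr_mulDl IH1 IH2.
elim/gr_ind: c => [|c1 c2 IH1 IH2|t k].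
- by rewrite !gr_mul0r.
- by rewrite !gr_mulDr IH1 IH2.
by rewrite !gr_mulUU mulrA mulgA.
Qed.

Lemma gr_mul1l : left_id gr_one gr_mul.
Proof.
move=> a; elim/gr_ind: a => [|a1 a2 IH1 IH2|r g].
- by rewrite gr_mul0r.
- by rewrite gr_mulDr IH1 IH2.
by rewrite gr_mulUU mul1r mul1g.
Qed.

Lemma gr_mul1r : right_id gr_one gr_mul.
Proof.
move=> a; elim/gr_ind: a => [|a1 a2 IH1 IH2|r g].
- by rewrite gr_mul0l.
- by rewrite gr_mulDl IH1 IH2.
by rewrite gr_mulUU mulr1 mulg1.
Qed.

Lemma gr_one_neq0 : gr_one != 0 :> RG.
Proof. by apply/eqP/malgP=> /(_ 1%g) /eqP; rewrite !mcoeffsE oner_eq0. Qed.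

HB.instance Definition _ := GRing.Zmodule_isNzRing.Build RG
  gr_mulA gr_mul1l gr_mul1r gr_mulDl gr_mulDr gr_one_neq0.

Definition gr_is_unit a : Prop := exists b : RG, b * a = 1 /\ a * b = 1.

Definition gr_unit : pred RG := fun a => `[< gr_is_unit a >].

Definition gr_inv a : RG :=
  if pselect (gr_is_unit a) is left ua then projT1 (cid ua) else a.

Lemma gr_mulVr : {in gr_unit, left_inverse 1 gr_inv *%R}.
Proof.
by move=> a /asboolP ua; rewrite /gr_inv; case: pselect => // e; case: cid => ? [].
Qed.

Lemma gr_mulrV : {in gr_unit, right_inverse 1 gr_inv *%R}.
Proof.
by move=> a /asboolP ua; rewrite /gr_inv; case: pselect => // e; case: cid => ? [].
Qed.

Lemma gr_unitP a b : b * a = 1 /\ a * b = 1 -> gr_unit a.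
Proof. by move=> ab; apply/asboolP; exists b. Qed.

Lemma gr_inv_out : {in [predC gr_unit], gr_inv =1 id}.
Proof.
by move=> a /negP nua; rewrite /gr_inv; case: pselect => // ua; case: nua; apply/asboolP.
Qed.

HB.instance Definition _ := GRing.NzRing_hasMulInverse.Build RG
  gr_mulVr gr_mulrV gr_unitP gr_inv_out.

End GroupRing.

(* The library's [{unit A}] needs a finite ring [A]. *)
Record unit_group (A : unitRingType) := UnitGroup {
  ug_val : A;
  ug_valP : ug_val \is a GRing.unit
}.

Section UnitGroup.
Variable A : unitRingType.
Implicit Types u v w : unit_group A.

HB.instance Definition _ := [isSub for @ug_val A].
HB.instance Definition _ := [Choice of unit_group A by <:].

Definition ug_one : unit_group A := UnitGroup (unitr1 A).

Fact ug_mul_subproof u v : ug_val u * ug_val v \is a GRing.unit.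
Proof. by rewrite unitrMl ?ug_valP. Qed.
Definition ug_mul u v : unit_group A := UnitGroup (ug_mul_subproof u v).

Fact ug_inv_subproof u : (ug_val u)^-1 \is a GRing.unit.
Proof. by rewrite unitrV ug_valP. Qed.
Definition ug_inv u : unit_group A := UnitGroup (ug_inv_subproof u).

Lemma ug_mulA : associative ug_mul.
Proof. by move=> u v w; apply: val_inj; rewrite /= mulrA. Qed.

Lemma ug_mul1l : left_id ug_one ug_mul.
Proof. by move=> u; apply: val_inj; rewrite /= mul1r. Qed.

Lemma ug_mul1r : right_id ug_one ug_mul.
Proof. by move=> u; apply: val_inj; rewrite /= mulr1. Qed.

Lemma ug_mulVl : left_inverse ug_one ug_inv ug_mul.
Proof. by move=> u; apply: val_inj; rewrite /= mulVr ?ug_valP. Qed.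

Lemma ug_mulVr : right_inverse ug_one ug_inv ug_mul.
Proof. by move=> u; apply: val_inj; rewrite /= divrr ?ug_valP. Qed.

HB.instance Definition _ := isGroup.Build (unit_group A)
  ug_mulA ug_mul1l ug_mul1r ug_mulVl ug_mulVr.

End UnitGroup.

Section Embedding.
Variables (R : nzRingType) (G : groupType).

Fact gr_of_group_unit (g : G) : (<< g >> : group_ring R G) \is a GRing.unit.
Proof.
apply/unitrP; exists (<< g^-1%g >> : group_ring R G).
by split; rewrite [LHS]gr_mulUU mulr1 ?mulVg ?mulgV.
Qed.

Definition group_unit (g : G) : unit_group (group_ring R G) :=
  UnitGroup (gr_of_group_unit g).

Lemma group_unitM : {morph group_unit : g h / (g * h)%g >-> (g * h)%g}.
Proof. by move=> g h; apply: val_inj; rewrite /= [RHS]gr_mulUU mulr1. Qed.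

Lemma group_unit_inj : injective group_unit.
Proof.
move=> g h /(congr1 val)/malgP/(_ g); rewrite /= mcoeffUU mcoeffU.
by case: eqP => // _ /eqP; rewrite oner_eq0.
Qed.

Definition group_in_units : set (unit_group (group_ring R G)) :=
  range group_unit.

End Embedding.

Arguments group_unit R {G} g.
Arguments group_in_units : clear implicits.

Definition normalizer_property (R : nzRingType) (G : groupType) : Prop :=
  normalizer (group_in_units R G) =
    mul_set (center (unit_group (group_ring R G))) (group_in_units R G).

(* Main.v *)
(* Let u be a unit with u^-1 g u = phi(g) for all g in G, translated so that 1
   lies in S = supp u.  The finite set D = S S^-1 is stable under conjugation by
   G, so the elements of finite order of K = <D> form a subgroup whose quotient A
   is abelian and torsion-free.  The A-homogeneous components of u = sum u_a and
   u^-1 = sum v_b commute with each other; ordering A partially shows that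
   u_a v_b is nilpotent when a + b <> 0, so each u_a v_{-a} is idempotent up to
   nilpotents.  Idempotents of RF with F finite are trivial, since the rank of
   the regular representation is |F| times the coefficient of 1 and R is
   G-adapted; hence some u_a is a unit, it induces the same phi, and a translate
   of it is supported on a finite normal subgroup T.  We may take T to contain an
   element z of prime order p lying in all finite non-normal subgroups.

   The affine maps x |-> g^-1 x phi(g) of T now form a finite group, and phi is
   inner if and only if they have a common fixed point.  They preserve the
   coefficients of the unit, whose sum is a unit of R, so every subgroup of
   affine maps of prime power order r^k, with r dividing |T|, has a fixed point.
   Subgroups of T avoiding z are normal in G; in particular T/B is a p-group for
   B = O_{p'}(T), and the maps act on B by power automorphisms.  Averaging over
   orbits makes the cocycle B-valued and trivial on a Sylow p-subgroup.  If phi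
   moves some b in B of prime order q, an element y with phi(b) = b^y can be
   corrected, by counting pairs of group elements modulo q, to one fixed by all
   maps modulo B, and translating by it makes phi trivial on elements of prime
   order of B.  The cocycle is then trivialized one prime of |B| at a time. *)

From HB Require Import structures.
Require Import Defs.
From mathcomp Require Import boolp classical_sets cardinality.
From mathcomp Require Import all_boot all_order all_algebra all_fingroup all_solvable.
From mathcomp Require Import generic_quotient fraction finmap monalg.

Set Implicit Arguments.
Unset Strict Implicit.
Unset Printing Implicit Defensive.

Import GRing.Theory.

Local Open Scope group_scope.

(** * Finite groups twisted by a cocycle *)

(** [phi] is easily made inner on small pieces; the obstacle is that the fixed points found for
    different Sylow subgroups of the group of affine maps need not agree. Averaging over an orbit
    reconciles them, but only in an abelian group of order prime to the size of the orbit. It is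
    therefore used in sections of [T]: the centre of [T / B], an abelian subgroup of [T / B], and
    the Sylow subgroups of [B] for odd primes, abelian because their cyclic subgroups are normal.
    The Sylow 2-subgroup of [B] may be Hamiltonian; there a map of odd order acts trivially, and the
    projection of a point fixed by a Sylow 2-subgroup is fixed by all maps. Triviality on elements
    of prime order matters because a power automorphism of a cyclic r-group, of order prime to r, is
    trivial once it fixes the elements of order r. An element conjugating one [b] to [phi b] must
    then do the same for every other element of prime order; choosing [b] with the longest
    [phi]-orbit makes this possible. Degrees need no total order: only finitely many differences
    have to receive a sign. *)

Lemma expn_eq1_mod r m k n : prime r -> k = 1 %[mod r] -> ~~ (r %| n) ->
  (k ^ n = 1 %[mod r ^ m])%N -> (k = 1 %[mod r ^ m])%N.
Proof.
move=> r_pr k1 rn kn1.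
have k0 : 0 < k.
  by case: k k1 {kn1} => // /eqP; rewrite mod0n modn_small ?prime_gt1.
apply/eqP; rewrite eqn_mod_dvd //.
move/eqP: kn1; rewrite eqn_mod_dvd ?expn_gt0 ?k0 // -[X in (_ - X)%N](exp1n n) subn_exp.
(* The cofactor of [k - 1] in [k ^ n - 1] is a sum of [n] powers of [k], hence congruent to [n]
   modulo [r]. *)
rewrite Gauss_dvdl // coprimeXl // prime_coprime // /dvdn -modn_summ.
rewrite (eq_bigr (fun=> 1 %% r)) => [|j _]; last by rewrite exp1n muln1 -modnXm k1 modnXm exp1n.
by rewrite modn_summ sum1_card card_ord.
Qed.

(** In a noncommuting pair with smallest sum of orders, the commutator commutes with both elements
    and generates the subgroup of order [r] of each cycle. Multiplying [y] by a power of [x] then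
    lowers its order, so the product commutes with [x] by minimality, and so does [y]. *)
Lemma odd_Dedekind_abelian (T : finGroupType) (H : {group T}) r :
  prime r -> odd r -> r.-group H -> {in H, forall x, <[x]> <| H} -> abelian H.
Proof.
move=> r_pr r_odd rH nH; apply/centsP=> x xH y yH.
have [n] := ubnP (#[x] + #[y]); elim: n => // n IH in x y xH yH *; rewrite ltnS => len.
wlog le_yx : x y xH yH len / #[y] <= #[x].
  move=> W; case/orP: (leq_total #[y] #[x]) => le; first exact: W.
  by apply/commute_sym/W; rewrite // addnC.
apply/commgP/negPn/negP=> nc.
set d := [~ x, y] in nc.
have dx : d \in <[x]>.
  by rewrite /d commgEl groupMl ?groupV ?cycle_id // memJ_norm ?cycle_id // (subsetP (normal_norm (nH x xH))).
have dy : d \in <[y]>.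
  by rewrite /d commgEr groupMr ?cycle_id // memJ_norm ?groupV ?cycle_id // (subsetP (normal_norm (nH y yH))).
have [[|a] Ea] := p_natP (mem_p_elt rH xH).
  by move/eqP: Ea nc; rewrite expn0 order_eq1 /d => /eqP ->; rewrite comm1g eqxx.
have cdx : commute x d by apply/(centsP (cycle_abelian x)) => //; rewrite cycle_id.
have cdy : commute y d by apply/(centsP (cycle_abelian y)) => //; rewrite cycle_id.
have dr : d ^+ r = 1.
  rewrite /d -commXg //; apply/eqP/commgP/IH => //; first by rewrite groupX.
  apply: leq_trans len; rewrite ltn_add2r orderXdiv Ea ?dvdn_mulr //; last by rewrite expnS dvdn_mulr.
  by rewrite ltn_Pdiv ?prime_gt1 ?expn_gt0 ?prime_gt0.
have od : #[d] = r by apply: nt_prime_order.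
have [[|b] Eb] := p_natP (mem_p_elt rH yH).
  by move/eqP: Eb nc; rewrite expn0 order_eq1 /d => /eqP ->; rewrite commg1 eqxx.
have gen w k : #[w] = (r ^ k.+1)%N -> d \in <[w]> -> <[d]> = <[w ^+ (r ^ k)]>.
  move=> ow dw; apply/eqP; rewrite (eq_subG_cyclic (cycle_cyclic w)) ?cycle_subG ?groupX ?cycle_id //.
  by rewrite -!orderE od orderXdiv ow ?dvdn_exp2l // -expnB ?prime_gt0 // subSnn expn1.
case: b => [|b] in Eb.
  have := gen y 0%N Eb dy; rewrite expn0 expg1 => Ey; case/negP: nc; rewrite /d.
  have /cycleP[k Ek] : y \in <[d]> by rewrite Ey cycle_id.
  by apply/commgP; rewrite Ek; exact: commuteX.
have le_ba : b.+1 <= a by rewrite Ea Eb leq_exp2l ?prime_gt1 in le_yx.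
have : (y ^+ (r ^ b.+1))^-1 \in <[x ^+ (r ^ a)]>.
  by rewrite -(gen x a Ea dx) (gen y b.+1 Eb dy) groupV cycle_id.
(* With this exponent, [x ^+ k] and [y] have inverse powers of exponent [r ^ b.+1]. *)
case/cycleP=> j Ej; pose k := (j * r ^ (a - b.+1))%N.
have Exy : (y * x ^+ k) ^+ (r ^ b.+1) = 1.
  have cX : [~ x ^+ k, y] = d ^+ k by rewrite commXg.
  rewrite expMg_Rmul ?cX; last 2 first.
  - by apply/commute_sym/commuteX/commute_sym/commuteX.
  - exact: commuteX.
  (* Oddness of [r] enters here and makes the commutator term disappear. *)
  have /dvdnP[s ->] : r %| 'C(r ^ b.+1, 2).
    by rewrite bin2odd ?oddX ?r_odd ?orbT // dvdn_mulr // expnS dvdn_mulr.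
  rewrite -(expgM d k) mulnA [(_ * r)%N]mulnC (expgM d r) dr expg1n mulg1.
  rewrite -expgM /k -mulnA -expnD subnK // mulnC expgM -Ej mulgV //.
have ltx : #[y * x ^+ k] < #[y].
  apply: (@leq_ltn_trans (r ^ b.+1)); last by rewrite Eb ltn_exp2l ?prime_gt1.
  by rewrite dvdn_leq ?expn_gt0 ?prime_gt0 // order_dvdn Exy.
have cxy : commute x (y * x ^+ k).
  apply: IH; rewrite ?groupM ?groupX //.
  by apply: leq_trans len; rewrite ltn_add2l.
case/negP: nc; apply/commgP; rewrite -[y](mulgK (x ^+ k)).
by apply: commuteM => //; apply/commuteV/commuteX.
Qed.

(** Each orbit outside the fixed points has size divisible by [p], and [f] is constant on it; this
    is the weighted form of the count of fixed points modulo [p]. *)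
Lemma pgroup_sum_fix (R : nzRingType) (aT : finGroupType) (D : {group aT})
    (sT : finType) (to : {action aT &-> sT}) (p : nat) (A : {set sT}) (f : sT -> R) :
  prime p -> p.-group D -> [acts D, on A | to] ->
  (forall d x, d \in D -> x \in A -> f (to x d) = f x) ->
  exists r, (\sum_(x in A) f x = \sum_(x in 'Fix_(A | to)(D)) f x + p%:R * r)%R.
Proof.
move=> p_pr pD; have [n] := ubnP #|A|; elim: n => // n IH in A * => ltAn actA fD.
have [/subsetP sAF | nsAF] := boolP (A \subset 'Fix_to(D)).
  exists 0%R; rewrite mulr0 addr0; apply/eq_bigl=> x; rewrite inE.
  by apply/idP/andP => [xA | []//]; split; last exact: sAF.
have [x xA nxF] := subsetPn nsAF.
have Ox : x \in orbit to D x by exact: orbit_refl.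
have sOA : orbit to D x \subset A by rewrite acts_sub_orbit.
have actAO : [acts D, on A :\: orbit to D x | to].
  apply/actsP=> d dD y; rewrite !inE; congr (~~ _ && _); last exact: (actsP actA).
  by rewrite (actsP (acts_orbit to x (subsetT D))).
have ltAO : #|A :\: orbit to D x| < n.
  apply: leq_trans (ltAn : #|A| <= n)%N; apply/proper_card.
  by apply/properP; split; [exact: subsetDl | exists x => //; rewrite inE Ox].
have [|r Er] := IH _ ltAO actAO.
  by move=> d y dD /setDP[yA _]; exact: fD.
have [m Em] : exists m, (#|orbit to D x| = p * m)%N.
  have pO : p.-nat #|orbit to D x|.
    by apply: pnat_dvd pD; exact: dvdn_orbit.
  case/p_natP: pO => -[|e] Ee; last by exists (p ^ e)%N; rewrite -expnS.
  by case/negP: nxF; apply/orbit1P; exact: card_orbit1.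
have fO y : y \in orbit to D x -> f y = f x.
  by case/orbitP=> d dD <-; exact: fD.
rewrite (big_setID (orbit to D x)) /= (setIidPr sOA) (eq_bigr _ fO) sumr_const Em.
exists (r + f x *+ m)%R; rewrite Er mulrDr [LHS]addrC -addrA; congr (_ + (_ + _))%R.
  apply: eq_bigl => y; rewrite !(in_setI, in_setD).
  case: (boolP (y \in orbit to D x)) => //= yO.
  apply/esym/negbTE; apply: contra nxF => /andP[_ Fy].
  have Oy : x \in orbit to D y by rewrite orbit_sym.
  by move: Oy; have /orbit1P -> := Fy; move/set1P ->.
by rewrite mulr_natl mulnC mulrnA.
Qed.

(** * Barycentres in finite abelian groups *)

Section Averaging.
Import FiniteModule.
Variables (S : finType) (X : finGroupType) (A : {group X}) (O : {set S}).
Variables (f : S -> X) (k : nat).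
Hypotheses (abA : abelian A) (fA : {in O, forall o, f o \in A}).
Hypothesis (kO : #|O| * k = 1 %[mod #|A|]).

Let s := (\sum_(o in O) fmod abA (f o))%R.

Let abel_exp (x : X) : x \in A -> x ^+ (#|O| * k) = x.
Proof.
move=> xA; rewrite -(expg_mod _ (expg_cardG xA)) kO (expg_mod _ (expg_cardG xA)).
by rewrite expg1.
Qed.

(** The barycentre of the family [f]: the sum is taken in the additive copy of [A], and the power
    [k] divides by the number of points. *)
Definition affine_mean : X := fmval s ^+ k.

Lemma affine_mean_in : affine_mean \in A.
Proof. by rewrite groupX // fmodP. Qed.

Lemma affine_mean_lcoset (K : {group X}) x :
  K \subset A -> x \in A -> {in O, forall o, f o \in x *: K} -> affine_mean \in x *: K.
Proof.
move=> sKA xA fK; rewrite -[x in x *: K]abel_exp // expgM.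
suff: fmval s \in x ^+ #|O| *: K.
  case/lcosetP=> y yK; rewrite /affine_mean => ->; rewrite expgMn; last first.
    by apply: (centsP abA); rewrite ?groupX //; apply: (subsetP sKA).
  by rewrite mem_lcoset mulKg groupX.
rewrite mem_lcoset /s -sum1_card.
apply: (@big_rec2 _ _ (fun (u : fmod_of abA) n => x ^- n * fmval u \in K)) => [|o u n oO IH].
  by rewrite mulg1 invg1.
have foA : f o \in A by exact: fA.
rewrite fmvalA fmodK // expgD expg1 invMg.
rewrite -mulgA (mulgA (x^-1)) mulgA (_ : x ^- n * (x^-1 * f o) = x^-1 * f o * x ^- n).
  by rewrite -mulgA groupM // -mem_lcoset fK.
by apply: (centsP abA); rewrite ?groupV ?groupX ?groupM ?groupV.
Qed.

(** The map only permutes the family, so it fixes the barycentre: the constant [c] enters the sum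
    [#|O|] times, and the power [k] turns this back into [c]. *)
Lemma affine_mean_fix (tau : S -> S) (al : X -> X) (c : X) :
  {in A &, {morph al : x y / x * y}} -> {in A, forall x, al x \in A} -> c \in A ->
  {in O, forall o, tau o \in O} -> {in O &, injective tau} ->
  {in O, forall o, f (tau o) = al (f o) * c} -> al affine_mean * c = affine_mean.
Proof.
move=> alM alA cA tauO tau_inj ftau.
have al1 : al 1 = 1 by apply: (mulgI (al 1)); rewrite -alM ?group1 // !mulg1.
pose alF (u : fmod_of abA) := fmod abA (al (fmval u)).
have alFM : {morph alF : u v / (u + v)%R}.
  by move=> u v; rewrite /alF fmvalA alM ?fmodP // fmodM ?alA ?fmodP.
have alF0 : alF 0%R = 0%R by rewrite /alF fmval0 al1 fmod1.
have Es : s = (alF s + fmod abA c *+ #|O|)%R.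
  rewrite /s (big_morph alF alFM alF0) -sumr_const -big_split /=.
  have EO : [set tau o | o in O] = O.
    apply/eqP; rewrite eqEcard card_in_imset // leqnn andbT.
    by apply/subsetP=> _ /imsetP[o oO ->]; exact: tauO.
  rewrite -{1}EO big_imset //=; apply: eq_bigr => o oO.
  by rewrite ftau // fmodM ?alA ?fA // /alF fmodK ?fA.
have alX (x : X) n : x \in A -> al (x ^+ n) = al x ^+ n.
  move=> xA; elim: n => [|n IH]; first by rewrite !expg0.
  by rewrite !expgS alM ?groupX // IH.
rewrite /affine_mean alX ?fmodP // -[c]abel_exp // expgM.
rewrite -expgMn; last by apply: (centsP abA); rewrite ?alA ?groupX ?fmodP.
congr (_ ^+ k); rewrite [in RHS]Es fmvalA fmvalZ fmodK // /alF fmodK //.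
by rewrite alA ?fmodP.
Qed.
End Averaging.

(* The map [embed] need not be injective: [Gam] will be a group of permutations of [T] in
   which central elements of [T] may become trivial. *)
Record conj_action (T Gam : finGroupType) := ConjAction {
  act_by : Gam -> T -> T;
  embed : T -> Gam;
  act_byM : forall g, {morph act_by g : x y / x * y};
  act_byA : forall g h x, act_by (g * h) x = act_by h (act_by g x);
  act_by_id : forall x, act_by 1 x = x;
  embedM : {morph embed : x y / x * y};
  act_by_embed : forall t x, act_by (embed t) x = x ^ t;
  embed_act : forall g x, embed (act_by g x) = embed x ^ g
}.

(** * Units of the group ring of a finite group, twisted by a cocycle *)

Section TwistedSystems.
Variables (T Gam : finGroupType) (E : conj_action T Gam).
Variable R : comUnitRingType.
Hypothesis nonunit : forall r, prime r -> r %| #|T| -> (r%:R)%R \isn't a @GRing.unit R.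
Local Notation al := (act_by E).
Local Notation i := (embed E).
Local Notation alM := (act_byM E).
Local Notation alA := (act_byA E).
Local Notation al_id := (act_by_id E).
Local Notation iM := (embedM E).
Local Notation al_i := (act_by_embed E).
Local Notation i_al := (embed_act E).

Lemma act_by1 g : al g 1 = 1.
Proof. by apply: (mulgI (al g 1)); rewrite -alM !mulg1. Qed.

Lemma act_byV g x : al g x^-1 = (al g x)^-1.
Proof. by apply: (mulgI (al g x)); rewrite -alM !mulgV act_by1. Qed.

Lemma act_byX g n : {morph al g : x / x ^+ n}.
Proof. by move=> x; elim: n => [|n IH]; rewrite ?expg0 ?act_by1 // !expgS alM IH. Qed.

Lemma act_byK g : cancel (al g) (al g^-1).
Proof. by move=> x; rewrite -alA mulgV al_id. Qed.

Lemma act_byKV g : cancel (al g^-1) (al g).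
Proof. by move=> x; rewrite -alA mulVg al_id. Qed.

Lemma act_by_inj g : injective (al g). Proof. exact: can_inj (act_byK g). Qed.

Lemma act_byJ g x y : al g (x ^ y) = al g x ^ al g y.
Proof. by rewrite !conjgE !alM act_byV. Qed.

Definition al_to x g := al g x.
Lemma al_to1 : al_to^~ 1 =1 id. Proof. exact: al_id. Qed.
Lemma al_toM x : act_morph al_to x. Proof. by move=> g h; exact: alA. Qed.
Definition lin_action := TotalAction al_to1 al_toM.

Lemma prime_nondvd r (s : R) : prime r -> r %| #|T| -> (1 = r%:R * s)%R -> False.
Proof.
by move=> r_pr rT Es; have /negP[] := nonunit r_pr rT; apply/unitrPr; exists s.
Qed.

(* [u] and [v] list the coefficients of two mutually inverse elements of the group ring of
   [T]; the affine maps [x |-> al g x * c g] permute the coefficients, and a common fixed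
   point of these maps is what has to be found. *)
Record twisted_unit (c : Gam -> T) (u v : T -> R) : Prop := TwistedUnit {
  cocycle : forall g h, c (g * h) = al h (c g) * c h;
  uinv : forall g x, u (al g x * c g) = u x;
  vinv : forall g x, v (al g x * c g)^-1 = v x^-1;
  convUV : forall t, (\sum_x u x * v (x^-1 * t)%g = (t == 1%g)%:R)%R;
  convVU : forall t, (\sum_x v x * u (x^-1 * t)%g = (t == 1%g)%:R)%R
}.

(** The cocycle after moving the origin to [x]: it is trivial at [g] exactly when [x] was fixed by
    the affine map of [g]. *)
Definition shift x (c : Gam -> T) g := al g x * c g * x^-1.

Lemma shift_unit x c u v : twisted_unit c u v ->
  twisted_unit (shift x c) (fun w => u (w * x)) (fun w => v (x^-1 * w)).
Proof.
case=> cM uI vI UV VU; split=> [g h|g w|g w|t|t].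
- by rewrite /shift alA cM !alM act_byV !mulgA mulgKV.
- by rewrite /shift !mulgA mulgKV -alM uI.
- rewrite /shift !mulgA -invMg mulgKV -alM; have := vI g (w * x).
  by rewrite !invMg.
- rewrite -UV (reindex_inj (mulIg x^-1)) /=; apply: eq_bigr => y _.
  by rewrite mulgKV invMg invgK !mulgA mulVg mul1g.
rewrite -[RHS](_ : ((x^-1 * t * x)%g == 1%g)%:R = _)%R; last first.
  by rewrite -mulgA -conjgE conjg_eq1.
rewrite -VU (reindex_inj (mulgI x)) /=; apply: eq_bigr => y _.
by rewrite mulKg invMg !mulgA.
Qed.

Lemma shift_fix x c y : (forall g, al g y * shift x c g = y) ->
  forall g, al g (y * x) * c g = y * x.
Proof. by move=> Fy g; rewrite -{2}(Fy g) /shift alM !mulgA mulgKV. Qed.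

Section OneSystem.
Variables (c : Gam -> T) (u v : T -> R).
Hypothesis cuv : twisted_unit c u v.
Let cM := cocycle cuv.
Let uI := uinv cuv.
Let vI := vinv cuv.

(** The restriction of [phi] to [T]: the cocycle stands for [g^-1 * phi g]. *)
Definition twist_hom t := t * c (i t).

Lemma cocycle1 : c 1 = 1.
Proof. by apply: (mulgI (c 1)); rewrite -[X in X * _]al_id -cM !mulg1. Qed.

Lemma twist_homM : {morph twist_hom : x y / x * y}.
Proof. by move=> x y; rewrite /twist_hom iM cM al_i conjgE !mulgA mulgK. Qed.

Lemma twist_hom1 : twist_hom 1 = 1.
Proof. by apply: (mulgI (twist_hom 1)); rewrite -twist_homM !mulg1. Qed.

Lemma twist_homX n : {morph twist_hom : x / x ^+ n}.
Proof. by move=> x; elim: n => [|n IH]; rewrite ?expg0 ?twist_hom1 // !expgS twist_homM IH. Qed.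

(** Both sides come from expanding [c] at [i x * g = g * i (al g x)]. With [g * c g] read as
    [phi g], this is the compatibility of [phi] with conjugation by [g]. *)
Lemma twist_hom_act g x : twist_hom (al g x) = al g (twist_hom x) ^ c g.
Proof.
have Ec : c (i x * g) = c (g * i (al g x)) by rewrite i_al conjgE !mulgA mulgV mul1g.
move: Ec; rewrite !cM al_i => Ec.
rewrite {2}/twist_hom alM conjgE -mulgA (mulgA _ _ (c g)) -mulgA Ec conjgE /twist_hom.
by rewrite !mulgA mulgK mulVg mul1g.
Qed.

Lemma tw_i t x : al (i t) x * c (i t) = t^-1 * x * twist_hom t.
Proof. by rewrite al_i conjgE /twist_hom !mulgA. Qed.

Definition tw x g := al g x * c g.
Lemma tw1 : tw^~ 1 =1 id. Proof. by move=> x; rewrite /tw cocycle1 al_id mulg1. Qed.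
Lemma twM x : act_morph tw x.
Proof. by move=> g h; rewrite /tw cM alM alA mulgA. Qed.
Definition tw_action := TotalAction tw1 twM.

Lemma sum_unit : ((\sum_x u x) * (\sum_x v x) = 1)%R.
Proof.
transitivity (\sum_t \sum_x u x * v (x^-1 * t)%g)%R.
  rewrite exchange_big mulr_suml; apply: eq_bigr => x _.
  rewrite -mulr_sumr; congr (_ * _)%R.
  by rewrite [RHS](reindex_inj (mulgI x)); apply: eq_bigr => y _; rewrite mulKg.
under eq_bigr do rewrite (convUV cuv).
by rewrite (bigD1 1) //= eqxx big1 ?addr0 // => t /negbTE ->.
Qed.

Lemma Sylow_fix r (D : {group Gam}) : prime r -> r %| #|T| -> r.-group D ->
  exists x, forall d, d \in D -> al d x * c d = x.
Proof.
move=> r_pr rT rD.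
have actT : [acts D, on [set: T] | tw_action] by apply/actsP=> d _ x; rewrite !inE.
have uD d x : d \in D -> x \in [set: T] -> u (tw_action x d) = u x by move=> _ _; exact: uI.
have [s] := pgroup_sum_fix r_pr rD actT uD.
have [-> | [x Fx] _] := set_0Vmem 'Fix_([set: T] | tw_action)(D).
  rewrite big_set0 add0r => Es; have := sum_unit.
  rewrite (_ : (\sum_x u x = \sum_(x in [set: T]) u x)%R); last by apply: eq_bigl => x; rewrite inE.
  by rewrite Es -mulrA => /esym/(prime_nondvd r_pr rT).
by exists x; move=> d dD; case/setIP: Fx => _ /afixP; apply.
Qed.

Lemma u_phi t w : u (t^-1 * w) = u (w * (twist_hom t)^-1).
Proof. by rewrite -[RHS](uI (i t)) tw_i -!mulgA mulVg mulg1. Qed.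

Lemma u_fix d x : c d = 1 -> u (al d x) = u x.
Proof. by move=> cd; have := uI d x; rewrite cd mulg1. Qed.

Lemma v_fix d x : c d = 1 -> v (al d x) = v x.
Proof. by move=> cd; have := vI d x^-1; rewrite cd mulg1 act_byV !invgK. Qed.

(** The coefficient form of the identity [v * b * u = phi b]. *)
Lemma conv_conj b t : (\sum_x v x * u ((x * b)^-1 * t)%g = (t == twist_hom b)%:R)%R.
Proof.
rewrite eq_mulgV1 -(convVU cuv); apply: eq_bigr => x _.
by rewrite invMg -mulgA [in LHS]u_phi -mulgA.
Qed.

Lemma diag_to1 : (fun (w : T * T) g => (al g w.1, al g w.2))^~ 1 =1 id.
Proof. by case=> x y; rewrite /= !al_id. Qed.
Lemma diag_toM w : act_morph (fun (w : T * T) g => (al g w.1, al g w.2)) w.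
Proof. by move=> g h; rewrite /= !alA. Qed.
Definition diag_action := TotalAction diag_to1 diag_toM.

(* Count, modulo [r], the pairs with [w.1 * b * w.2] (respectively [b * w.2 * w.1]) in the
   class of [twist_hom b], weighted by [v w.1 * u w.2]: the totals are 1 and 0 if [b] is
   outside that class, but both sets have the same [D]-fixed pairs. *)
Lemma Brauer_conj r (D : {group Gam}) b : prime r -> r %| #|T| -> r.-group D ->
  {in D, forall d, c d = 1} -> {in D, forall d, al d b = b} ->
  exists2 y, {in D, forall d, al d y = y} & twist_hom b = b ^ y.
Proof.
move=> r_pr rT rD cD Db.
pose C := 'Fix_(lin_action)(D).
have CP y : reflect {in D, forall d, al d y = y} (y \in C).
  by apply: (iffP afixP) => Fy d /Fy.
pose cl t := [exists y in C, t == twist_hom b ^ y].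
have phiD d : d \in D -> al d (twist_hom b) = twist_hom b.
  by move=> dD; rewrite -[RHS](congr1 twist_hom (Db d dD)) twist_hom_act cD // conjg1.
have clD d t : d \in D -> cl (al d t) = cl t.
  move=> dD; apply: eq_existsb => y; apply: andb_id2l => /CP Fy.
  by rewrite -{1}(Fy d dD) -{1}(phiD d dD) -act_byJ (inj_eq (act_by_inj (g := d))).
have clJ x t : x \in C -> cl (t ^ x) = cl t.
  have CM y1 y2 : y1 \in C -> y2 \in C -> y1 * y2 \in C.
    by move=> /CP F1 /CP F2; apply/CP => d dD; rewrite alM F1 ?F2.
  have CV y : y \in C -> y^-1 \in C by move=> /CP F1; apply/CP => d dD; rewrite act_byV F1.
  move=> xC; apply/existsP/existsP => -[y /andP[yC /eqP Ey]].
    by exists (y * x^-1); rewrite CM ?CV //= conjgM -Ey conjgK.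
  by exists (y * x); rewrite CM //= conjgM -Ey.
have [/existsP[y /andP[yC /eqP Ey]] | ncl] := boolP (cl b).
  exists y^-1; first by move=> d dD; rewrite act_byV; move/CP: yC => ->.
  by rewrite [in RHS]Ey conjgK.
pose A1 := [set w : T * T | cl (w.1 * b * w.2)].
pose A2 := [set w : T * T | cl (b * w.2 * w.1)].
pose f (w : T * T) := (v w.1 * u w.2)%R.
have fD d w : d \in D -> f (diag_action w d) = f w.
  by move=> dD; rewrite /f /= u_fix ?v_fix ?cD.
have act1 : [acts D, on A1 | diag_action].
  by apply/actsP=> d dD w; rewrite !inE /= -{1}(Db d dD) -!alM clD.
have act2 : [acts D, on A2 | diag_action].
  by apply/actsP=> d dD w; rewrite !inE /= -{1}(Db d dD) -!alM clD.
have [s1] := pgroup_sum_fix r_pr rD act1 (fun d x dD _ => fD d x dD).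
have [s2] := pgroup_sum_fix r_pr rD act2 (fun d x dD _ => fD d x dD).
(* The first entry of a fixed pair lies in [C], and conjugation by it turns [w.1 * b * w.2] into
   [b * w.2 * w.1] inside the class. *)
have -> : 'Fix_(A1 | diag_action)(D) = 'Fix_(A2 | diag_action)(D).
  apply/setP => w; rewrite !in_setI; apply: andb_id2r => /afixP Fw.
  have w1C : w.1 \in C by apply/CP => d dD; exact: (congr1 fst (Fw d dD)).
  by rewrite !inE -(clJ w.1) // conjgE !mulgA mulVg mul1g.
have -> : (\sum_(w in A1) f w = 1)%R.
  transitivity (\sum_(t | cl t) \sum_x v x * u ((x * b)^-1 * t)%g)%R.
    rewrite exchange_big /= (eq_bigl (fun w => true && cl (w.1 * b * w.2))).
      rewrite -(pair_big_dep predT (fun x y => cl (x * b * y)) (fun x y => v x * u y)%R).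
      apply: eq_bigr => x _ /=.
      by rewrite (reindex_inj (mulgI (x * b)^-1)) /=; apply: eq_bigl => t; rewrite mulKVg.
    by move=> w; rewrite inE.
  under eq_bigr do rewrite conv_conj.
  rewrite (bigD1 (twist_hom b)) /=; last first.
    by apply/existsP; exists 1; rewrite conjg1 eqxx andbT; apply/CP => d _; rewrite act_by1.
  by rewrite eqxx big1 ?addr0 // => t /andP[_ /negbTE ->].
have -> : (\sum_(w in A2) f w = 0)%R.
  transitivity (\sum_(t | cl t) \sum_y u y * v (y^-1 * (b^-1 * t))%g)%R.
    rewrite exchange_big /= (eq_bigl (fun w => true && cl (b * w.2 * w.1))).
      rewrite (reindex_inj (h := fun w => (w.2, w.1))) /=; last by case=> ? ? [? ?] [-> ->].
      rewrite -(pair_big_dep predT (fun y x => cl (b * y * x)) (fun y x => v x * u y)%R).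
      apply: eq_bigr => y _ /=.
      rewrite (reindex_inj (mulgI (b * y)^-1)) /=; apply: eq_big => t.
        by rewrite mulKVg.
      by move=> _; rewrite invMg -mulgA [LHS]mulrC.
    by move=> w; rewrite inE.
  rewrite big1 // => t clt; rewrite (convUV cuv) -eq_mulVg1.
  by case: eqP => // bt; rewrite bt clt in ncl.
move=> /esym/(canRL (addrK _)); rewrite sub0r => -> /esym.
by rewrite addrC -mulrN -mulrDr => /esym /(prime_nondvd r_pr rT).
Qed.
End OneSystem.
End TwistedSystems.

(** * Elements of p-power order and the subgroup generated by [z] *)

Section CyclicPGroups.
Variables (T : finGroupType) (p : nat) (z : T).
Hypotheses (p_pr : prime p) (oz : #[z] = p).
Implicit Types x y w : T.

Lemma mem_cycle_prime x : #[x] = p -> (x \in <[z]>) = (<[x]> == <[z]>).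
Proof. by move=> ox; rewrite -cycle_subG eqEcard -!orderE ox oz leqnn andbT. Qed.

Lemma prime_power_order x k : x ^+ (p ^ k.+1) = 1 -> x ^+ (p ^ k) != 1 -> #[x] = (p ^ k.+1)%N.
Proof.
move=> x1 nx1; have := x1; move/eqP; rewrite -order_dvdn => /(dvdn_pfactor _ _ p_pr)[m lemk Ex].
rewrite Ex; congr (p ^ _)%N; apply/eqP; rewrite eqn_leq lemk ltnNge.
by apply: contra nx1 => lemk'; rewrite -order_dvdn Ex dvdn_exp2l.
Qed.

Lemma order_last x k : #[x] = (p ^ k.+1)%N -> #[x ^+ (p ^ k)] = p.
Proof.
by move=> ox; rewrite orderXdiv ox ?dvdn_exp2l // -expnB ?prime_gt0 // subSnn expn1.
Qed.

Lemma mem_last x k : #[x] = (p ^ k.+1)%N -> (z \in <[x]>) = (x ^+ (p ^ k) \in <[z]>).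
Proof.
move=> ox; have ol := order_last ox; rewrite mem_cycle_prime //.
apply/idP/idP => [zx | /eqP Ez]; last first.
  by rewrite -cycle_subG -Ez cycleX.
by rewrite (eq_subG_cyclic (cycle_cyclic x)) ?cycleX ?cycle_subG // -!orderE ol oz.
Qed.

(** A nontrivial subgroup of a cyclic p-group contains its only subgroup of order [p]. *)
Lemma mem_subcycle y e : p.-elt y -> z \in <[y]> -> e \in <[y]> -> e != 1 -> z \in <[e]>.
Proof.
move=> py zy ey e1; have pe : p.-elt e by apply: mem_p_elt py ey.
have [[|k] Ek] := p_natP pe; first by rewrite -order_eq1 Ek in e1.
rewrite (mem_last Ek) mem_cycle_prime ?(order_last Ek) //.
rewrite (eq_subG_cyclic (cycle_cyclic y)) ?cycle_subG ?groupX //.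
by rewrite -!orderE (order_last Ek) oz.
Qed.

(** The last nontrivial powers of [y] and [w] generate the same group of order [p], so a power of
    [y] cancels that of [w]. *)
Lemma cancel_last y w k : #[y] = (p ^ k.+1)%N -> #[w] = (p ^ k.+1)%N ->
  z \in <[y]> -> z \in <[w]> -> commute w y -> exists j, (y ^+ j * w) ^+ (p ^ k) = 1.
Proof.
move=> oy ow; rewrite (mem_last oy) (mem_last ow) !mem_cycle_prime ?order_last //.
move=> /eqP <- Ew cwy; have: (w ^+ (p ^ k))^-1 \in <[y ^+ (p ^ k)]>.
  by rewrite groupV -cycle_subG (eqP Ew).
case/cycleP=> j Ej; exists j; rewrite expgMn; last by apply/commute_sym/commuteX.
by rewrite -expgM mulnC expgM -Ej mulVg.
Qed.

Lemma pelt_comm_mul y w : p.-elt y -> p.-elt w -> commute w y -> p.-elt (y * w).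
Proof.
by move=> py pw cwy; apply: p_eltM => //; exact: commute_sym.
Qed.

(** While [z] lies in the cycle of [w], the power [s] of [y] of the same order as [w] can be used to
    lower the order of [w]. *)
Lemma remove_socle n y w : p.-elt y -> p.-elt w -> commute w y -> #[w] < #[y] ->
  z \in <[y]> -> #[w] <= n -> exists2 m, z \notin <[y ^+ m * w]> & #[y ^+ m * w] <= #[w].
Proof.
move=> py; elim: n w => [|n IH] w pw cwy ltwy zy lewn.
  by have := order_gt0 w; rewrite ltnNge lewn.
have [zw|nzw] := boolP (z \in <[w]>); last by exists 0%N; rewrite expg0 mul1g.
have [[|l] ow] := p_natP pw.
  have /eqP := ow; rewrite expn0 order_eq1 => /eqP w1; rewrite w1 cycle1 in zw.
  by have := oz; rewrite (set1P zw) order1 => p1; have := prime_gt1 p_pr; rewrite -p1.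
have [k oy] := p_natP py.
have lk : l.+1 < k by rewrite ow oy ltn_exp2l ?prime_gt1 in ltwy.
pose s := y ^+ (p ^ (k - l.+1)).
have os : #[s] = (p ^ l.+1)%N.
  rewrite /s orderXdiv oy ?dvdn_exp2l ?leq_subr // -expnB ?prime_gt0 ?leq_subr //.
  by rewrite subKn // ltnW.
have s1 : s != 1 by rewrite -order_eq1 os -(expn0 p) eqn_exp2l ?prime_gt1.
have zs : z \in <[s]> by apply: (mem_subcycle py zy _ s1); exact: mem_cycle.
have cws : commute w s by exact: commuteX.
have [j Ej] := cancel_last os ow zs zw cws.
have cw1 : commute (s ^+ j * w) y.
  by apply/commute_sym/commuteM; [do 2!apply: commuteX | exact: commute_sym].
have ps : p.-elt (s ^+ j * w).
  by apply: pelt_comm_mul => //; [do 2!apply: p_eltX | apply: commuteX].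
have lt1 : #[s ^+ j * w] < #[w].
  apply: (@leq_ltn_trans (p ^ l)); last by rewrite ow ltn_exp2l ?prime_gt1.
  by rewrite dvdn_leq ?expn_gt0 ?prime_gt0 // order_dvdn Ej.
have [||m nz le_m] // := IH _ ps cw1 _ zy.
- exact: ltn_trans lt1 ltwy.
- exact: leq_trans lt1 lewn.
exists (m + p ^ (k - l.+1) * j)%N; rewrite expgD expgM -mulgA //.
exact: leq_trans le_m (ltnW lt1).
Qed.

Section Factor.
Variables (NC : {group T}).
Hypothesis NCz : forall x, p.-elt x -> x \notin NC -> z \in <[x]>.

(** Otherwise some power [w'] of [w] has the order of [y]. If its cycle contains [z], multiplying
    [y] by a power of [w'] lowers the order of [y] without entering [NC], and induction applies. If
    not, [y * w'] lies outside [NC] although its cycle avoids [z], against [NCz]. *)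
Lemma order_cent_lt n y w : #[y] <= n -> p.-elt y -> p.-elt w -> y \notin NC -> w \in NC ->
  commute w y -> #[w] < #[y].
Proof.
elim: n y => [|n IH] y; first by rewrite leqNgt order_gt0.
move=> leyn py pw yN wN cwy; rewrite ltnNge; apply/negP => le_yw.
have zy := NCz py yN.
have [[|k] oy] := p_natP py.
  by have /eqP := oy; rewrite expn0 order_eq1 => /eqP y1; rewrite y1 group1 in yN.
have [l ow] := p_natP pw.
have lkl : k < l by rewrite ow oy leq_exp2l ?prime_gt1 in le_yw.
pose w' := w ^+ (p ^ (l - k.+1)).
have ow' : #[w'] = (p ^ k.+1)%N.
  rewrite /w' orderXdiv ow ?dvdn_exp2l ?leq_subr // -expnB ?prime_gt0 ?leq_subr //.
  by rewrite subKn.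
have cw'y : commute w' y by apply/commute_sym/commuteX.
have pw' : p.-elt w' by apply: p_eltX.
have w'N : w' \in NC by rewrite groupX.
have [zw | nzw] := boolP (z \in <[w']>).
  have [j Ej] := cancel_last ow' oy zw zy (commute_sym cw'y).
  have lt1 : #[w' ^+ j * y] < #[y].
    apply: (@leq_ltn_trans (p ^ k)); last by rewrite oy ltn_exp2l ?prime_gt1.
    by rewrite dvdn_leq ?expn_gt0 ?prime_gt0 // order_dvdn Ej.
  suff lt2 : #[w] < #[w' ^+ j * y].
    by have := leq_trans lt2 (leq_trans (ltnW lt1) le_yw); rewrite ltnn.
  apply: IH => //; first exact: leq_trans lt1 leyn.
  - by apply: p_eltM; rewrite ?p_eltX //; apply/commute_sym/commuteX/commute_sym.
  - by rewrite groupMl // groupX.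
  by apply: commuteM => //; apply: commuteX; apply: commuteX.
have ywN : y * w' \notin NC by rewrite groupMr.
have pyw : p.-elt (y * w') by exact: pelt_comm_mul.
have zyw := NCz pyw ywN.
have Eyw : (y * w') ^+ (p ^ k) = y ^+ (p ^ k) * w' ^+ (p ^ k).
  by rewrite expgMn //; exact: commute_sym.
have yk : y ^+ (p ^ k) \in <[z]> by rewrite -(mem_last oy).
have nyw : (y * w') ^+ (p ^ k) \notin <[z]>.
  by rewrite Eyw groupMl // -(mem_last ow').
have oyw : #[y * w'] = (p ^ k.+1)%N.
  apply: prime_power_order; last by apply: contraNneq nyw => ->.
  by rewrite expgMn; [rewrite -{1}oy -ow' !expg_order mulg1 | exact: commute_sym].
by rewrite -(mem_last oyw) zyw in nyw.
Qed.

(* Since [a] stabilizes the cyclic groups avoiding [z], it maps both [v] and [s * v] into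
   their own cycles; as [a] fixes [s], the two constraints together force [a v = v]. *)
Lemma socle_free_part y w : p.-elt y -> p.-elt w -> y \notin NC -> w \in NC -> commute w y ->
  exists2 m, z \notin <[y ^+ m * w]> &
  (forall a : T -> T, {morph a : x y / x * y} ->
    (forall x, z \notin <[x]> -> a x \in <[x]>) -> a y = y -> a w = w).
Proof.
move=> py pw yN wN cwy; have ltwy := order_cent_lt (leqnn _) py pw yN wN cwy.
have zy := NCz py yN.
have [m nzv lev] := remove_socle py pw cwy ltwy zy (leqnn _).
exists m => // a aM aS ay.
have a1 : a 1 = 1 by apply: (mulgI (a 1)); rewrite -aM !mulg1.
have aX n x : a (x ^+ n) = a x ^+ n.
  by elim: n => [|n IH]; rewrite ?expg0 ?a1 // !expgS aM IH.
move: nzv lev; have [v Ev] : exists v, v = y ^+ m * w by exists (y ^+ m * w).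
rewrite -Ev => nzv lev.
suff av : a v = v.
  by apply: (mulgI (y ^+ m)); rewrite -Ev -[RHS]av Ev aM aX ay.
have cvy : commute v y.
  by rewrite Ev; apply/commute_sym/commuteM; [exact: commuteX | exact: commute_sym].
have pv : p.-elt v by rewrite Ev; apply: pelt_comm_mul; rewrite ?p_eltX //; apply: commuteX.
have [[|l] ov] := p_natP pv.
  by have /eqP := ov; rewrite expn0 order_eq1 => /eqP ->.
have [k oy] := p_natP py.
have lk : l.+1 < k by have := leq_ltn_trans lev ltwy; rewrite ov oy ltn_exp2l ?prime_gt1.
pose s := y ^+ (p ^ (k - l.+1)).
have os : #[s] = (p ^ l.+1)%N.
  rewrite /s orderXdiv oy ?dvdn_exp2l ?leq_subr // -expnB ?prime_gt0 ?leq_subr //.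
  by rewrite subKn // ltnW.
have s1 : s != 1 by rewrite -order_eq1 os -(expn0 p) eqn_exp2l ?prime_gt1.
have zs : z \in <[s]> by apply: (mem_subcycle py zy _ s1); exact: mem_cycle.
have csv : commute s v by apply/commute_sym/commuteX.
have Esv n : (s * v) ^+ n = s ^+ n * v ^+ n by rewrite expgMn.
have nsv : (s * v) ^+ (p ^ l) \notin <[z]>.
  by rewrite Esv groupMl -?(mem_last os) // -(mem_last ov).
have sv1 : (s * v) ^+ (p ^ l.+1) = 1 by rewrite Esv -{1}os -ov !expg_order mulg1.
have osv : #[s * v] = (p ^ l.+1)%N.
  by apply: prime_power_order => //; apply: contraNneq nsv => ->.
have asv : a (s * v) \in <[s * v]> by apply: aS; rewrite (mem_last osv).
have /cycleP[f Ef] := aS v nzv.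
have cyV : v \in <[v]> by exact: cycle_id.
have /cycleP[e Ee] : a (s * v) * (s * v)^-1 \in <[s * v]>.
  by rewrite groupM ?groupV ?cycle_id.
have as_ : a s = s by rewrite aX ay.
have Ed : a v * v^-1 = (s * v) ^+ e.
  rewrite -Ee aM as_ invMg !mulgA Ef -(mulgA s) (_ : s * (v ^+ f * v^-1) = v ^+ f * v^-1 * s).
    by rewrite mulgK.
  by apply: commuteM; [exact: commuteX | exact/commuteV].
(* A nontrivial [s ^+ e] would have [z] in its cycle; but it equals [a v * v^-1 * v ^- e], which
   lies in the cycle of [v]. *)
have se1 : s ^+ e = 1.
  apply/eqP/negPn/negP => nse; case/negP: nzv.
  have : z \in <[s ^+ e]>.
    by apply: mem_subcycle (py) _ _ nse => //; rewrite groupX // mem_cycle.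
  apply: subsetP; rewrite cycle_subG -(mulgK (v ^+ e) (s ^+ e)) -Esv -Ed Ef.
  by rewrite !groupM ?groupV ?groupX.
apply/eqP; rewrite eq_mulgV1 Ed.
have /dvdnP[e' ->] : (p ^ l.+1 %| e)%N by rewrite -os order_dvdn se1.
by rewrite mulnC expgM sv1 expg1n.
Qed.
End Factor.
End CyclicPGroups.

Lemma coprime_inv_mod m n : coprime m n -> exists k, m * k = 1 %[mod n].
Proof.
move=> co; exists (chinese m n 0 1 %/ m)%N.
rewrite mulnC divnK ?(chinese_modr co) // /dvdn (chinese_modl co) mod0n //.
Qed.

(** * Finite groups in which every subgroup avoiding [z] is stable *)

Section Blackburn.
Variables (T Gam : finGroupType) (E : conj_action T Gam).
Local Notation al := (act_by E).
Local Notation i := (embed E).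
Variables (p : nat) (z : T).
Hypotheses (p_pr : prime p) (oz : #[z] = p).
Hypothesis BL : forall (K : {group T}) g x, z \notin K -> x \in K -> al g x \in K.

Local Notation B := 'O_p^'([set: T]).
Implicit Types (x y t b : T) (g : Gam).
Variable R : comUnitRingType.
Hypothesis nonunit : forall r, prime r -> r %| #|T| -> (r%:R)%R \isn't a @GRing.unit R.

Lemma stable_cycle g x : z \notin <[x]> -> al g x \in <[x]>.
Proof. by move=> nz; apply: BL nz _; exact: cycle_id. Qed.

Lemma normal_cycle x : z \notin <[x]> -> <[x]> <| [set: T].
Proof.
move=> nz; rewrite /normal subsetT; apply/subsetP=> t _.
rewrite inE -cycleJ cycle_subG -(act_by_embed E); exact: stable_cycle.
Qed.

Lemma p'elt_z x : p^'.-elt x -> z \notin <[x]>.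
Proof.
move=> p'x; apply/negP=> zx; have := mem_p_elt p'x zx.
by rewrite /p_elt oz p'natE // dvdnn.
Qed.

(** The cycle of a [pi]-element avoids [z], hence is a normal [pi]-subgroup. *)
Lemma mem_pi_core (pi : nat_pred) x : p \notin pi -> (x \in 'O_pi([set: T])) = pi.-elt x.
Proof.
move=> npi; apply/idP/idP => [xO | pix]; first exact: mem_p_elt (pcore_pgroup _ _) xO.
have p'x : p^'.-elt x by apply: sub_p_elt pix => q qpi; rewrite !inE; apply: contraNneq npi => <-.
have := pcore_max pix (normal_cycle (p'elt_z p'x)); rewrite cycle_subG; exact.
Qed.

Lemma mem_B x : (x \in B) = p^'.-elt x.
Proof. by rewrite mem_pi_core // !inE eqxx. Qed.

Lemma B_z b : b \in B -> z \notin <[b]>.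
Proof. by rewrite mem_B; exact: p'elt_z. Qed.

Lemma al_B g b : b \in B -> al g b \in B.
Proof. by move=> bB; have := stable_cycle g (B_z bB); apply: subsetP; rewrite cycle_subG. Qed.

Lemma al_Br g b : (al g b \in B) = (b \in B).
Proof. by apply/idP/idP=> [/(al_B g^-1)|/al_B //]; rewrite act_byK. Qed.

Lemma B_conj b t : b \in B -> b ^ t \in B.
Proof. by move=> bB; rewrite -(act_by_embed E) al_B. Qed.

Lemma coprime_normal_commute x y : z \notin <[x]> -> z \notin <[y]> ->
  coprime #[x] #[y] -> commute x y.
Proof.
move=> nx ny co; apply/commgP/eqP.
suff: [~ x, y] \in <[x]> :&: <[y]> by rewrite (coprime_TIg co) => /set1gP.
have [_ nX] := andP (normal_cycle nx); have [_ nY] := andP (normal_cycle ny).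
rewrite !inE; apply/andP; split.
  rewrite commgEl groupMl ?groupV ?cycle_id // memJ_norm ?cycle_id //.
  by rewrite (subsetP nX) ?inE.
rewrite commgEr groupMr ?cycle_id // memJ_norm ?groupV ?cycle_id //.
by rewrite (subsetP nY) ?inE.
Qed.

Lemma socle_free_commute x b : p.-elt x -> z \notin <[x]> -> b \in B -> commute x b.
Proof.
move=> px nzx bB; apply: (coprime_normal_commute nzx (B_z bB)).
by apply: (pnat_coprime px); rewrite mem_B in bB.
Qed.

(** The part of [x] prime to the order r of [b] commutes with [b] because both generate normal
    subgroups of coprime orders. The other part lies in the r-core, where the normal subgroup of
    order r meets the centre and so is central. *)
Lemma B_prime_central b x : b \in B -> prime #[b] -> x \in B -> commute x b.
Proof.
move=> bB; have [r ob] : exists r, #[b] = r by exists #[b].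
rewrite ob => r_pr xB.
have bp : r != p by apply: contraTneq bB => E0; rewrite mem_B /p_elt ob E0 p'natE // dvdnn.
rewrite -[x](consttC r); apply/commute_sym/commuteM; last first.
  apply: coprime_normal_commute; rewrite ?B_z ?groupX //.
  by rewrite ob; apply: pnat_coprime (pnat_id r_pr) (p_elt_constt _ _).
have rO : p \notin (r : nat_pred) by rewrite inE eq_sym.
have bO : b \in 'O_r([set: T]) by rewrite mem_pi_core // /p_elt ob pnat_id.
have xO : x.`_r \in 'O_r([set: T]) by rewrite mem_pi_core // p_elt_constt.
have sbO : <[b]> \subset 'O_r([set: T]) by rewrite cycle_subG.
have nbO : <[b]> <| 'O_r([set: T]) by apply: normalS (normal_cycle (B_z bB)); rewrite ?subsetT.
have bZ : <[b]> \subset 'Z('O_r([set: T])).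
  apply: prime_meetG; first by rewrite -orderE ob.
  rewrite meet_center_nil ?(pgroup_nil (pcore_pgroup _ _)) //.
  by rewrite cycle_eq1 -order_eq1 ob neq_ltn prime_gt1 ?orbT.
have /centerP[_ cb] : b \in 'Z('O_r([set: T])) by rewrite -cycle_subG.
exact: cb.
Qed.

Lemma B_quotient_pgroup : p.-group ([set: T] / B).
Proof.
apply/pgroupP=> q q_pr /(Cauchy q_pr)[X XT oX].
apply: contraT => qp; have [x nx _ EX] := morphimP XT.
have : x.`_q \in B.
  rewrite mem_B; apply: sub_p_elt (p_elt_constt q x) => q1; rewrite !inE => /eqP ->.
  by rewrite inE in qp.
move/coset_id; rewrite morph_constt // -EX constt_p_elt; last by rewrite /p_elt oX pnat_id.
by move=> X1; rewrite X1 order1 in oX; rewrite -oX in q_pr.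
Qed.

Lemma nBT x : x \in 'N(B).
Proof. by apply: (subsetP (gFnorm _ _)); rewrite inE. Qed.

Lemma B_Sylow_decomp (P : {group T}) x : p.-Sylow([set: T]) P ->
  exists b w, [/\ b \in B, w \in P & x = b * w].
Proof.
move=> sylP; have nBP : P \subset 'N(B) by apply/subsetP=> w _; exact: nBT.
have sylPB : p.-Sylow([set: T] / B) (P / B) by exact: quotient_pHall.
have EPB : P / B = [set: T] / B by apply: pHall_id sylPB B_quotient_pgroup.
have : [set: T] \subset B * P.
  by rewrite -quotientSK ?EPB //; apply/subsetP=> w _; exact: nBT.
by move/subsetP/(_ x); rewrite inE => /(_ isT)/mulsgP[b w bB wP ->]; exists b, w.
Qed.

Lemma coset_eqB x y : coset B x = coset B y -> x * y^-1 \in B.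
Proof.
by move/(rcoset_kercosetP (nBT x) (nBT y)); rewrite mem_rcoset.
Qed.

Lemma eq_cosetB x y : x * y^-1 \in B -> coset B x = coset B y.
Proof. by move=> xy; apply/(rcoset_kercosetP (nBT x) (nBT y)); rewrite mem_rcoset. Qed.

Lemma cosetM x y : coset B (x * y) = coset B x * coset B y.
Proof. by rewrite morphM ?nBT. Qed.

Lemma cosetJ x y : coset B (x ^ y) = coset B x ^ coset B y.
Proof. by rewrite morphJ ?nBT. Qed.

Definition al_bar g (X : coset_of B) := coset B (al g (fingroup.repr X)).

Lemma al_barE g x : al_bar g (coset B x) = coset B (al g x).
Proof.
apply: eq_cosetB; rewrite -act_byV -(act_byM E) al_Br; apply: coset_eqB.
by rewrite coset_reprK.
Qed.

Lemma al_barM g : {morph al_bar g : X Y / X * Y}.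
Proof.
move=> X Y; rewrite -[X]coset_reprK -[Y]coset_reprK -cosetM !al_barE.
by rewrite (act_byM E) cosetM.
Qed.

Definition al_barto X g := al_bar g X.
Lemma al_barto1 : al_barto^~ 1 =1 id.
Proof. by move=> X; rewrite -[X in LHS]coset_reprK /al_barto al_barE act_by_id coset_reprK. Qed.
Lemma al_bartoM X : act_morph al_barto X.
Proof.
by move=> g h; rewrite /al_barto -[X]coset_reprK !al_barE (act_byA E).
Qed.
Definition bar_action := TotalAction al_barto1 al_bartoM.

Definition solvable_system (c : Gam -> T) := exists x, forall g, al g x * c g = x.

Lemma solvable_shift x c : solvable_system (shift E x c) -> solvable_system c.
Proof. by case=> y Fy; exists (y * x); exact: shift_fix Fy. Qed.

Canonical embed_morphism := Morphism (in2W (embedM E) : {in [set: T] &, {morph i : x y / x * y}}).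

Lemma p_dvd_T : p %| #|T|.
Proof. by rewrite -cardsT -oz order_dvdG ?inE. Qed.

Lemma exists_Sylow_pair (r : nat) (Q : {group T}) : r.-group Q ->
  exists2 Pi : {group Gam}, r.-Sylow([set: Gam]) Pi & {in Q, forall w, i w \in Pi}.
Proof.
move=> rQ; have [|Pi sylPi sQPi] := @Sylow_superset r _ [set: Gam] (i @* Q) (subsetT _).
  exact: morphim_pgroup.
by exists Pi => // w wQ; rewrite (subsetP sQPi) // mem_morphim ?inE.
Qed.

(** The stabilizer contains a Sylow [r]-subgroup, so the length of the orbit is prime to [r]; [k] is
    the exponent used for averaging. *)
Lemma orbit_size_coprime (r : nat) (Pi : {group Gam}) (sT : finType)
    (to : {action Gam &-> sT}) o (X : finGroupType) (A : {group X}) :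
  prime r -> r.-Sylow([set: Gam]) Pi -> {in Pi, forall d, to o d = o} -> r.-group A ->
  exists k, #|orbit to [set: Gam] o| * k = 1 %[mod #|A|].
Proof.
move=> r_pr sylPi Fo rA; apply: coprime_inv_mod; rewrite coprime_sym.
apply: (pnat_coprime rA); rewrite card_orbit.
have sPS : Pi \subset 'C_([set: Gam])[o | to].
  by apply/subsetP=> d dPi; rewrite inE inE; apply/astab1P; exact: Fo.
by case/and3P: sylPi => _ _; apply: pnat_dvd; exact: indexgS.
Qed.

(* A Sylow subgroup has a fixed point, so after a shift the cocycle is trivial on it and
   central modulo [B]; averaging it over its orbit, of size prime to [p], makes it trivial
   modulo [B]. *)
Lemma p_step c (u v : T -> R) : twisted_unit E c u v -> exists x, forall g, shift E x c g \in B.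
Proof.
move=> cuv; have [P sylP] := Sylow_exists p [set: T].
have [Pi sylPi iP] := exists_Sylow_pair (pHall_pgroup sylP).
have [x0 Fx0] := Sylow_fix nonunit cuv p_pr p_dvd_T (pHall_pgroup sylPi).
have {cuv} := shift_unit x0 cuv.
set c' := shift E x0 c; set u' := fun w => _; set v' := fun w => _ => cuv.
have c'Pi d : d \in Pi -> c' d = 1 by move=> dPi; rewrite /c' /shift Fx0 // mulgV.
suff [t Ht] : exists t, forall g, shift E t c' g \in B.
  exists (t * x0) => g; move: (Ht g); rewrite /c' /shift (act_byM E).
  by rewrite invMg !mulgA.
have phiB b : b \in B -> twist_hom E c' b \in B.
  rewrite !mem_B /p_elt => p'b; apply: pnat_dvd p'b.
  by rewrite order_dvdn -(twist_homX cuv) expg_order (twist_hom1 cuv).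
(* [phi] fixes [P] pointwise, since the cocycle is trivial on [Pi], and it preserves [B]; as
   [T = B * P], it is trivial on the quotient. *)
have phi_bar t : coset B (twist_hom E c' t) = coset B t.
  have [b [w [bB wP ->]]] := B_Sylow_decomp t sylP.
  rewrite (twist_homM cuv) (cosetM (twist_hom E c' b)) (cosetM b).
  have -> : twist_hom E c' w = w by rewrite /twist_hom c'Pi ?mulg1 ?iP.
  by rewrite (coset_id (phiB b bB)) (coset_id bB).
(* Modulo [B], where [phi] is trivial, [twist_hom_act] says that conjugation by [c' g] fixes every
   element. *)
have cZ g : coset B (c' g) \in 'Z([set: T] / B).
  apply/centerP; split; first by rewrite mem_quotient ?inE.
  move=> X /morphimP[x _ _ ->] /=.
  have Ex := congr1 (coset B) (twist_hom_act cuv g (al g^-1 x)).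
  move: Ex; rewrite phi_bar cosetJ -(al_barE g (twist_hom E c' _)) phi_bar al_barE.
  rewrite act_byKV => Ex; apply/esym.
  by rewrite /commute conjgC -Ex.
pose O := orbit (tw_action cuv) [set: Gam] 1.
have OE o : o \in O -> exists g, o = c' g.
  by case/orbitP=> g _ <-; exists g; rewrite /= /tw act_by1 mul1g.
have [k kO] : exists k, #|O| * k = 1 %[mod #|'Z([set: T] / B)|].
  apply: (orbit_size_coprime p_pr sylPi); last exact: pgroupS (center_sub _) B_quotient_pgroup.
  by move=> d dPi; rewrite /= /tw act_by1 mul1g c'Pi.
have fA : {in O, forall o, coset B o \in 'Z([set: T] / B)} by move=> o /OE[g ->].
have abZ : abelian 'Z([set: T] / B) by exact: center_abelian.
pose a := affine_mean O (coset B) k abZ.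
have alZ g : {in 'Z([set: T] / B), forall X, al_bar g X \in 'Z([set: T] / B)}.
  move=> X /centerP[_ cX]; apply/centerP; split.
    by rewrite /al_bar mem_quotient ?inE.
  move=> _ /morphimP[y _ _ ->] /=; rewrite -[y](act_byKV E g) -al_barE.
  by rewrite /commute -!al_barM cX // mem_quotient ?inE.
have aF g : al_bar g a * coset B (c' g) = a.
  apply: (affine_mean_fix abZ fA kO (tau := fun o => tw_action cuv o g)) => //.
  - by move=> X Y _ _; exact: al_barM.
  - by move=> o oO; rewrite /O orbit_actr ?inE.
  - by move=> o1 o2 _ _; exact: act_inj.
  by move=> o _; rewrite /= /tw cosetM al_barE.
exists (fingroup.repr a) => g; apply: coset_eqB.
by rewrite cosetM -al_barE coset_reprK aF.
Qed.

(** * Cocycles with values in [B] *)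

Section NormalizedCocycle.
Variables (c : Gam -> T) (u v : T -> R).
Hypotheses (cuv : twisted_unit E c u v) (cB : forall g, c g \in B).

(** The affine maps preserve [B], whose order is prime to [p], so a p-group of them fixes a point of
    [B]. *)
Lemma B_step (Pi : {group Gam}) : p.-group Pi ->
  exists2 b, b \in B & {in Pi, forall d, shift E b c d = 1}.
Proof.
move=> pPi; pose to := tw_action cuv.
have actB : [acts Pi, on B | to].
  apply/actsP=> d _ b /=; rewrite /tw groupMr ?cB // al_Br //.
have := pgroup_fix_mod pPi actB.
have [-> | [b]] := set_0Vmem 'Fix_(B | to)(Pi).
  rewrite cards0 mod0n => B0; have := pcore_pgroup p^' [set: T].
  by rewrite /pgroup p'natE // /dvdn B0 eqxx.
case/setIP=> bB /afixP Fb _; exists b => // d dPi.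
by rewrite /shift; have := Fb d dPi; rewrite /= /tw => ->; rewrite mulgV.
Qed.

Local Notation ph := (twist_hom E c).

(** The case of a trivial group [D] in [Brauer_conj]: each element taken alone is conjugate to its
    image. *)
Lemma phi_class t : exists y, ph t = t ^ y.
Proof.
have c11 : {in 1%G, forall d, c d = 1} by move=> d /set1P ->; exact: cocycle1 cuv.
have t1 : {in 1%G, forall d, al d t = t} by move=> d /set1P ->; exact: act_by_id.
by have [y _ Ey] := Brauer_conj nonunit cuv p_pr p_dvd_T (pgroup1 _ p) c11 t1; exists y.
Qed.

Lemma conj_exp b t : b \in B -> exists j, b ^ t = b ^+ j.
Proof.
move=> bB; apply/cycleP; rewrite -(act_by_embed E); exact/stable_cycle/B_z.
Qed.

Lemma phi_exp b : b \in B -> exists j, ph b = b ^+ j.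
Proof. by move=> bB; have [y ->] := phi_class b; exact: conj_exp. Qed.

Lemma conj_expX b t j k : b ^ t = b ^+ j -> b ^ (t ^+ k) = b ^+ (j ^ k).
Proof.
move=> bt; elim: k => [|k IH]; first by rewrite expg0 conjg1 expn0 expg1.
by rewrite expgSr conjgM IH conjXg bt -expgM expnS.
Qed.

(** Both [g] and [x] act on the cycle of [b] by powers, and power maps commute. *)
Lemma al_conj b g x : b \in B -> b ^ al g x = b ^ x.
Proof.
move=> bB; have [j Ej] : exists j, al g^-1 b = b ^+ j by apply/cycleP/stable_cycle/B_z.
have [m Em] := conj_exp x bB; rewrite Em.
rewrite -{1}(act_byKV E g b) -act_byJ Ej conjXg Em -expgM mulnC expgM -Ej.
by rewrite act_byX act_byKV.
Qed.

(** The p'-part of [t] lies in [B], which centralizes elements of prime order of [B]. *)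
Lemma pcomp_conj b t : b \in B -> prime #[b] -> b ^ t.`_p = b ^ t.
Proof.
move=> bB b_pr; rewrite -[t in RHS](consttC p) conjgM.
have [j ->] := conj_exp t.`_p bB; rewrite conjXg; congr (_ ^+ _); apply/esym/conjg_fixP/commgP/commute_sym.
by apply: B_prime_central; rewrite // mem_B p_elt_constt.
Qed.

Lemma order_phi b x : b \in B -> ph b = b ^ x -> fingraph.order ph b = #|<[x]> : 'C_<[x]>[b]|.
Proof.
move=> bB Ex; have [j Ej] := conj_exp x bB.
have itE n : iter n ph b = b ^ (x ^+ n).
  elim: n => [|n IH]; first by rewrite expg0 conjg1.
  by rewrite iterS IH (conj_expX n Ej) (twist_homX cuv) Ex Ej -expgM (conj_expX n.+1 Ej) expnS.
rewrite index_cent1 /fingraph.order; apply: eq_card => y; apply/idP/imsetP.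
  by move=> /iter_findex <-; exists (x ^+ findex ph b y); rewrite ?itE // mem_cycle.
by case=> _ /cycleP[n ->] ->; rewrite -itE inE; exact: fconnect_iter.
Qed.

(** * Correcting [phi] on the elements of prime order of [B] *)

Section Core.
Variables (P : {group T}) (Pi : {group Gam}).
Hypotheses (sylP : p.-Sylow([set: T]) P) (sylPi : p.-Sylow([set: Gam]) Pi).
Hypothesis iP : {in P, forall w, i w \in Pi}.
Hypothesis cPi : {in Pi, forall d, c d = 1}.
Variable b : T.
Hypotheses (bB : b \in B) (b_pr : prime #[b]) (bphi : ph b != b).
Hypothesis bmax : forall b', b' \in B -> prime #[b'] ->
  fingraph.order ph b' <= fingraph.order ph b.

Let pP : p.-group P := pHall_pgroup sylP.
Let pPi : p.-group Pi := pHall_pgroup sylPi.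
Local Notation M := 'C[b].
Local Notation D := 'C_Pi[b | lin_action E].

Lemma sBM : B \subset M.
Proof. by apply/subsetP=> x xB; apply/cent1P/B_prime_central. Qed.

Lemma exists_D_fixed : exists y, [/\ p.-elt y, {in D, forall d, al d y = y} & ph b = b ^ y].
Proof.
have cD : {in D, forall d, c d = 1} by move=> d /setIP[/cPi].
have bD : {in D, forall d, al d b = b} by move=> d /setIP[_ /astab1P].
have pD : p.-group D by apply: pgroupS pPi; exact: subsetIl.
have [y Dy Ey] := Brauer_conj nonunit cuv p_pr p_dvd_T pD cD bD.
exists y.`_p; split; first exact: p_elt_constt.
  by move=> d dD; rewrite /constt act_byX Dy.
by rewrite pcomp_conj.
Qed.

Variable y : T.
Hypotheses (py : p.-elt y) (yD : {in D, forall d, al d y = y}) (Ey : ph b = b ^ y).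

(** If its cycle avoids [z], a p-element generates a normal subgroup of order prime to that of [b],
    hence commutes with [b]. *)
Lemma notin_M_z x : p.-elt x -> x \notin M -> z \in <[x]>.
Proof. by move=> px; apply: contraR => nzx; apply/cent1P/socle_free_commute. Qed.

Lemma yM : y \notin M.
Proof.
apply: contra bphi => /cent1P cyb; rewrite Ey; apply/eqP/conjg_fixP/commgP.
exact: commute_sym.
Qed.

Lemma PM_commute_y w : w \in P -> w \in M -> commute w y.
Proof.
move=> wP wM; have iwD : i w \in D.
  rewrite inE iP //=; apply/astab1P; rewrite /= /al_to act_by_embed.
  by apply/conjg_fixP/commgP/commute_sym/cent1P.
by apply/commute_sym/commgP/conjg_fixP; have := yD iwD; rewrite act_by_embed.
Qed.

Lemma PM_socle_free w : w \in P -> w \in M ->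
  exists2 m, z \notin <[y ^+ m * w]> & forall g, al g y = y -> al g w = w.
Proof.
move=> wP wM; have pw := mem_p_elt pP wP.
have [m nz Hm] := socle_free_part p_pr oz notin_M_z py pw yM wM (PM_commute_y wP wM).
by exists m => // g; apply: Hm; [exact: act_byM | move=> x; exact: stable_cycle].
Qed.

(** Conjugation by [w'] fixes [y], and [PM_socle_free] transfers this to [w]. *)
Lemma PM_commute w w' : w \in P -> w \in M -> w' \in P -> w' \in M -> commute w w'.
Proof.
move=> wP wM w'P w'M; have [m _ /(_ (i w'))] := PM_socle_free wP wM.
rewrite !act_by_embed => Hw; apply/commgP/conjg_fixP/Hw/conjg_fixP/commgP/commute_sym.
exact: PM_commute_y.
Qed.

Lemma M_decomp x : x \in M -> exists b' w, [/\ b' \in B, w \in P, w \in M & x = b' * w].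
Proof.
move=> xM; have [b' [w [b'B wP Ex]]] := B_Sylow_decomp x sylP.
exists b', w; split=> //; rewrite -(groupMl _ (subsetP sBM _ b'B)) -Ex //.
Qed.

(** An element conjugating [b * b'] to its image serves both factors: their cycles meet trivially
    and are stable under conjugation and [phi], so components can be compared. *)
Lemma exists_common_conj b' : b' \in B -> prime #[b'] ->
  exists x, [/\ p.-elt x, ph b = b ^ x & ph b' = b' ^ x].
Proof.
move=> b'B b'_pr; have [/cycleP[n En] | nbb'] := boolP (b' \in <[b]>).
  by exists y; split; rewrite // En (twist_homX cuv) Ey conjXg.
have tiBB : <[b']> :&: <[b]> = 1 by apply: prime_TIg; rewrite ?cycle_subG.
have [x Ex] := phi_class (b * b').
have [[j1 E1] [j2 E2]] := (phi_exp bB, phi_exp b'B).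
have [[k1 F1] [k2 F2]] := (conj_exp x bB, conj_exp x b'B).
move: Ex; rewrite (twist_homM cuv) conjMg => Ex.
have Exx : b' ^ x * (ph b')^-1 = (b ^ x)^-1 * ph b.
  by apply: (mulgI (b ^ x)); rewrite mulgA -Ex mulgK mulKVg.
have : b' ^ x * (ph b')^-1 \in <[b']> :&: <[b]>.
  rewrite inE {2}Exx F1 F2 E1 E2.
  by rewrite !groupM ?groupV ?mem_cycle.
rewrite tiBB => /set1gP X1; exists x.`_p.
rewrite p_elt_constt !pcomp_conj //; split=> //.
  by apply: (mulgI (b ^ x)^-1); rewrite -Exx X1 mulVg.
by apply: (mulIg (ph b')^-1); rewrite X1 mulgV.
Qed.

(** By [order_phi] the orbit lengths are indices of these centralizers. Subgroups of a cyclic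
    p-group form a chain, so the larger index gives the smaller subgroup. *)
Lemma cent_of_max b' x : b' \in B -> prime #[b'] -> p.-elt x -> ph b = b ^ x -> ph b' = b' ^ x ->
  'C_<[x]>[b] \subset 'C_<[x]>[b'].
Proof.
move=> b'B b'_pr px Ex Ex'; have := bmax b'B b'_pr.
rewrite (order_phi bB Ex) (order_phi b'B Ex') => le.
rewrite -(cardSg_cyclic (cycle_cyclic x)) ?subsetIl //.
have [k1 E1] := p_natP (pgroupS (subsetIl <[x]> 'C[b]) px).
have [k2 E2] := p_natP (pgroupS (subsetIl <[x]> 'C[b']) px).
rewrite E1 E2 dvdn_exp2l // -(leq_exp2l _ _ (prime_gt1 p_pr)) -E1 -E2.
have L1 := Lagrange (subsetIl <[x]> 'C[b]); have L2 := Lagrange (subsetIl <[x]> 'C[b']).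
rewrite -(leq_pmul2r (indexg_gt0 <[x]> 'C_<[x]>[b])) L1 -L2 leq_mul2l le orbT.
by [].
Qed.

Lemma eqn_exp_mod a n1 n2 : (a : T) ^+ n1 = a ^+ n2 -> n1 = n2 %[mod #[a]].
Proof. by move/eqP; rewrite eq_expg_mod_order => /eqP. Qed.

(** An element [x] inducing [phi] on both [b] and [b'] differs from [y] by an element of [M], whose
    p-part [e] raises [b'] to some power [F]. The point is that [F] is 1: [y ^+ m * e] commutes with
    [B] for some [m], and [x ^+ m] centralizes [b], hence [b'] by the choice of [b]. *)
Lemma conj_phi_of_max b' : b' \in B -> prime #[b'] ->
  ph b' = b' ^ y /\ (forall x, x \in M -> b' ^ x = b').
Proof.
move=> b'B b'_pr; have [x [px Ex Ex']] := exists_common_conj b'B b'_pr.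
have sCC := cent_of_max b'B b'_pr px Ex Ex'.
have [Y EY] := conj_exp y b'B.
have [j Ej] := conj_exp y bB.
have Bfix a : a \in B -> b' ^ a = b'.
  by move=> aB; apply/conjg_fixP/commgP/commute_sym/B_prime_central.
have socle w : w \in P -> w \in M -> exists F m, [/\ b' ^ w = b' ^+ F,
    (F * Y ^ m = 1 %[mod #[b']])%N, y ^+ m \in M & b' ^ (x ^+ m) = b'].
  move=> wP wM; have [F EF] := conj_exp w b'B.
  have [m nz _] := PM_socle_free wP wM; exists F, m.
  have pv : p.-elt (y ^+ m * w).
    apply: p_eltM; [exact/commute_sym/commuteX/PM_commute_y | exact: p_eltX |].
    exact: mem_p_elt pP wP.
  have ymM : y ^+ m \in M by rewrite -(groupMr _ wM); apply/cent1P/socle_free_commute.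
  split=> //.
    apply: eqn_exp_mod; rewrite expg1 mulnC expgM -(conj_expX m EY) -conjXg -EF -conjgM.
    rewrite (commuteX m (PM_commute_y wP wM)).
    by apply/conjg_fixP/commgP/commute_sym/socle_free_commute.
  suff : x ^+ m \in 'C_<[x]>[b'].
    by case/setIP=> _ /cent1P/commute_sym/commgP/conjg_fixP.
  apply: (subsetP sCC); rewrite inE mem_cycle; apply/cent1P/commute_sym/commgP/conjg_fixP.
  have Exj : b ^ x = b ^+ j by rewrite -Ex Ey.
  rewrite (conj_expX m Exj) -(conj_expX m Ej).
  by apply/conjg_fixP/commgP/commute_sym/cent1P.
have [e [eP eM Exe]] : exists e, [/\ e \in P, e \in M & b' ^ x = b' ^ (e * y)].
  have : x * y^-1 \in M.
    apply/cent1P/commute_sym/commgP/conjg_fixP.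
    by rewrite conjgM -Ex Ey conjgK.
  case/M_decomp=> a [e [aB eP eM Ee]]; exists e; split=> //.
  by rewrite -(mulgKV y x) Ee -mulgA conjgM (Bfix a aB).
have [F [m [EF FY ymM xm]]] := socle e eP eM.
have EX : b' ^ x = b' ^+ (F * Y)%N by rewrite Exe conjgM EF conjXg EY -expgM mulnC.
have FYm : ((F * Y) ^ m = 1 %[mod #[b']])%N.
  by apply: eqn_exp_mod; rewrite -(conj_expX m EX) xm.
(* Expand [F * (F * Y) ^ m] as [F ^ m * (F * Y ^ m)] and use that both bracketed factors of known
   value are 1. *)
have FF : (F ^ m = F %[mod #[b']])%N.
  rewrite -[F in RHS]muln1 -modnMmr -FYm modnMmr expnMn mulnCA -modnMmr FY modnMmr muln1.
  by [].
have FFn n : (F ^ (m ^ n) = F %[mod #[b']])%N.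
  elim: n => [|n IH]; first by rewrite expn0 expn1.
  by rewrite expnSr expnM -modnXm IH modnXm.
(* Otherwise [y ^+ m], which lies in [M], would generate the same cycle as [y], which does not.
   Iterating [F ^ m = F] then reaches an exponent divisible by the order of [e]. *)
have pm : p %| m.
  rewrite -[_ %| _]negbK -prime_coprime //; apply: contra yM => co.
  rewrite -cycle_subG (_ : <[y]> = <[y ^+ m]>) ?cycle_subG //.
  apply/eqP; have [k Ek] := p_natP py.
  by rewrite -[_ == _]/(generator _ _) generator_coprime Ek coprimeXl.
have F1 : (F = 1 %[mod #[b']])%N.
  have [n En] := p_natP (mem_p_elt pP eP).
  rewrite -(FFn n); have /dvdnP[k ->] : (p ^ n %| m ^ n)%N by rewrite dvdn_exp2r.
  have Fpn : (F ^ (p ^ n) = 1 %[mod #[b']])%N.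
    by apply: eqn_exp_mod; rewrite -(conj_expX _ EF) -En expg_order conjg1 expg1.
  by rewrite mulnC expnM -modnXm Fpn modnXm exp1n.
have EX' : b' ^ x = b' ^ y.
  rewrite EX EY; apply/eqP; rewrite eq_expg_mod_order -modnMml F1 modnMml mul1n.
  by [].
split; first by rewrite Ex'.
move=> x1 /M_decomp[a [w [aB wP wM ->]]]; rewrite conjgM Bfix //.
have [F' [m' [-> FY' _ xm']]] := socle w wP wM.
have Y1 : (Y ^ m' = 1 %[mod #[b']])%N.
  by apply: eqn_exp_mod; rewrite expg1 -(conj_expX m' (etrans EX' EY)) xm'.
apply/eqP; rewrite -{2}[b']expg1 eq_expg_mod_order; apply/eqP.
by rewrite -FY' -modnMmr Y1 modnMmr muln1.
Qed.

Lemma M_fix x : (x \in M) = (b ^ x == b).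
Proof.
apply/idP/eqP => [/cent1P/commute_sym/commgP/conjg_fixP // | Hx].
by apply/cent1P/commute_sym/commgP/conjg_fixP.
Qed.

Lemma al_M g x : x \in M -> al g x \in M.
Proof. by rewrite !M_fix al_conj. Qed.

Lemma cosetM_commute x x' : x \in M -> x' \in M -> commute (coset B x) (coset B x').
Proof.
case/M_decomp=> a [w [aB wP wM ->]] /M_decomp[a' [w' [a'B w'P w'M ->]]].
rewrite !cosetM (coset_id aB) (coset_id a'B) !mul1g /commute -!cosetM.
by rewrite (PM_commute wP wM w'P w'M).
Qed.

Lemma cosety_commute x : x \in M -> commute (coset B y) (coset B x).
Proof.
case/M_decomp=> a [w [aB wP wM ->]]; rewrite cosetM (coset_id aB) mul1g /commute -!cosetM.
by rewrite (PM_commute_y wP wM).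
Qed.

Lemma D_fix_coset d x : d \in D -> x \in M -> coset B (al d x) = coset B x.
Proof.
move=> dD /M_decomp[a [w [aB wP wM ->]]]; rewrite (act_byM E) !cosetM.
have [m _ ->] := PM_socle_free wP wM; last exact: yD.
by rewrite (coset_id aB) (coset_id (al_B d aB)).
Qed.

(** [D] is the kernel of the action of [Pi] on the cycle of [b], whose automorphism group is cyclic
    because [b] has prime order. *)
Lemma Pi_mod_D : exists2 h, h \in Pi & forall d, d \in Pi -> exists n, d * h ^- n \in D.
Proof.
pose rho g := restr_perm <[b]> (actperm (lin_action E) g).
have Nb g : actperm (lin_action E) g \in 'N(<[b]> | 'P).
  apply/astabsP=> x; rewrite /= apermE actpermE /= /al_to.
  apply/idP/idP => [|xb]; last first.
    by apply: (BL g _ xb); exact: B_z.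
  by move/(BL g^-1 (B_z bB)); rewrite act_byK.
have rhoM : {in [set: Gam] &, {morph rho : g h / g * h}}.
  by move=> g h _ _; rewrite /rho actpermM ?inE // (morphM (restr_perm_morphism _)).
pose rhom := Morphism rhoM.
have AutT g : actperm (lin_action E) g \in Aut [set: T].
  rewrite inE; apply/andP; split; first by apply/subsetP=> x; rewrite inE.
  by apply/morphicP=> x x' _ _; rewrite !actpermE /= /al_to (act_byM E).
have cycA : cyclic (rhom @* Pi).
  apply: cyclicS (Aut_prime_cyclic (G := <[b]>) _); last by rewrite -orderE.
  by apply/subsetP=> _ /morphimP[g _ _ ->]; exact: (Aut_restr_perm (subsetT _) (AutT g)).
case/cyclicP: cycA => q0 Eq0.
have : q0 \in rhom @* Pi by rewrite Eq0 cycle_id.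
case/morphimP=> h _ hPi Eh; exists h => // d dPi.
have : rhom d \in <[q0]> by rewrite -Eq0 mem_morphim ?inE.
case/cycleP=> n En; exists n; rewrite inE groupM ?groupV ?groupX //=; apply/astab1P.
have : rhom (d * h ^- n) = 1 by rewrite morphM ?morphV ?morphX ?inE // En -Eh mulgV.
move/(congr1 (fun s : {perm T} => s b)); rewrite /= /rho restr_permE ?cycle_id // actpermE perm1.
by [].
Qed.

Section Twist.
Variable h : Gam.
Hypothesis hPi : h \in Pi.

(** The twisted commutators of [M] modulo [B]; they form a group because [M / B] is abelian. *)
Let inY t := [exists e in M, coset B t == coset B (e^-1 * al h e)].

Lemma inYP t : reflect (exists2 e, e \in M & coset B t = coset B (e^-1 * al h e)) (inY t).
Proof.
apply: (iffP existsP) => [[e /andP[eM /eqP]] | [e eM Ee]]; first by exists e.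
by exists e; rewrite eM Ee eqxx.
Qed.

Lemma inYM x t : x \in M -> inY (x^-1 * al h x * t) = inY t.
Proof.
have sub x1 t1 : x1 \in M -> inY t1 -> inY (x1^-1 * al h x1 * t1).
  move=> xM /inYP[e eM Ee]; apply/inYP; exists (x1 * e); first by rewrite groupM.
  have dM : x1^-1 * al h x1 \in M by rewrite groupM ?groupV ?al_M.
  have -> : (x1 * e)^-1 * al h (x1 * e) = e^-1 * (x1^-1 * al h x1) * al h e.
    by rewrite invMg (act_byM E) !mulgA.
  rewrite [in LHS]cosetM Ee (cosetM (e^-1 * _)) (cosetM e^-1 (_ * _)) (cosetM e^-1).
  by rewrite (cosetM_commute (groupVr eM) dM) mulgA.
move=> xM; apply/idP/idP; last exact: sub.
move/(sub _ _ (groupVr xM)); rewrite invgK act_byV; rewrite /inY (_ : coset B _ = coset B t) //.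
rewrite cosetM (cosetM x) (cosetM_commute xM) ?groupV ?al_M // -!cosetM.
by rewrite !mulgA mulgK mulVg mul1g.
Qed.

(** A pair stands for a term of the product [u * v]: the entries move like the supports of [u] and
    [v], and their product is conjugated by [t]. *)
Let to (w : T * T) (t : T) := (t^-1 * w.1 * ph t, (ph t)^-1 * w.2 * t).

Lemma pair_to1 : to^~ 1 =1 id.
Proof. by case=> x x'; rewrite /to /= (twist_hom1 cuv) invg1 !mul1g !mulg1. Qed.
Lemma pair_toM w : act_morph to w.
Proof. by move=> t s; rewrite /to /= (twist_homM cuv) !invMg !mulgA. Qed.
Definition pair_action := TotalAction pair_to1 pair_toM.

Let f (w : T * T) := (u w.1 * v w.2)%R.

Lemma pair_weight w t : f (pair_action w t) = f w.
Proof.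
rewrite /f /= -(tw_i E c) (uinv cuv); congr (_ * _)%R.
by have := vinv cuv (i t) (w.2)^-1; rewrite (tw_i E c) invgK !invMg !invgK mulgA.
Qed.

Lemma fix_pairP w : reflect (pair_action w b = w) (w \in 'Fix_pair_action(<[b]>)).
Proof.
by rewrite afix_cycle ?in_setT //; exact: afix1P.
Qed.

(** Summing over all pairs collects coefficients of [u * v = 1], so only the element 1 counts; pairs
    moved by [b] cancel modulo the order of [b]. *)
Lemma sum_pairs s : exists r,
  ((inY s^-1)%:R = \sum_(w in 'Fix_([set w : T * T | inY (s^-1 * (w.1 * w.2))] | pair_action)(<[b]>)) f w
     + #[b]%:R * r)%R.
Proof.
set A := [set w : T * T | _].
have actA : [acts <[b]>, on A | pair_action].
  apply/actsP=> t tb w; rewrite !inE /=.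
  have tB : t \in B by move: tb; apply: subsetP; rewrite cycle_subG.
  rewrite (_ : _ * _ * _ * _ = t^-1 * (w.1 * w.2) * t); last first.
    by move: (ph t) => pt; rewrite !mulgA mulgK.
  rewrite /inY !cosetM (coset_id tB) (coset_id (groupVr tB)) mul1g mulg1.
  by [].
have qb : #[b].-group <[b]> by rewrite /pgroup -orderE pnat_id.
have [r Er] := pgroup_sum_fix b_pr qb actA (fun t w _ _ => pair_weight w t).
exists r; rewrite -Er.
transitivity (\sum_(t | inY (s^-1 * t)%g) \sum_x u x * v (x^-1 * t)%g)%R.
  under eq_bigr do rewrite (convUV cuv).
  have [Y1 | nY1] := boolP (inY s^-1).
    by rewrite (bigD1 1) ?mulg1 //= eqxx big1 ?addr0 // => t /andP[_ /negbTE ->].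
  rewrite big1 // => t Yt; case: eqP => // t1.
  by rewrite t1 mulg1 (negbTE nY1) in Yt.
rewrite exchange_big /= (eq_bigl (fun w : T * T => true && inY (s^-1 * (w.1 * w.2)))).
  rewrite -(pair_big_dep predT (fun x x' => inY (s^-1 * (x * x'))%g) (fun x x' => u x * v x')%R).
  apply: eq_bigr => x _ /=.
  by rewrite [RHS](reindex_inj (mulgI x^-1)) /=; apply: eq_bigl => t; rewrite mulKVg.
by move=> w; rewrite inE.
Qed.

(* Both [x] and [al h x] conjugate [b] to [ph b] for the [b]-fixed pairs [(x, x')], so the
   weighted counts of [sum_pairs 1] and [sum_pairs w] agree modulo [#[b]]; hence [w^-1],
   like 1, is a twisted commutator modulo [B]. *)
Lemma twist_coset : exists2 e, e \in M & coset B (al h (y * e)) = coset B (y * e).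
Proof.
have [w Ew] : exists w, w = y^-1 * al h y by exists (y^-1 * al h y).
have wM : w \in M by rewrite Ew M_fix conjgM al_conj ?B_conj // conjgKV.
suff /inYP[e eM Ee] : inY w^-1.
  exists e => //; have -> : al h (y * e) = y * w * al h e.
    by rewrite (act_byM E) Ew mulKVg.
  have -> : coset B (y * w * al h e) = coset B (y * (w * e) * (e^-1 * al h e)).
    by rewrite !mulgA mulgK.
  rewrite cosetM -Ee (cosetM y) (cosetM w) (cosetM_commute wM eM) -!cosetM.
  by rewrite !mulgA mulgK.
have [r1 E1] := sum_pairs 1; have [r2 E2] := sum_pairs w.
apply: contraT => nYw.
have Y1 : inY 1^-1.
  by apply/inYP; exists 1; rewrite ?group1 // act_by1 mulg1.
have qT : #[b] %| #|T| by rewrite -cardsT order_dvdG ?inE.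
case: (prime_nondvd nonunit b_pr qT (s := (r1 - r2)%R)).
have /= := congr2 (fun r s => r - s)%R E1 E2; rewrite Y1 (negbTE nYw) subr0.
set S1 := (\sum_(w0 in _) f w0)%R; set S2 := (\sum_(w0 in _) f w0)%R.
suff -> : S1 = S2 by rewrite opprD addrACA subrr add0r -mulrBr.
(* Applying [al h] to the first entry preserves the weight, since [c h] is trivial, and matches the
   fixed pairs for 1 with those for [w]. *)
rewrite {}/S1 {}/S2 [RHS](reindex_inj (h := fun x : T * T => (al h x.1, x.2))) /=; last first.
  by case=> x1 x2 [x1' x2'] [/act_by_inj -> ->].
have fstE x : (b^-1 * x * ph b == x) = (b ^ x == ph b).
  move: (ph b) => pt; rewrite conjgE; apply/eqP/eqP => [Ex | <-].
    by rewrite -{2}Ex !mulgA mulgK mulVg mul1g.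
  by rewrite !mulgA mulgK mulVg mul1g.
have fixE x x' : ((x, x') \in 'Fix_pair_action(<[b]>)) =
    (b ^ x == ph b) && ((ph b)^-1 * x' * b == x').
  by rewrite -fstE -xpair_eqE; apply/fix_pairP/eqP.
apply: eq_big => [[x x']|[x x'] _]; last by rewrite /f /= (u_fix cuv) ?cPi.
rewrite !in_setI !fixE al_conj //; apply: andb_id2r => /andP[/eqP Exb _].
rewrite !inE invg1 mul1g /=.
have [m mM Ex] : exists2 m, m \in M & x = y * m.
  exists (y^-1 * x); last by rewrite mulKVg.
  have -> : y^-1 * x = al (i y) (x * y^-1) by rewrite act_by_embed conjgE !mulgA mulgKV.
  by rewrite al_M // M_fix conjgM Exb Ey conjgK.
have -> : w^-1 * (al h x * x') = w^-1 * y * w * (al h m * m^-1) * y^-1 * (x * x').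
  by rewrite [in LHS]Ex (act_byM E) -{1}(mulKVg y (al h y)) -Ew Ex !mulgA mulgKV mulgKV.
have mM' : al h m * m^-1 \in M by rewrite groupM ?groupV ?al_M.
suff Ec : coset B (w^-1 * y * w * (al h m * m^-1) * y^-1) = coset B (m^-1 * al h m).
  by rewrite -[LHS](inYM (x * x') mM) /inY cosetM [in RHS]cosetM Ec.
rewrite -(mulgA _ _ y^-1) cosetM (_ : coset B (w^-1 * y * w) = coset B y).
  rewrite -cosetM mulgA cosetM (cosetM y) (cosety_commute mM') -!cosetM mulgK.
  by rewrite cosetM (cosetM_commute _ (groupVr mM)) ?al_M // -cosetM.
by rewrite -mulgA cosetM (cosetM y) (cosety_commute wM) -!cosetM mulKg.
Qed.
End Twist.

(** Modulo [D], every element of [Pi] is a power of [h]; and [D] fixes [y] as well as the image of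
    [M] modulo [B]. *)
Lemma Pi_fixed_coset : exists2 e, e \in M & {in Pi, forall d, coset B (al d (y * e)) = coset B (y * e)}.
Proof.
have [h hPi Hh] := Pi_mod_D; have [e eM Ee] := twist_coset hPi; exists e => // d dPi.
have [n dn] := Hh d dPi.
have hn k : coset B (al (h ^+ k) (y * e)) = coset B (y * e).
  elim: k => [|k IH]; first by rewrite expg0 act_by_id.
  by rewrite expgSr (act_byA E) -al_barE IH al_barE.
rewrite -(mulgKV (h ^+ n) d) (act_byA E) -al_barE (_ : coset B (al _ (y * e)) = coset B (y * e)).
  by rewrite al_barE hn.
by rewrite (act_byM E) cosetM (yD dn) (D_fix_coset dn eM) -cosetM.
Qed.

(** The orbit of [y * e] modulo [B] stays in one coset of [M / B], inside an abelian p-group, and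
    its length is prime to [p]. Its barycentre lies in the same coset, so it differs from [y] by an
    element of [M] only. *)
Lemma Gam_fixed_coset : exists2 e, e \in M & forall g, coset B (al g (y * e)) = coset B (y * e).
Proof.
have [e eM Fe] := Pi_fixed_coset.
pose A := (<[coset B (y * e)]> <*> (M / B))%G.
pose O := orbit bar_action [set: Gam] (coset B (y * e)).
have abM : abelian (M / B).
  by apply/centsP=> _ /morphimP[x1 _ x1M ->] _ /morphimP[x2 _ x2M ->]; exact: cosetM_commute.
have cyM x : x \in M -> commute (coset B (y * e)) (coset B x).
  move=> xM; apply/commute_sym; rewrite cosetM; apply: commuteM.
    exact/commute_sym/cosety_commute.
  exact: cosetM_commute.
have abA : abelian A.
  rewrite abelianY cycle_abelian abM /= cent_cycle.
  by apply/subsetP=> _ /morphimP[x _ xM ->]; apply/cent1P/commute_sym/cyM.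
have pA : p.-group A.
  by apply: pgroupS B_quotient_pgroup; rewrite join_subG cycle_subG quotientS ?mem_quotient ?inE ?subsetT.
have OE X : X \in O -> exists2 x, x \in M & X = coset B (y * e * x).
  case/orbitP=> g _ <-; exists ((y * e)^-1 * al g (y * e)); last by rewrite mulKVg /= /al_barto al_barE.
  by rewrite M_fix conjgM al_conj ?B_conj // conjgKV.
have sMA : M / B \subset A by exact: joing_subr.
have yeA : coset B (y * e) \in A by rewrite mem_gen // inE cycle_id.
have fA : {in O, forall X, id X \in A}.
  by move=> X /OE[x xM ->]; rewrite cosetM groupM // (subsetP sMA) // mem_quotient.
have [k kO] : exists k, #|O| * k = 1 %[mod #|A|].
  by apply: (orbit_size_coprime p_pr sylPi) pA => d dPi; rewrite /= /al_barto al_barE Fe.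
pose a := affine_mean O id k abA.
have alA g : {in A, forall X, al_bar g X \in A}.
  move=> X XA; have: X \in <[coset B (y * e)]> * (M / B).
    rewrite -cent_joinEr ?cent_cycle //.
    by apply/subsetP=> _ /morphimP[x _ xM ->]; apply/cent1P/commute_sym/cyM.
  case/mulsgP=> _ _ /cycleP[n ->] /morphimP[x _ xM ->] ->.
  have al_barX Y j : al_bar g (Y ^+ j) = al_bar g Y ^+ j.
    rewrite -[Y]coset_reprK -morphX ?nBT // !al_barE act_byX morphX ?nBT //.
  rewrite al_barM al_barX groupM ?groupX //; last first.
    by rewrite al_barE (subsetP sMA) // mem_quotient // al_M.
  have : al_bar g (coset B (y * e)) \in O by apply/orbitP; exists g; rewrite ?inE.
  by case/OE=> x' x'M ->; rewrite cosetM groupM // (subsetP sMA) // mem_quotient.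
have aF g : al_bar g a = a.
  rewrite -[LHS]mulg1; apply: (affine_mean_fix abA fA kO (tau := fun X => bar_action X g)) => //.
  - by move=> X Y _ _; exact: al_barM.
  - by move=> X XO; rewrite /O orbit_actr ?inE.
  - by move=> X Y _ _; exact: act_inj.
  by move=> X _; rewrite /= mulg1.
have : a \in coset B (y * e) *: (M / B).
  apply: affine_mean_lcoset => // X /OE[x xM ->].
  by rewrite cosetM mem_lcoset mulKg mem_quotient.
case/lcosetP=> _ /morphimP[x _ xM ->] Ea; exists (e * x); first by rewrite groupM.
by move=> g; rewrite mulgA cosetM -Ea -[RHS](aF g) Ea -cosetM al_barE.
Qed.
End Core.

Lemma phi_shift x t : twist_hom E (shift E x c) t = x * ph t * x^-1.
Proof. by rewrite /twist_hom /shift act_by_embed conjgE !mulgA mulgV mul1g. Qed.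

(** Shifting conjugates [phi] by [(y * e)^-1]. The cocycle stays in [B] because the coset of [y * e]
    is invariant, and [phi] becomes trivial on elements of prime order because [y] induces it there
    while [e] centralizes them. *)
Lemma core_step (P : {group T}) (Pi : {group Gam}) :
  p.-Sylow([set: T]) P -> p.-Sylow([set: Gam]) Pi ->
  {in P, forall w, i w \in Pi} -> {in Pi, forall d, c d = 1} ->
  exists y, (forall g, shift E y c g \in B) /\
    (forall b, b \in B -> prime #[b] -> twist_hom E (shift E y c) b = b).
Proof.
move=> sylP sylPi iP cPi.
have [/existsP[b1 /and3P[b1B b1_pr b1phi]] | triv] :=
  boolP [exists b, [&& b \in B, prime #[b] & ph b != b]]; last first.
  exists 1; split=> [g|b bB b_pr]; first by rewrite /shift act_by1 mul1g invg1 mulg1.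
  rewrite phi_shift mul1g invg1 mulg1; apply/eqP; apply: contraNT triv => nb.
  by apply/existsP; exists b; rewrite bB b_pr.
pose Q b := [&& b \in B, prime #[b] & ph b != b].
have Qb1 : Q b1 by rewrite /Q b1B b1_pr.
case: (@arg_maxnP _ b1 Q (fingraph.order ph) Qb1) => b /and3P[bB b_pr bphi] bmax.
have bmax' b' : b' \in B -> prime #[b'] -> fingraph.order ph b' <= fingraph.order ph b.
  move=> b'B b'_pr; have [b'phi | nb'] := eqVneq (ph b') b'; last by apply: bmax; rewrite /Q b'B b'_pr.
  rewrite (order_phi b'B (x := 1)) ?conjg1 //.
  by rewrite cycle1 (trivgP (subsetIl 1 'C[b'])) indexgg fingraph.order_gt0.
have [y [py yD Ey]] := exists_D_fixed sylPi cPi bB b_pr.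
have [e eM Fe] := Gam_fixed_coset sylP sylPi iP cPi bB b_pr bphi py yD Ey.
exists (y * e); split=> [g|b' b'B b'_pr].
  have -> : shift E (y * e) c g = al g (y * e) * (y * e)^-1 * c g ^ (y * e)^-1.
    by rewrite /shift; move: (y * e) => t; rewrite conjgE invgK !mulgA mulgKV.
  by rewrite groupM ?B_conj ?coset_eqB.
have [Ey' Me] := conj_phi_of_max sylP iP bB b_pr bphi bmax' py yD Ey b'B b'_pr.
have [j Ej] := conj_exp y b'B.
rewrite phi_shift Ey' -[b' ^ y](_ : b' ^ (y * e) = _); last by rewrite conjgM Ej conjXg Me.
by move: (y * e) => t; rewrite conjgE !mulgA mulgV mul1g mulgK.
Qed.

(** * The primary component of the cocycle for a prime other than [p] *)

Section PrimaryPart.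
Variable r : nat.
Hypotheses (r_pr : prime r) (rp : r != p) (rT : r %| #|T|).
Local Notation Br := 'O_r([set: T]).

Lemma p_notin_r : p \notin (r : nat_pred).
Proof. by rewrite inE eq_sym. Qed.

Lemma mem_Br x : (x \in Br) = r.-elt x.
Proof. by rewrite mem_pi_core ?p_notin_r. Qed.

Lemma sBrB : Br \subset B.
Proof.
apply/subsetP=> x; rewrite mem_Br mem_B; apply: sub_p_elt => q.
by rewrite !inE => /eqP ->.
Qed.

Lemma al_Br_in g x : x \in Br -> al g x \in Br.
Proof.
move=> xBr; have := stable_cycle g (B_z (subsetP sBrB x xBr)).
by apply: subsetP; rewrite cycle_subG.
Qed.

(** Fixing the elements of order [r] makes the exponent [k] congruent to 1 modulo [r], and
    [expn_eq1_mod] lifts this to the order of [x]. *)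
Lemma cyclic_aut_trivial (f : T -> T) x k n : x \in Br -> {morph f : a b / a * b} ->
  f x = x ^+ k -> iter n f x = x -> ~~ (r %| n) -> f (x ^+ (#[x] %/ r)) = x ^+ (#[x] %/ r) -> f x = x.
Proof.
move=> xBr fM fx itx rn f0.
have f1 : f 1 = 1 by apply: (mulgI (f 1)); rewrite -fM !mulg1.
have fX a j : f (a ^+ j) = f a ^+ j.
  by elim: j => [|j IH]; rewrite ?expg0 ?f1 // !expgS fM IH.
have itE j : iter j f x = x ^+ (k ^ j).
  elim: j => [|j IH]; first by rewrite expn0 expg1.
  by rewrite iterS IH fX fx -expgM expnS.
have := xBr; rewrite mem_Br => /p_natP[[|m] ox].
  by have /eqP := ox; rewrite expn0 order_eq1 => /eqP ->.
have kr : k = 1 %[mod r].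
  have o0 : #[x ^+ (#[x] %/ r)] = r.
    by rewrite orderXdiv ox ?expnS ?mulKn ?prime_gt0 ?dvdn_mull // mulnK ?expn_gt0 ?prime_gt0.
  by rewrite -o0; apply: eqn_exp_mod; rewrite expg1 -[RHS]f0 fX fx -!expgM mulnC.
have kn : (k ^ n = 1 %[mod r ^ m.+1])%N.
  by rewrite -ox; apply: eqn_exp_mod; rewrite -itE itx expg1.
have k1 := expn_eq1_mod r_pr kr rn kn.
by rewrite fx; apply/eqP; rewrite -{2}[x]expg1 eq_expg_mod_order ox; apply/eqP.
Qed.

Section Decomposed.
Variables (N0 K : {group T}) (x0 : T).
Hypotheses (sBN : B \subset N0) (defN : K ><| Br = N0).
Hypothesis alN : forall g x, x \in N0 -> al g x \in N0.
Hypothesis r'K : r^'.-group K.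
Hypothesis x0N : x0 \in N0.
Let f := remgr K Br.

Let nKN : K <| N0. Proof. by case/sdprod_context: defN. Qed.
Let KB : 'O_r([set: T])%G \in [complements to K in N0].
Proof. by case/sdprodP: defN => _ EN _ TI; apply/complP. Qed.

Lemma rem_morph : {in N0 &, {morph f : x y / x * y}}.
Proof. exact: remgrM KB nKN. Qed.

Lemma rem_id x : x \in Br -> f x = x.
Proof. by apply: remgr_id; case/sdprodP: defN. Qed.

Lemma rem_in x : x \in N0 -> f x \in Br.
Proof.
by move=> xN; apply: mem_remgr; rewrite (sdprodW defN).
Qed.

Lemma rem_r' x : x \in N0 -> r^'.-elt x -> f x = 1.
Proof.
move=> xN r'x; have fX n : f (x ^+ n) = f x ^+ n.
  elim: n => [|n IH]; first by rewrite !expg0 rem_id ?group1.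
  by rewrite !expgS rem_morph ?groupX // IH.
have rf : r.-elt (f x) by rewrite -mem_Br rem_in.
apply/eqP; rewrite -order_eq1 -dvdn1 -(eqP (pnat_coprime rf r'x)).
by rewrite dvdn_gcd dvdnn order_dvdn -fX expg_order rem_id ?group1 ?eqxx.
Qed.

Lemma rem_al g x : x \in N0 -> f (al g x) = al g (f x).
Proof.
move=> xN; have sKN : K \subset N0 := normal_sub nKN.
have kK : divgr K Br x \in K by apply: mem_divgr; rewrite (sdprodW defN).
have alkN : al g (divgr K Br x) \in N0 by rewrite alN // (subsetP sKN).
have r'k : r^'.-elt (al g (divgr K Br x)).
  have r'd := mem_p_elt r'K kK; apply: pnat_dvd r'd.
  by rewrite order_dvdn -act_byX expg_order act_by1.
have fxB := rem_in xN.
rewrite {1}(divgr_eq K Br x) (act_byM E) rem_morph //; last first.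
  by rewrite alN // (subsetP sBN) // (subsetP sBrB).
by rewrite (rem_r' alkN r'k) mul1g rem_id // al_Br_in.
Qed.

Lemma rem_constt g : f (c g) = (c g).`_r.
Proof.
have cN : c g \in N0 by apply: (subsetP sBN).
rewrite -{1}[c g](consttC r) rem_morph ?groupX // rem_id ?mem_Br ?p_elt_constt //.
by rewrite rem_r' ?groupX ?p_elt_constt ?mulg1.
Qed.

Definition ract x g := al g x * f (c g).

Lemma ract1 : ract^~ 1 =1 id.
Proof. by move=> x; rewrite /ract (cocycle1 cuv) act_by_id rem_id ?group1 // mulg1. Qed.

Lemma ractM x : act_morph ract x.
Proof.
move=> g h; have cN k : c k \in N0 by apply: (subsetP sBN).
by rewrite /ract (cocycle cuv) rem_morph ?alN // rem_al // (act_byM E) (act_byA E) mulgA.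
Qed.
Definition r_action := TotalAction ract1 ractM.

Lemma ract_fix d : al d x0 * c d = x0 -> r_action (f x0) d = f x0.
Proof.
move=> Fd; have cN : c d \in N0 by apply: (subsetP sBN).
by rewrite /= /ract -{2}Fd rem_morph ?alN // rem_al.
Qed.

Lemma abelian_primary_fix (Pi_r : {group Gam}) : abelian Br -> r.-Sylow([set: Gam]) Pi_r ->
  {in Pi_r, forall d, al d x0 * c d = x0} -> exists2 a, a \in Br & forall g, al g a * (c g).`_r = a.
Proof.
move=> abBr sylr Fx0; pose O := orbit r_action [set: Gam] (f x0).
have cBr g : f (c g) \in Br by rewrite rem_in // (subsetP sBN).
have fO : {in O, forall a, id a \in 'O_r([set: T])%G}.
  by move=> _ /orbitP[g _ <-]; rewrite /= /ract groupM ?cBr // al_Br_in ?rem_in.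
have [k kO] : exists k, #|O| * k = 1 %[mod #|'O_r([set: T])|].
  apply: (orbit_size_coprime r_pr sylr) (pcore_pgroup _ _) => d dP.
  exact/ract_fix/Fx0.
exists (affine_mean O id k abBr); first exact: affine_mean_in.
move=> g; rewrite -rem_constt; apply: (affine_mean_fix abBr fO kO (tau := fun a => r_action a g)) => //.
- by move=> a1 a2 _ _; exact: act_byM.
- by move=> a; exact: al_Br_in.
- by move=> a aO; rewrite /O orbit_actr ?inE.
by move=> a1 a2 _ _; exact: act_inj.
Qed.

(** An element [g] of order prime to [r] is linearly trivial on the [r]-core, so it acts there as a
    translation by an [r]-element whose order divides that of [g], hence trivially. The stabilizer
    of [f x0] thus contains a Sylow subgroup for every prime. *)
Lemma full_primary_fix (Pi_r : {group Gam}) : r.-Sylow([set: Gam]) Pi_r ->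
  {in Pi_r, forall d, al d x0 * c d = x0} ->
  (forall g a n, a \in Br -> iter n (al g) a = a -> ~~ (r %| n) -> al g a = a) ->
  exists2 a, a \in Br & forall g, al g a * (c g).`_r = a.
Proof.
move=> sylr Fx0 triv; exists (f x0); first exact: rem_in.
have cBr g : f (c g) \in Br by rewrite rem_in // (subsetP sBN).
suff: 'C_([set: Gam])[f x0 | r_action] = [set: Gam].
  move=> EC g; have : g \in 'C_([set: Gam])[f x0 | r_action] by rewrite EC inE.
  by case/setIP=> _ /astab1P; rewrite /= /ract rem_constt.
have r'fix g : r^'.-elt g -> r_action (f x0) g = f x0.
  move=> r'g; have rg : ~~ (r %| #[g]) by rewrite -p'natE.
  have itE n a : iter n (al g) a = al (g ^+ n) a.
    by elim: n => [|n IH]; rewrite ?expg0 ?act_by_id // iterS IH -(act_byA E) -expgSr.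
  have alg a : a \in Br -> al g a = a.
    by move=> aBr; apply: (triv g a #[g]) => //; rewrite itE expg_order act_by_id.
  have gn n : r_action (f x0) (g ^+ n) = f x0 * f (c g) ^+ n.
    elim: n => [|n IH]; first by rewrite act1 mulg1.
    by rewrite expgSr actM IH /= /ract alg ?groupM ?groupX ?cBr ?rem_in // expgSr mulgA.
  have fc1 : f (c g) = 1.
    have : f (c g) ^+ #[g] = 1 by apply: (mulgI (f x0)); rewrite -gn expg_order act1 mulg1.
    have rf : r.-elt (f (c g)) by rewrite -mem_Br.
    move/eqP; rewrite -order_dvdn => dv; apply/eqP; rewrite -order_eq1 -dvdn1.
    by rewrite -(eqP (pnat_coprime rf r'g)) dvdn_gcd dvdnn.
  by have := gn 1%N; rewrite !expg1 fc1 mulg1.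
pose C := 'C_([set: Gam])[f x0 | r_action]%G.
have sub_idx s (S : {group Gam}) : prime s -> s.-Sylow([set: Gam]) S -> S \subset C -> ~~ (s %| #|[set: Gam] : C|).
  move=> s_pr /and3P[_ _ s'S] sSC; rewrite -p'natE //.
  by apply: pnat_dvd s'S; exact: indexgS.
apply/eqP; rewrite eqEsubset subsetIl /= -indexg_eq1; apply: contraT => n1.
have s_pr : prime (pdiv #|[set: Gam] : C|).
  by apply: pdiv_prime; rewrite ltn_neqAle eq_sym n1 indexg_gt0.
have [S sylS] := Sylow_exists (pdiv #|[set: Gam] : C|) [set: Gam].
have [Es | ns] := eqVneq (pdiv #|[set: Gam] : C|) r.
  have : ~~ (r %| #|[set: Gam] : C|).
    apply: (sub_idx _ _ r_pr sylr); apply/subsetP=> d dP; rewrite inE inE /=.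
    exact/astab1P/ract_fix/Fx0.
  by rewrite -Es pdiv_dvd.
suff sSC : S \subset C by have := sub_idx _ _ s_pr sylS sSC; rewrite pdiv_dvd.
apply/subsetP=> d dS; rewrite inE inE /=; apply/astab1P/r'fix.
apply: sub_p_elt (mem_p_elt (pHall_pgroup sylS) dS) => q.
by rewrite !inE => /eqP ->.
Qed.
End Decomposed.

Lemma order_quot x : x \in Br -> x != 1 -> #[x ^+ (#[x] %/ r)] = r.
Proof.
rewrite mem_Br => /p_natP[[|m] ox] x1; first by rewrite -order_eq1 ox in x1.
by rewrite orderXdiv ox ?expnS ?mulKn ?prime_gt0 ?dvdn_mull // mulnK ?expn_gt0 ?prime_gt0.
Qed.

Lemma primary_decomp (N0 : {group T}) : Br \subset N0 ->
  (forall x, x \in N0 -> r^'.-elt x -> x \in 'C(Br)) ->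
  exists2 K : {group T}, r^'.-group K & K ><| Br = N0.
Proof.
move=> sBrN cr'.
have nBr : Br <| N0 by rewrite (normalS sBrN (subsetT _)) ?pcore_normal.
have r'idx : r^'.-nat #|N0 : Br|.
  have [S sylS] := Sylow_exists r N0; have [sSN rS r'S] := and3P sylS.
  apply: pnat_dvd r'S; apply: indexgS; apply/subsetP=> x xS.
  by rewrite mem_Br (mem_p_elt rS).
have hallBr : Hall N0 Br.
  by rewrite /Hall sBrN (pnat_coprime (pcore_pgroup _ _) r'idx).
have /splitsP[K /complP[tiK EK]] := SchurZassenhaus_split hallBr nBr.
have r'K : r^'.-group K.
  rewrite /pgroup (_ : #|K| = #|N0 : Br|) //.
  by rewrite -divgS // -EK (TI_cardMg tiK) mulKn ?cardG_gt0.
have nKB : Br \subset 'N(K).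
  apply: subset_trans (cent_sub K); rewrite centsC; apply/subsetP=> x xK.
  by apply: cr'; rewrite ?(mem_p_elt r'K) // -EK (subsetP (mulG_subr _ _)).
by exists K => //; rewrite sdprodE ?(setIC K) // -(normC nKB).
Qed.

(** A group of order 2 has no nontrivial automorphism, so the involution of a stable cycle is
    fixed. *)
Lemma coprime_aut_trivial2 : r = 2 -> forall g a n,
  a \in Br -> iter n (al g) a = a -> ~~ (r %| n) -> al g a = a.
Proof.
move=> r2 g a n aBr ita rn; have [-> | a1] := eqVneq a 1; first exact: act_by1.
have aB := subsetP sBrB a aBr.
have /cycleP[k Ek] := stable_cycle g (B_z aB).
apply: (cyclic_aut_trivial (k := k) (n := n)) => //; first exact: act_byM.
have oe := order_quot aBr a1; set e := a ^+ _ in oe *.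
have eB : e \in B by rewrite groupX.
have : al g e \in <[e]> by exact/stable_cycle/B_z.
rewrite cycle2g ?oe // !inE => /orP[/eqP E1 | /eqP //].
have : e = 1 by apply: (act_by_inj (E := E) (g := g)); rewrite act_by1.
by move=> e1; rewrite e1 order1 in oe; rewrite -oe in r2.
Qed.

Lemma abelian_Br : odd r -> abelian Br.
Proof.
move=> r_odd; apply: (odd_Dedekind_abelian r_pr r_odd (pcore_pgroup _ _)) => x xBr.
have sBrT := subsetT Br; have xB := subsetP sBrB x xBr.
by apply: normalS sBrT (normal_cycle (B_z xB)); rewrite cycle_subG.
Qed.

Lemma primary_fix : (forall b, b \in B -> prime #[b] -> ph b = b) ->
  exists2 a, a \in Br & forall g, al g a * (c g).`_r = a.
Proof.
move=> phB; have rBr : r.-group Br := pcore_pgroup _ _.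
have [Pi_r sylr iBr] := exists_Sylow_pair rBr.
have [x0 Fx0] := Sylow_fix nonunit cuv r_pr rT (pHall_pgroup sylr).
(* For 2, elements of odd order centralize the 2-core, so projecting from the whole of [T] is
   possible. *)
have [r2 | r_odd] := even_prime r_pr.
  have [|x _ r'x|K r'K defT] := @primary_decomp [set: T]%G; first exact: subsetT.
    apply/centP=> a aBr; apply/commute_sym/commgP/conjg_fixP.
    rewrite -(act_by_embed E); apply: (coprime_aut_trivial2 r2 (n := #[x])) => //.
      have -> n : iter n (al (i x)) a = a ^ (x ^+ n); last by rewrite expg_order conjg1.
      elim: n => [|n IH]; first by rewrite expg0 conjg1.
      by rewrite iterS IH act_by_embed -conjgM -expgSr.
    by rewrite -p'natE.
  apply: (full_primary_fix (N0 := [set: T]%G) (K := K) (x0 := x0) _ defT _ r'K _ sylr) => //.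
  - by apply/subsetP=> x; rewrite inE.
  - by move=> g x; rewrite !inE.
  - by rewrite inE.
  exact: (coprime_aut_trivial2 r2).
have abBr := abelian_Br r_odd.
have BcBr b a : b \in B -> a \in Br -> commute b a.
  move=> bB aBr; rewrite -(consttC r b); apply/commute_sym/commuteM.
    by apply: (centsP abBr) => //; rewrite mem_Br p_elt_constt.
  apply: (coprime_normal_commute (B_z (subsetP sBrB a aBr)) (B_z (groupX _ bB))).
  by move: aBr; rewrite mem_Br => ra; exact: pnat_coprime ra (p_elt_constt _ _).
have phBr a : a \in Br -> ph a = a.
  move=> aBr; have [-> | a1] := eqVneq a 1; first exact: twist_hom1 cuv.
  have [t pt Et] : exists2 t, p.-elt t & ph a = a ^ t.
    have [t ->] := phi_class a; exists t.`_p; first exact: p_elt_constt.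
    rewrite -{1}[t](consttC p) conjgM; apply/conjg_fixP/commgP/commute_sym/BcBr.
      by rewrite mem_B p_elt_constt.
    by rewrite -(act_by_embed E) al_Br_in.
  rewrite Et.
  have [k Ek] := conj_exp t (subsetP sBrB a aBr).
  have oe := order_quot aBr a1.
  apply: (cyclic_aut_trivial (f := fun x => x ^ t) (k := k) (n := #[t])) => //.
  - by move=> x x'; exact: conjMg.
  - have -> n : iter n (fun x => x ^ t) a = a ^ (t ^+ n); last by rewrite expg_order conjg1.
    elim: n => [|n IH]; first by rewrite expg0 conjg1.
    by rewrite iterS IH -conjgM -expgSr.
  - by rewrite -p'natE //; apply: sub_p_elt pt => q; rewrite !inE => /eqP ->; rewrite eq_sym.
  by rewrite conjXg -Et -(twist_homX cuv) phB ?oe // groupX // (subsetP sBrB).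
(* Elements of [T] of order prime to an odd [r] may act nontrivially on the [r]-core, so the
   projection is defined on its centralizer only. *)
pose N0 := 'C(Br)%G.
have sBN : B \subset N0.
  by apply/subsetP=> b bB; apply/centP=> a; exact: BcBr.
have sBrN : Br \subset N0 by apply: subset_trans sBrB sBN.
have [|K r'K defN] := primary_decomp sBrN; first by [].
apply: (abelian_primary_fix (N0 := N0) (K := K) (x0 := x0) sBN defN _ r'K _ abBr sylr) => //.
  move=> g x /centP cx; apply/centP=> a aBr; rewrite -(act_byKV E g a) /commute -!(act_byM E).
  by rewrite cx // al_Br_in.
(* Since [phi a = a], being fixed by the affine map of [a] means that [x0] commutes with [a]. *)
apply/centP=> a aBr; have := Fx0 (i a) (iBr a aBr); rewrite (tw_i E c) phBr // => Ex.
by rewrite /commute -{2}Ex !mulgA mulgV mul1g.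
Qed.
End PrimaryPart.

(** The solutions for the various primes are multiplied together; elements of [B] of coprime orders
    commute, so the equations multiply too. *)
Lemma solvable_of_primary : (forall b, b \in B -> prime #[b] -> ph b = b) -> solvable_system c.
Proof.
move=> phB.
pose Q (r : nat) a := [&& r.-elt a, a \in B & [forall g, al g a * (c g).`_r == a]].
have exQ r : exists a, Q r a.
  have [/and3P[r_pr rp rT] | nr] := boolP [&& prime r, r != p & r %| #|T|].
    have [a aBr Fa] := primary_fix r_pr rp rT phB; exists a.
    rewrite /Q -(mem_Br rp) aBr (subsetP (sBrB rp)) //.
    by apply/forallP=> g; rewrite Fa.
  (* For every other [r], the [r]-part of [c g] is trivial. *)
  exists 1; rewrite /Q /p_elt order1 group1; apply/forallP=> g; rewrite act_by1 mul1g.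
  apply/eqP/constt1P/pnatP => // q q_pr qc; apply: contra nr; rewrite inE => /eqP <-.
  rewrite q_pr (dvdn_trans qc) ?andbT -?cardsT ?order_dvdG ?inE //=.
  by apply: contraTneq qc => ->; rewrite -p'natE //; have := cB g; rewrite mem_B.
have [a Qa] : exists a, forall r, Q r (a r).
  exists (fun r => odflt 1 [pick x | Q r x]) => r; case: pickP => [x //|Q0].
  by have [x] := exQ r; rewrite Q0.
exists (\prod_(0 <= r < #|T|.+1) a r) => g.
have Ec : c g = \prod_(0 <= r < #|T|.+1) (c g).`_r.
  have le : #[c g] <= #|T| by rewrite -cardsT subset_leq_card ?subsetT.
  rewrite (big_cat_nat _ (n := #[c g].+1)) //= prod_constt big_nat big1 ?mulg1 //.
  move=> r /andP[ltr _]; apply/constt1P/pnatP => // q q_pr qc; rewrite inE.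
  by apply: contraTneq ltr => <-; rewrite -leqNgt dvdn_leq.
rewrite {1}Ec; elim: #|T|.+1 => [|n IH]; first by rewrite !big_nil act_by1 mulg1.
rewrite !big_nat_recr //= (act_byM E).
have [/and3P[pa aB /forallP Fa]] := Qa n.
have cn : commute (al g (a n)) (\prod_(0 <= r < n) (c g).`_r).
  rewrite big_nat; elim/big_rec: _ => [|r x /andP[_ rn] IHx]; first exact: commute1.
  apply: commuteM => //.
  apply: (coprime_normal_commute (B_z (al_B g aB)) (B_z (groupX _ (cB g)))).
  have pal : n.-elt (al g (a n)) by apply: pnat_dvd pa; rewrite order_dvdn -act_byX expg_order act_by1.
  apply: (pnat_coprime pal); apply: sub_p_elt (p_elt_constt r (c g)) => q.
  by rewrite !inE => /eqP ->; rewrite neq_ltn rn.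
by rewrite -mulgA (mulgA (al g (a n))) cn -(mulgA _ (al g (a n))) mulgA IH (eqP (Fa g)).
Qed.
End NormalizedCocycle.

Lemma twisted_fixed_point c (u v : T -> R) : twisted_unit E c u v -> solvable_system c.
Proof.
move=> cuv; have [x1 c1B] := p_step cuv; apply: (solvable_shift (x := x1)).
have {cuv} cuv := shift_unit x1 cuv; move: (shift E x1 c) c1B cuv => {}c cB cuv.
have [P sylP] := Sylow_exists p [set: T].
have [Pi sylPi iP] := exists_Sylow_pair (pHall_pgroup sylP).
have [x2 x2B cPi] := B_step cuv cB (pHall_pgroup sylPi); apply: (solvable_shift (x := x2)).
have {}cB g : shift E x2 c g \in B by rewrite /shift !groupM ?groupV ?al_B.
have {cuv} cuv := shift_unit x2 cuv.
have [y [c2B phB]] := core_step cuv cB sylP sylPi iP cPi; apply: (solvable_shift (x := y)).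
exact: solvable_of_primary (shift_unit y cuv) c2B phB.
Qed.
End Blackburn.

(** * Finitely generated groups with finite conjugacy classes *)

Section FiniteGeneration.
Variable G : groupType.
Implicit Types (x y a b d : G) (C L w : seq G).

Definition wprod w : G := \prod_(x <- w) x.

(** Words without inverses: inverses come from [C] being closed under them, or from finiteness. *)
Definition generated C x := exists2 w, all (mem C) w & x = wprod w.

Definition torsion x := exists2 n, 0 < n & x ^+ n = 1.

Lemma wprod_cat w1 w2 : wprod (w1 ++ w2) = wprod w1 * wprod w2.
Proof. by rewrite /wprod big_cat. Qed.

Lemma wprod_cons x w : wprod (x :: w) = x * wprod w.
Proof. by rewrite /wprod big_cons. Qed.

Lemma wprod_nil : wprod [::] = 1.
Proof. by rewrite /wprod big_nil. Qed.

Lemma wprod_conj w x : wprod w ^ x = wprod [seq a ^ x | a <- w].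
Proof. by rewrite /wprod conjg_prod big_map. Qed.

Lemma generated1 C : generated C 1.
Proof. by exists [::]; rewrite ?wprod_nil. Qed.

Lemma generatedM C x y : generated C x -> generated C y -> generated C (x * y).
Proof.
by move=> [w1 C1 ->] [w2 C2 ->]; exists (w1 ++ w2); rewrite ?all_cat ?C1 ?wprod_cat.
Qed.

Lemma mem_generated C x : x \in C -> generated C x.
Proof. by move=> xC; exists [:: x]; rewrite /= ?xC // wprod_cons wprod_nil mulg1. Qed.

Lemma generatedX C x n : generated C x -> generated C (x ^+ n).
Proof.
move=> Cx; elim: n => [|n IH]; first by rewrite expg0; exact: generated1.
by rewrite expgS; exact: generatedM.
Qed.

Lemma generatedV C x : (forall a, a \in C -> a^-1 \in C) -> generated C x -> generated C x^-1.
Proof.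
move=> CV [w + ->]; elim: w => [|a w IH] /=.
  by rewrite wprod_nil invg1 => _; exact: generated1.
case/andP=> aC wC; rewrite wprod_cons invgM.
by apply: generatedM; [exact: IH | exact/mem_generated/CV].
Qed.

Lemma generatedJ C x t : (forall a, a \in C -> a ^ t \in C) -> generated C x -> generated C (x ^ t).
Proof.
move=> CJ [w wC ->]; exists [seq a ^ t | a <- w]; rewrite ?wprod_conj //.
by rewrite all_map; apply: sub_all wC => a; exact: CJ.
Qed.

Lemma generated_sub C (P : G -> Prop) :
  P 1 -> (forall x y, P x -> P y -> P (x * y)) -> (forall x, x \in C -> P x) ->
  forall x, generated C x -> P x.
Proof.
move=> P1 PM PC _ [w + ->]; elim: w => [|a w IH] /=; first by rewrite wprod_nil.
by case/andP=> aC wC; rewrite wprod_cons; apply: PM; [exact: PC | exact: IH].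
Qed.

Fixpoint short_words C n :=
  if n is n'.+1 then [::] :: [seq c :: w | c <- C, w <- short_words C n'] else [:: [::]].

Lemma short_wordsP C n w : all (mem C) w -> size w <= n -> w \in short_words C n.
Proof.
elim: n w => [|n IH] [|c w] //= /andP[cC wC] lew.
by rewrite inE; apply/orP; right; apply/allpairsP; exists (c, w); rewrite IH.
Qed.

(* Conjugating the letters in front of an occurrence of [d] moves it to the front without
   changing the other occurrences of [d]. *)
Lemma collect_front C d w k : (forall a, a \in C -> a ^ d \in C) -> all (mem C) w -> k <= count_mem d w ->
  exists w', [/\ all (mem C) w', size w = (k + size w')%N & wprod w = d ^+ k * wprod w'].
Proof.
move=> CJ; elim: k w => [|k IH] w wC lek; first by exists w; rewrite expg0 mul1g.
have dw : d \in w by rewrite -has_pred1 has_count (leq_trans _ lek).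
case/splitPr: dw => w1 w2 in wC lek *.
move: wC; rewrite all_cat /= => /and3P[w1C dC w2C].
have [||w' [w'C sw' Ew']] := IH ([seq a ^ d | a <- w1] ++ w2).
- rewrite all_cat w2C andbT all_map; apply: sub_all w1C => a; exact: CJ.
- move: lek; rewrite !count_cat /= eqxx add1n addnS ltnS => /leq_trans; apply.
  rewrite leq_add2r count_map; apply: sub_count => a /= /eqP ->.
  by rewrite conjgE mulgA mulVg mul1g.
exists w'; split=> //.
  by move: sw'; rewrite !size_cat /= size_map addnS => ->; rewrite addSn.
rewrite expgS -mulgA -Ew' !wprod_cat wprod_cons -wprod_conj conjgE.
by rewrite !mulgA mulgV mul1g.
Qed.

Lemma count_mem_le C w n : (forall d, d \in C -> count_mem d w <= n) ->
  count (mem C) w <= n * size C.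
Proof.
elim: C => [|c C IH] leC /=; first by rewrite muln0 leqn0 (@eq_count _ _ pred0) ?count_pred0.
rewrite mulnS (@eq_count _ _ (predU (pred1 c) (mem C))); last by move=> x; rewrite /= inE.
rewrite -(leq_add2r (count (predI (pred1 c) (mem C)) w)) count_predUI.
apply: leq_trans (leq_addr _ _); apply: leq_add; first by apply: leC; rewrite inE eqxx.
by apply: IH => d dC; apply: leC; rewrite inE dC orbT.
Qed.

(* Collecting [n.+1] equal letters at the front and replacing them by the shorter word
   shortens every word longer than [n * size C]. *)
Lemma generated_finite C n :
  (forall a d, a \in C -> d \in C -> a ^ d \in C) ->
  (forall d, d \in C -> exists w, [/\ all (mem C) w, size w <= n & d ^+ n.+1 = wprod w]) ->
  exists L, forall x, generated C x -> x \in L.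
Proof.
move=> CJ Cn; exists [seq wprod w | w <- short_words C (n * size C)] => _ [w + ->].
have [m] := ubnP (size w); elim: m => // m IH in w *; rewrite ltnS => lem wC.
have [le | gt] := leqP (size w) (n * size C).
  by apply: map_f; exact: short_wordsP.
have [d dC ltd] : exists2 d, d \in C & n < count_mem d w.
  have [/hasP[d dC ltd]|/hasPn no] := boolP (has (fun d => n < count_mem d w) C); first by exists d.
  have := count_mem_le (C := C) (w := w) (n := n); rewrite (all_count _ _) in wC.
  rewrite (eqP wC) leqNgt gt => /(_ _)/negP[] // d dC; rewrite leqNgt; exact: no.
have [w1 [w1C sw Ew]] := collect_front (fun a aC => CJ a d aC dC) wC ltd.
have [w2 [w2C sw2 Ew2]] := Cn d dC.
rewrite Ew Ew2 -wprod_cat; apply: IH; last by rewrite all_cat w2C.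
by rewrite size_cat; apply: leq_trans lem; rewrite sw ltn_add2r ltnS.
Qed.

Lemma torsion_of_finite L x : (forall n, x ^+ n \in L) -> torsion x.
Proof.
move=> xL; pose f (j : 'I_(size L).+1) := x ^+ j.
have /injectivePn[j1 [j2 nj Ej]] : ~~ injectiveb f.
  apply/negP=> fi; have Uf : uniq (codom f) := fi.
  have sf : {subset codom f <= L} by move=> _ /codomP[j ->]; exact: xL.
  by have := uniq_leq_size Uf sf; rewrite size_codom card_ord ltnn.
wlog lt : j1 j2 nj Ej / j1 < j2.
  move=> W; case: (ltngtP j1 j2) => [|gt|/val_inj e]; first exact: W.
    by apply: (W j2 j1); rewrite // eq_sym.
  by rewrite e eqxx in nj.
exists (j2 - j1)%N; first by rewrite subn_gt0.
by apply: (mulgI (x ^+ j1)); rewrite mulg1 -expgnDr subnKC ?(ltnW lt).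
Qed.

Lemma torsion1 : torsion 1.
Proof. by exists 1%N; rewrite ?expg1n. Qed.

Lemma torsionV x : torsion x -> torsion x^-1.
Proof. by case=> n n0 xn; exists n => //; rewrite expVgn xn invg1. Qed.

Lemma torsionJ x t : torsion x -> torsion (x ^ t).
Proof. by case=> n n0 xn; exists n => //; rewrite -conjXg xn conj1g. Qed.

Lemma torsion_of_power x n : 0 < n -> torsion (x ^+ n) -> torsion x.
Proof.
by move=> n0 [m m0 xm]; exists (n * m)%N; rewrite ?muln_gt0 ?n0 // expgnA.
Qed.

Lemma generated_finiteV C L x : (forall y, generated C y -> y \in L) -> generated C x -> generated C x^-1.
Proof.
move=> CL Cx; have [[//|n] _ xn] : torsion x.
  by apply: (@torsion_of_finite L) => n; apply/CL/generatedX.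
rewrite (_ : x^-1 = x ^+ n); first exact: generatedX.
by apply: (mulgI x); rewrite mulgV -expgS.
Qed.

(** Dietzmann's lemma: for a common exponent [n] of the letters, [d ^+ n.+1] is the one-letter word
    [d]. *)
Lemma generated_torsion_finite C :
  (forall a d, a \in C -> d \in C -> a ^ d \in C) -> (forall d, d \in C -> torsion d) ->
  exists L, forall x, generated C x -> x \in L.
Proof.
move=> CJ Ct.
have [n n0 Cn] : exists2 n, 0 < n & forall d, d \in C -> d ^+ n = 1.
  elim: C Ct {CJ} => [|c C IH] Ct; first by exists 1%N.
  have [|n n0 Cn] := IH; first by move=> d dC; apply: Ct; rewrite inE dC orbT.
  have [m m0 cm] := Ct c (mem_head c C).
  exists (n * m)%N => [|d]; first by rewrite muln_gt0 n0.
  rewrite inE => /predU1P[-> | dC]; first by rewrite mulnC expgnA cm expg1n.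
  by rewrite expgnA Cn ?expg1n.
apply: (generated_finite (n := n)) => // d dC; exists [:: d].
by split; rewrite /= ?dC // expgS Cn // wprod_cons wprod_nil.
Qed.

(** * Groups generated by a finite conjugation-stable set *)

Section FiniteConjugacy.
Variable D : seq G.
Hypotheses (DJ : forall d x, d \in D -> d ^ x \in D) (DV : forall d, d \in D -> d^-1 \in D).
Local Notation K := (generated D).

Let KJ x t : K x -> K (x ^ t).
Proof. by apply: generatedJ => a; exact: DJ. Qed.

Let KV x : K x -> K x^-1.
Proof. exact: generatedV. Qed.

Definition same_action x y := forall d, d \in D -> d ^ x = d ^ y.

Lemma same_actionK x y a : same_action x y -> K a -> a ^ x = a ^ y.
Proof.
move=> sxy; move: a; apply: generated_sub => [|a b Ea Eb|a]; last exact: sxy.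
  by rewrite !conj1g.
by rewrite !conjMg Ea Eb.
Qed.

Let act x : {ffun seq_sub D -> seq_sub D} := [ffun d => SeqSub (DJ x (valP d))].

Lemma act_same x y : act x = act y -> same_action x y.
Proof. by move=> /ffunP Exy d dD; have := Exy (SeqSub dD); rewrite !ffunE => -[]. Qed.

Lemma finite_representatives (Q : G -> Prop) : exists reps : seq G,
  (forall r, r \in reps -> Q r) /\ (forall x, Q x -> exists2 r, r \in reps & same_action x r).
Proof.
pose s f := if pselect (exists2 x, Q x & act x = f) is left ex then [:: s2val (cid2 ex)] else [::].
exists (flatten [seq s f | f : {ffun seq_sub D -> seq_sub D}]); split=> [r|x Qx].
  case/flattenP=> _ /mapP[f _ ->]; rewrite /s; case: pselect => // ex.
  by rewrite inE => /eqP ->; exact: (s2valP (cid2 ex)).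
have [y [Qy Exy Ey]] : exists y, [/\ Q y, act y = act x & s (act x) = [:: y]].
  rewrite /s; case: pselect => [ex | []]; last by exists x.
  by exists (s2val (cid2 ex)); split=> //; [exact: s2valP | exact: (s2valP' (cid2 ex))].
exists y; last by apply: act_same.
by apply/flattenP; exists (s (act x)); rewrite ?Ey ?inE // -Ey map_f ?mem_enum.
Qed.

Lemma finite_action_image (V : eqType) (F : G -> V) (Q : G -> Prop) :
  (forall x y, Q x -> Q y -> same_action x y -> F x = F y) ->
  exists L : seq V, forall x, Q x -> F x \in L.
Proof.
move=> FQ; have [reps [repsQ Qreps]] := finite_representatives Q.
exists [seq F r | r <- reps] => x Qx; have [r rr sxr] := Qreps x Qx.
by apply/mapP; exists r; rewrite // (FQ x r) //; exact: repsQ.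
Qed.

(** The exponent is the order of the symmetric group of [D]. *)
Lemma central_power : exists2 n, 0 < n & forall x a, K a -> commute a (x ^+ n).
Proof.
have act_inj x : injective (act x).
  by move=> [d1 D1] [d2 D2]; rewrite !ffunE => -[/conjg_inj E]; apply: val_inj.
exists #|[set: {perm seq_sub D}]|; first exact: cardG_gt0.
move=> x a Ka; apply/commgP/conjg_fixP.
rewrite -[RHS]conjg1; apply: same_actionK Ka => d dD; rewrite conjg1.
have pE n : val ((perm (@act_inj x) ^+ n)%g (SeqSub dD)) = d ^ (x ^+ n).
  elim: n => [|n IH]; first by rewrite expg0 perm1 conjg1.
  by rewrite expgSr permM permE ffunE /= IH expgSr conjgM.
by rewrite -pE (expg_cardG (in_setT _)) perm1.
Qed.

(* If [c ^+ n] is central for [c = [~ x, y]], then [c ^+ n.+1 = [~ x, y * y] * (c ^ y) ^+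
   n.-1] is a product of [n] commutators. *)
Lemma commutator_torsion a b : K a -> K b -> torsion [~ a, b].
Proof.
have [n n0 Kn] := central_power; have [reps [repsK Kreps]] := finite_representatives K.
pose C := [seq [~ r1, r2] | r1 <- reps, r2 <- reps].
(* A commutator depends only on how its two entries act on [D], so there are finitely many. *)
have CE x y : K x -> K y -> [~ x, y] \in C.
  move=> Kx Ky; have [r1 r1r s1] := Kreps x Kx; have [r2 r2r s2] := Kreps y Ky.
  have -> : [~ x, y] = [~ r1, r2].
    rewrite commgEr (same_actionK s1 (KV Ky)) -commgEr.
    by rewrite !commgEl (same_actionK s2 (repsK _ r1r)).
  by apply/allpairsP; exists (r1, r2).
have CP c : c \in C -> exists x y, [/\ K x, K y & c = [~ x, y]].
  by case/allpairsP=> -[r1 r2] [/= /repsK K1 /repsK K2 ->]; exists r1, r2.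
have [L CL] : exists L, forall x, generated C x -> x \in L.
  apply: (generated_finite (n := n)) => [c d /CP[x [y [Kx Ky ->]]] _ | _ /CP[x [y [Kx Ky ->]]]].
    by rewrite conjRg; apply: CE; exact: KJ.
  exists ([~ x, y * y] :: nseq n.-1 ([~ x, y] ^ y)); split.
  - have Cxy : [~ x, y] ^ y \in C by rewrite conjRg; apply: CE; exact: KJ.
    rewrite /= CE //=; last exact: generatedM.
    by apply/allP=> w /nseqP[-> _].
  - by rewrite /= size_nseq prednK.
  rewrite wprod_cons /wprod big_nseq -/(wprod _) iter_mulg_1 expgS.
  have -> : [~ x, y * y] = [~ x, y] * [~ x, y] ^ y.
    rewrite /commg conjMg conjVg -conjgM -mulgA.
    by rewrite mulVKg.
  move: [~ x, y] (Kn [~ x, y] y Ky) => c cn; rewrite -mulgA; congr (_ * _).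
  rewrite -[RHS](expgS (c ^ y) n.-1) prednK // -conjXg.
  by apply/esym/conjg_fixP/commgP/commute_sym.
by move=> Ka Kb; apply: (@torsion_of_finite L) => j; apply/CL/generatedX/mem_generated/CE.
Qed.

(** Conjugates of an element of [K] depend only on the action on [D], so they are finite in
    number. *)
Lemma torsion_conj_closure (W : seq G) : (forall x, x \in W -> K x /\ torsion x) ->
  exists C : seq G, [/\ {subset W <= C}, forall c, c \in C -> K c /\ torsion c
    & forall c x, c \in C -> K x -> c ^ x \in C].
Proof.
elim: W => [|a W IH] aW; first by exists [::].
have [x xW | C [WC CK CJ]] := IH; first by apply: aW; rewrite inE xW orbT.
have [Ka ta] := aW a (mem_head _ _).
have [La aL] : exists L, forall x, K x -> a ^ x \in L.
  by apply: finite_action_image => x y _ _ sxy; exact: same_actionK.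
pose Ca := [seq c <- La | `[< exists2 x, K x & c = a ^ x >]].
have CaP c : reflect (exists2 x, K x & c = a ^ x) (c \in Ca).
  apply: (iffP idP) => [|[x Kx ->]]; first by rewrite mem_filter => /andP[/asboolP].
  by rewrite mem_filter aL // andbT; apply/asboolP; exists x.
exists (Ca ++ C); split=> [x | c | c x].
- rewrite inE mem_cat => /predU1P[-> | /WC ->]; last exact: orbT.
  by apply/orP; left; apply/CaP; exists 1; rewrite ?conjg1; first exact: generated1.
- by rewrite mem_cat => /orP[/CaP[x Kx ->] | /CK //]; split; [exact: KJ | exact: torsionJ].
rewrite !mem_cat => /orP[/CaP[y Ky ->] Kx | cC Kx]; last by rewrite CJ ?orbT.
by apply/orP; left; apply/CaP; exists (y * x); [exact: generatedM | rewrite conjgM].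
Qed.

Lemma torsionM a b : K a -> K b -> torsion a -> torsion b -> torsion (a * b).
Proof.
move=> Ka Kb ta tb.
have [|C [abC CK CJ]] := @torsion_conj_closure [:: a; b].
  by move=> x; rewrite !inE => /orP[] /eqP ->.
have [L CL] := generated_torsion_finite (fun c d cC dC => CJ c d cC (CK d dC).1) (fun c cC => (CK c cC).2).
apply: (@torsion_of_finite L) => n; apply/CL/generatedX.
by apply: generatedM; apply: mem_generated; apply: abC; rewrite !inE eqxx ?orbT.
Qed.
End FiniteConjugacy.
End FiniteGeneration.

(** * The torsion-free abelian quotient *)

Section TorsionFreeQuotient.
Variables (G : groupType) (D : seq G).
Hypotheses (DJ : forall d x : G, d \in D -> d ^ x \in D) (DV : forall d : G, d \in D -> d^-1 \in D).
Local Notation K := (generated D).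
Local Open Scope quotient_scope.

Let KT := {x : G | `[< K x >]}.
Let Kval (x : KT) : K (val x). Proof. exact/asboolP/(valP x). Qed.
Let KV x : K x -> K x^-1. Proof. exact: generatedV. Qed.
Let KJ x t : K x -> K (x ^ t). Proof. by apply: generatedJ => a; exact: DJ. Qed.

Let eqt (x y : KT) := `[< torsion ((val x)^-1 * val y) >].

Let eqt_refl : reflexive eqt.
Proof. by move=> x; apply/asboolP; rewrite mulVg; exact: torsion1. Qed.
Let eqt_sym : symmetric eqt.
Proof.
have sub x y : eqt x y -> eqt y x.
  by move=> /asboolP/torsionV txy; apply/asboolP; rewrite invgM invgK in txy.
by move=> x y; apply/idP/idP; exact: sub.
Qed.
Let eqt_trans : transitive eqt.
Proof.
move=> y x z /asboolP txy /asboolP tyz; apply/asboolP.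
rewrite -(mulgK (val y) (val x)^-1) -mulgA.
rewrite (_ : _ * _ * _ = ((val x)^-1 * val y) * ((val y)^-1 * val z)); last by rewrite !mulgA.
by apply: (torsionM DJ) => //; apply: generatedM; try apply: KV; exact: Kval.
Qed.

Let e := EquivRel eqt eqt_refl eqt_sym eqt_trans.
Let Q := {eq_quot e}.

Let kmk x (Kx : K x) : KT := exist _ x (asboolT Kx).
Let kmul x y := kmk (generatedM (Kval x) (Kval y)).
Let kinv x := kmk (KV (Kval x)).

Let piE (x y : KT) : (\pi_Q x = \pi_Q y) <-> torsion ((val x)^-1 * val y).
Proof. by split=> [/eqmodP/asboolP // | t]; apply/eqmodP/asboolP. Qed.

Let qadd (a b : Q) : Q := \pi_Q (kmul (repr a) (repr b)).
Let qopp (a : Q) : Q := \pi_Q (kinv (repr a)).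

Let valM x y : val (kmul x y) = val x * val y. Proof. by []. Qed.
Let valV x : val (kinv x) = (val x)^-1. Proof. by []. Qed.

Let qaddE x y : qadd (\pi_Q x) (\pi_Q y) = \pi_Q (kmul x y).
Proof.
have /piE tx : \pi_Q (repr (\pi_Q x)) = \pi_Q x by rewrite reprK.
have /piE ty : \pi_Q (repr (\pi_Q y)) = \pi_Q y by rewrite reprK.
apply/piE; rewrite !valM; move: (repr _) (repr _) tx ty => y' x' tx ty.
have -> : (val x' * val y')^-1 * (val x * val y) =
    ((val x')^-1 * val x) ^ val y' * ((val y')^-1 * val y).
  by rewrite conjgE invgM !mulgA mulgK.
apply: (torsionM DJ) => //; try exact: torsionJ.
  by apply: KJ; apply: generatedM; [apply: KV|]; exact: Kval.
by apply: generatedM; [apply: KV|]; exact: Kval.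
Qed.

Let qopp_subproof x : qopp (\pi_Q x) = \pi_Q (kinv x).
Proof.
have /piE tx : \pi_Q (repr (\pi_Q x)) = \pi_Q x by rewrite reprK.
apply/piE; rewrite !valV invgK; move: (repr _) tx => x' tx.
rewrite (_ : val x' * (val x)^-1 = (((val x')^-1 * val x)^-1) ^ (val x')^-1).
  exact/torsionJ/torsionV.
by rewrite conjgE invgK invgM invgK !mulgA mulgK.
Qed.

Let qaddA : associative qadd.
Proof.
elim/quotW=> x; elim/quotW=> y; elim/quotW=> w.
rewrite (qaddE y w) (qaddE x (kmul y w)) (qaddE x y) (qaddE (kmul x y) w); apply/piE.
by rewrite !valM (mulgA (val x)) mulVg; exact: torsion1.
Qed.

Let qaddC : commutative qadd.
Proof.
elim/quotW=> x; elim/quotW=> y; rewrite (qaddE x y) (qaddE y x); apply/piE; rewrite !valM invgM -mulgA.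
rewrite (_ : _ * _ = [~ val y, val x]); last by rewrite /commg conjgE !mulgA.
by apply: (commutator_torsion DJ) => //; exact: Kval.
Qed.

Let q0 : Q := \pi_Q (kmk (generated1 D)).

Let qadd0 : left_id q0 qadd.
Proof.
elim/quotW=> x; rewrite /q0 qaddE; apply/piE.
by rewrite valM mul1g mulVg; exact: torsion1.
Qed.

Let qaddN : left_inverse q0 qopp qadd.
Proof.
elim/quotW=> x; rewrite qopp_subproof qaddE; apply/piE.
by rewrite valM valV mulVg invg1 mul1g; exact: torsion1.
Qed.

Lemma torsion_free_quotient : exists (A : zmodType) (dg : G -> A),
  [/\ forall x y, K x -> K y -> dg (x * y) = (dg x + dg y)%R,
      forall x, K x -> dg x = 0%R <-> torsion x
    & forall (a : A) n, 0 < n -> (a *+ n = 0)%R -> a = 0%R].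
Proof.
pose A : zmodType := HB.pack Q (Choice.on {eq_quot e}) (GRing.isZmodule.Build {eq_quot e} qaddA qaddC qadd0 qaddN).
(* Outside [K] the degree has the default value 0. *)
pose dg x : A := if pselect (K x) is left Kx then \pi_Q (kmk Kx) else q0.
have dgE x (Kx : K x) : dg x = \pi_Q (kmk Kx) by rewrite /dg; case: pselect => // Kx'; congr (\pi_Q _); apply: val_inj.
have dgM x y : K x -> K y -> dg (x * y) = (dg x + dg y)%R.
  move=> Kx Ky; rewrite !dgE; first exact: generatedM; move=> Kxy.
  by rewrite [RHS]qaddE; congr (\pi_Q _); apply: val_inj.
have dg0 x : K x -> dg x = 0%R <-> torsion x.
  move=> Kx; rewrite dgE; split=> [/esym/piE | tx]; first by rewrite invg1 mul1g.
  by apply/esym/piE; rewrite invg1 mul1g.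
exists A, dg; split=> // a n n0; elim/quotW: a => x.
have -> : \pi_Q x = dg (val x) by rewrite (dgE _ (Kval x)); congr (\pi_Q _); apply: val_inj.
have dgX m : (dg (val x) *+ m)%R = dg (val x ^+ m).
  elim: m => [|m IH]; first by apply/esym/dg0; [exact: generated1 | exact: torsion1].
  by rewrite mulrS IH expgS dgM //; do ?apply: generatedX; exact: Kval.
rewrite dgX => /dg0 tx; apply/dg0; first exact: Kval.
by apply: (torsion_of_power n0); apply: tx; apply: generatedX; exact: Kval.
Qed.
End TorsionFreeQuotient.

Local Close Scope group_scope.
Local Open Scope ring_scope.

(** * Partial orders on a torsion-free abelian group *)

Section Cones.
Variable A : zmodType.
Hypothesis A_torsion_free : forall (a : A) n, (0 < n)%N -> a *+ n = 0 -> a = 0.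

(** The positive elements of a translation-invariant strict order. *)
Definition cone (P : A -> Prop) := (forall a b, P a -> P b -> P (a + b)) /\ ~ P 0.

Lemma cone_mulrn P a n : cone P -> P a -> (0 < n)%N -> P (a *+ n).
Proof.
case=> PD _ Pa; case: n => // n _; elim: n => [|n IH]; first by rewrite mulr1n.
by rewrite mulrS; exact: PD.
Qed.

(* The cone can be enlarged by [a] or by [- a]: if both failed, torsion-freeness would put
   0 in the cone. *)
Lemma exists_cone (F : seq A) : exists P, cone P /\ (forall f, f \in F -> f != 0 -> P f \/ P (- f)).
Proof.
elim: F => [|a F [P [PC PF]]]; first by exists (fun _ => False); split=> //; split.
have [-> | a0] := eqVneq a 0.
  by exists P; split=> // f; rewrite inE => /predU1P[-> | fF nf]; [rewrite eqxx | exact: PF].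
pose ext b (c : A) := exists p k, [/\ c = p + b *+ k, p = 0 \/ P p & P p \/ (0 < k)%N].
have [PD P0] := PC.
have ext_cone b : ~ ext b 0 -> cone (ext b).
  move=> nb; split=> // _ _ [p [k [-> p0 pk]]] [q [l [-> q0 ql]]].
  exists (p + q), (k + l)%N; split; first by rewrite mulrnDr addrACA.
    by case: p0 q0 => [->|Pp] [->|Pq]; rewrite ?addr0 ?add0r; auto.
  case: pk ql => [Pp|k0] [Pq|l0]; try by right; rewrite addn_gt0 ?k0 ?l0 ?orbT.
  by left; exact: PD.
have extP b c : P c -> ext b c by exists c, 0%N; rewrite mulr0n addr0; split; auto.
have extb b : ext b b by exists 0, 1%N; rewrite mulr1n add0r; split; auto.
suff [/ext_cone C|/ext_cone C] : ~ ext a 0 \/ ~ ext (- a) 0.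
- exists (ext a); split=> // f; rewrite inE => /predU1P[-> _| fF nf]; first by left.
  by case: (PF f fF nf); [left|right]; exact: extP.
- exists (ext (- a)); split=> // f; rewrite inE => /predU1P[-> _| fF nf]; first by right.
  by case: (PF f fF nf); [left|right]; exact: extP.
apply/not_andP=> -[[p [k [Ep p0 pk]]] [q [l [Eq q0 ql]]]].
have noP b r n : 0 = r + b *+ n -> b != 0 -> r = 0 \/ P r -> P r \/ (0 < n)%N -> P r /\ (0 < n)%N.
  move=> E b0; case: (posnP n) => [n0 | n0] [r0 | Pr] rn.
  - by subst; case: rn.
  - by move: E Pr; rewrite n0 mulr0n addr0 => <-.
  - by move: E; rewrite r0 add0r => /esym/(A_torsion_free n0)/eqP; rewrite (negPf b0).
  - by [].
have [Pp k0] := noP _ _ _ Ep a0 p0 pk.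
have [Pq l0] : P q /\ (0 < l)%N by apply: (noP _ _ _ Eq); rewrite ?oppr_eq0.
apply: P0; rewrite (_ : 0 = p *+ l + q *+ k); first by apply: PD; exact: cone_mulrn.
have -> : p = - (a *+ k) by apply/eqP; rewrite -addr_eq0 -Ep.
have -> : q = a *+ l by apply/eqP; rewrite -subr_eq0 -mulNrn -Eq.
by rewrite mulNrn -!mulrnA mulnC addNr.
Qed.
End Cones.

(** * Nilpotent elements and lifting of idempotents *)

Section Nilpotent.
Variable S : nzRingType.
Implicit Types x y : S.

Definition nilpotent x := exists n, x ^+ n = 0.

Lemma nilpotent0 : nilpotent 0.
Proof. by exists 1%N; rewrite expr1. Qed.

Lemma nilpotentM x y : GRing.comm x y -> nilpotent x -> nilpotent (x * y).
Proof. by move=> xy [n xn]; exists n; rewrite exprMn_comm // xn mul0r. Qed.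

Lemma nilpotentN x : nilpotent x -> nilpotent (- x).
Proof. by move=> [n xn]; exists n; rewrite exprNn xn mulr0. Qed.

Lemma nilpotent_exp x n : nilpotent (x ^+ n) -> nilpotent x.
Proof. by move=> [m xm]; exists (n * m)%N; rewrite exprM. Qed.

Lemma nilpotentD x y : GRing.comm x y -> nilpotent x -> nilpotent y -> nilpotent (x + y).
Proof.
move=> xy [n xn] [m ym]; exists (n + m)%N; rewrite exprDn_comm // big1 // => i _.
have [le | lt] := leqP m i.
  by rewrite -(subnK le) (exprD y) ym !mulr0 mul0rn.
have le : (n <= n + m - i)%N by rewrite -addnBA ?leq_addr // ltnW.
by rewrite -(subnK le) (exprD x) xn mulr0 mul0r mul0rn.
Qed.

(** The idempotent is [1 - (1 - e ^+ n) ^+ n]: it is a multiple of [e ^+ n], while its complement is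
    a multiple of [(1 - e) ^+ n]. [Q] keeps track of the support. *)
Lemma lift_idempotent (Q : S -> Prop) e : Q 1 -> (forall x y, Q x -> Q y -> Q (x - y)) ->
  (forall x y, Q x -> Q y -> Q (x * y)) -> Q e -> nilpotent (e * (1 - e)) ->
  exists f, [/\ Q f, f * f = f, f = 0 -> nilpotent e & f = 1 -> exists2 e', GRing.comm e e' & e * e' = 1].
Proof.
move=> Q1 QB QM Qe [n e0].
have QX x m : Q x -> Q (x ^+ m) by move=> Qx; elim: m => [|m IH]; rewrite ?expr0 // exprS; exact: QM.
have ce1 : GRing.comm e (1 - e) by apply: commrB; [exact: commr1 | exact: commr_refl].
pose s1 := \sum_(i < n) e ^+ i; pose w := (1 - e ^+ n) ^+ n; pose s2 := \sum_(i < n) (1 - e ^+ n) ^+ i.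
have cen : GRing.comm e (1 - e ^+ n) by apply: commrB; [exact: commr1 | exact: commrX].
have ces1 : GRing.comm e s1 by apply: commr_sum => i _; exact: commrX.
have ces2 : GRing.comm e s2 by apply: commr_sum => i _; exact: commrX.
have wE : w = (1 - e) ^+ n * s1 ^+ n.
  rewrite -exprMn_comm; last by apply/commr_sym/commrB; [exact: commr1 | exact/commr_sym].
  by rewrite /w -[in LHS]opprB subrX1 -mulNr opprB.
have wE' : 1 - w = e ^+ n * s2.
  by rewrite /w -[LHS]opprB subrX1 -mulNr addrAC subrr add0r opprK.
have ww : e ^+ n * w = 0 by rewrite wE mulrA -exprMn_comm // e0 mul0r.
have cs2w : s2 * w = w * s2 by apply/esym/commr_sum => i _; apply/commrX/commr_sym/commrX/commr_refl.
exists (1 - w); split=> [|||w1].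
- exact: (QB _ _ Q1 (QX _ _ (QB _ _ Q1 (QX _ _ Qe)))).
- by rewrite {1}wE' mulrBr mulr1 -mulrA cs2w mulrA ww mul0r subr0 -wE'.
- by move/eqP; rewrite subr_eq0 => /eqP w1; exists n; rewrite -[e ^+ n]mulr1 w1.
case: n => [|n] in e0 s1 w s2 ces1 ces2 cen wE wE' ww cs2w w1 *.
  by move/eqP: e0; rewrite expr0 oner_eq0.
exists (e ^+ n * s2); first by apply: commrM => //; exact: commrX.
by rewrite mulrA -exprS -wE'.
Qed.

Lemma comm_conjl s g g' x : GRing.comm s x -> g * x = x * g' -> s * g * x = x * (s * g').
Proof. by move=> sx gx; rewrite -mulrA gx !mulrA sx. Qed.

Lemma comm_conjr s g g' x : GRing.comm s x -> x * g = g' * x -> x * (s * g) = s * g' * x.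
Proof. by move=> sx gx; rewrite -[RHS]mulrA -gx !mulrA sx. Qed.

Lemma comm_unit_inverse x y e' : GRing.comm x y -> GRing.comm (x * y) e' -> x * y * e' = 1 ->
  x * (y * e') = 1 /\ y * e' * x = 1.
Proof.
move=> xy ce E; have E1 : x * (y * e') = 1 by rewrite mulrA.
have E2 : e' * y * x = 1 by rewrite -mulrA -xy -ce.
split=> //; suff -> : y * e' = e' * y by [].
by rewrite -[LHS]mul1r -E2 -mulrA E1 mulr1.
Qed.

Variables (I : Type) (X : I -> S).
Hypothesis XC : forall a b, GRing.comm (X a) (X b).

(** The double centralizer of the family [X]. It is commutative and closed under sums and products,
    so commutation need not be checked on expanded expressions. *)
Definition bicentral x := forall y, (forall a, GRing.comm y (X a)) -> GRing.comm x y.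

Lemma bicentral_gen a : bicentral (X a).
Proof. by move=> y yX; exact/commr_sym. Qed.

Lemma bicentralM x y : bicentral x -> bicentral y -> bicentral (x * y).
Proof. by move=> bx b_y z zX; apply/commr_sym/commrM; apply/commr_sym; [exact: bx | exact: b_y]. Qed.

Lemma bicentralC x y : bicentral x -> bicentral y -> GRing.comm x y.
Proof.
move=> bx b_y; apply: bx => a; apply: b_y => b; exact: XC.
Qed.

Lemma bicentral_sum (J : Type) (s : seq J) (Q : pred J) (f : J -> S) :
  (forall i, Q i -> bicentral (f i)) -> bicentral (\sum_(i <- s | Q i) f i).
Proof.
move=> bf y yX; apply/commr_sym/commr_sum => i Qi; exact/commr_sym/bf.
Qed.
End Nilpotent.

(** * Products of components of nonzero total degree *)

Section NilpotentProducts.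
Variables (A : zmodType) (S : nzRingType) (X Y : A -> S) (sX sY : seq A).
Hypothesis A_torsion_free : forall (a : A) n, (0 < n)%N -> a *+ n = 0 -> a = 0.
Hypotheses (uX : uniq sX) (X0 : forall a, a \notin sX -> X a = 0) (Y0 : forall b, b \notin sY -> Y b = 0).
Hypotheses (XX : forall a b, GRing.comm (X a) (X b)) (XY : forall a b, GRing.comm (X a) (Y b))
  (YY : forall a b, GRing.comm (Y a) (Y b)).
Hypothesis conv0 : forall c, c != 0 -> \sum_(a <- sX) X a * Y (c - a) = 0.

Let Z (i : A + A) := match i with inl a => X a | inr b => Y b end.
Let ZZ i j : GRing.comm (Z i) (Z j).
Proof. by case: i; case: j => a b //=; apply/commr_sym. Qed.
Let bX a : bicentral Z (X a). Proof. exact: (@bicentral_gen _ _ Z (inl a)). Qed.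
Let bY b : bicentral Z (Y b). Proof. exact: (@bicentral_gen _ _ Z (inr b)). Qed.

(* Descending induction on [a + b]: [(X a * Y b) ^+ 2] is minus the sum of [X a * Y b * (X
   i * Y j)] over the other pairs with [i + j = a + b], and this term is [X i * Y b * (X a
   * Y j)], one factor of which has a larger degree. *)
Lemma nilpotent_products_cone (P : A -> Prop) :
  cone P -> (forall a a', a \in sX -> a' \in sX -> a != a' -> P (a - a') \/ P (a' - a)) ->
  forall a b, P (a + b) -> nilpotent (X a * Y b).
Proof.
move=> [PD P0] PX a b.
pose F := [seq a + b | a <- sX, b <- sY]; pose up c := count (fun d => `[< P (d - c) >]) F.
have [n] := ubnP (up (a + b)); elim: n => // n IH in a b *; rewrite ltnS => len Pab.
have [aX | /X0 ->] := boolP (a \in sX); last by rewrite mul0r; exact: nilpotent0.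
have up_lt c d : c \in F -> P (c - d) -> (up c < up d)%N.
  move=> cF Pcd; rewrite /up.
  pose h e := `[< P (e - c) >]; have U := count_predUI h (pred1 c) F.
  have I0 : count (predI h (pred1 c)) F = 0%N.
    rewrite (@eq_count _ _ pred0) ?count_pred0 // => e /=.
    by apply/andP=> -[/asboolP Pec /eqP ec]; apply: P0; rewrite ec subrr in Pec.
  have lt : (count h F < count (predU h (pred1 c)) F)%N.
    by rewrite -[ltnRHS]addn0 -I0 U -[ltnLHS]addn0 ltn_add2l -has_count has_pred1.
  apply: leq_trans lt _.
  apply: sub_count => e /= /orP[/asboolP Pec | /eqP ->]; apply/asboolP => //.
  by rewrite -(subrK c e) -addrA; exact: PD.
have bXY a1 b1 : bicentral Z (X a1 * Y b1) by apply: bicentralM.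
have above a1 b1 d : a1 + b1 = (a + b) + d -> P d -> nilpotent (X a1 * Y b1).
  move=> E Pd.
  have [a1X | /X0 ->] := boolP (a1 \in sX); last by rewrite mul0r; exact: nilpotent0.
  have [b1Y | /Y0 ->] := boolP (b1 \in sY); last by rewrite mulr0; exact: nilpotent0.
  apply: IH; last by rewrite E; exact: PD.
  apply: leq_trans len; apply: up_lt; first by apply/allpairsP; exists (a1, b1).
  by rewrite E addrAC subrr add0r.
have c0 : a + b != 0 by apply/eqP=> E; apply: P0; rewrite -E.
have := conv0 c0; rewrite (bigD1_seq a) //= (addrC a b) addrK => /eqP; rewrite addr_eq0 => /eqP E.
apply: (@nilpotent_exp _ _ 2); rewrite expr2 {2}E mulrN; apply: nilpotentN.
rewrite mulr_sumr.
suff [] : nilpotent (\sum_(i <- sX | i != a) X a * Y b * (X i * Y (b + a - i))) /\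
  bicentral Z (\sum_(i <- sX | i != a) X a * Y b * (X i * Y (b + a - i))) by [].
rewrite big_seq_cond; elim/big_rec: _ => [|i t /andP[iX ia] [nt bt]].
  by split; [exact: nilpotent0 | move=> y _; exact: commr_sym (commr0 _)].
have bi : bicentral Z (X a * Y b * (X i * Y (b + a - i))) by apply: bicentralM.
split; last by move=> y yZ; apply/commr_sym/commrD; apply/commr_sym; [exact: bi | exact: bt].
apply: nilpotentD => //; first exact: bicentralC ZZ _ _ _ _.
have -> : X a * Y b * (X i * Y (b + a - i)) = X i * Y b * (X a * Y (b + a - i)).
  by rewrite -!mulrA [Y b * (X i * _)]mulrA -XY mulrA [Y b * (X a * _)]mulrA -XY !mulrA XX.
case: (PX i a iX aX ia) => Pia.
  apply: nilpotentM; first by apply: (bicentralC ZZ); exact: bicentralM.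
  by apply: (above _ _ (i - a)) => //; rewrite [RHS]addrC addrA subrK.
rewrite (bicentralC ZZ); try exact: bicentralM.
apply: nilpotentM; first by apply: (bicentralC ZZ); exact: bicentralM.
by apply: (above _ _ (a - i)) => //; rewrite !addrA.
Qed.

Lemma nilpotent_products a b : a + b != 0 -> nilpotent (X a * Y b).
Proof.
move=> ab0.
have [P [PC PF]] := exists_cone A_torsion_free ((a + b) :: [seq x - y | x <- sX, y <- sX]).
have PX x y : x \in sX -> y \in sX -> x != y -> P (x - y) \/ P (y - x).
  move=> xX yX xy; rewrite -(opprB x y); apply: PF; last by rewrite subr_eq0.
  by rewrite inE; apply/orP; right; apply/allpairsP; exists (x, y).
case: (PF (a + b) (mem_head _ _) ab0) => Pab; first exact: nilpotent_products_cone Pab.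
apply: (@nilpotent_products_cone (fun x => P (- x))) Pab.
  by case: PC => PD P0; split=> [x y Px Py|]; rewrite ?oppr0 // opprD; exact: PD.
by move=> x y xX yX xy; rewrite !opprB; case: (PX x y xX yX xy); [right|left].
Qed.
End NilpotentProducts.

(** * Group rings *)

Section GroupRingCoefficients.
Variables (R : nzRingType) (G : groupType).
Local Notation RG := (group_ring R G).
Implicit Types (a b c : RG) (g h x y : G) (Q : pred G).

Definition gr_elt g : RG := << g >>.

Lemma gr_ext a b : (forall g, a@_g = b@_g) -> a = b.
Proof. by move=> E; apply/malgP. Qed.

Lemma gr_coefM a b g : (a * b)@_g = \sum_(x <- msupp a) a@_x * b@_(x^-1 * g)%g.
Proof.
rewrite -[a * b]/(gr_mul a b) /gr_mul raddf_sum; apply: eq_bigr => x _.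
rewrite raddf_sum /=.
have E y : (<< a@_x * b@_y *g (x * y)%g >> : {malg R[G]})@_g = if y == (x^-1 * g)%g then a@_x * b@_y else 0.
  by rewrite mcoeffU -[(_ * _)%g == g](inj_eq (mulgI x^-1%g)) mulKg; case: eqP.
rewrite (eq_bigr _ (fun y _ => E y)) -big_mkcond /=.
have [yb | yb] := boolP ((x^-1 * g)%g \in msupp b).
  rewrite (big_rem _ yb) eqxx big_seq_cond big1 /= ?addr0 // => y.
  by rewrite mem_rem_uniq ?fset_uniq // inE => /andP[/andP[/negPf->]].
rewrite big_seq_cond big1 ?(mcoeff_outdom yb) ?mulr0 // => y /andP[ys /eqP E'].
by rewrite -E' ys in yb.
Qed.

Lemma gr_coefMw (s : seq G) a b g : uniq s -> {subset msupp a <= s} ->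
  (a * b)@_g = \sum_(x <- s) a@_x * b@_(x^-1 * g)%g.
Proof.
move=> us sub; rewrite gr_coefM [RHS](bigID (mem (msupp a))) /= [X in _ = _ + X]big1 => [|x xa]; last first.
  by rewrite mcoeff_outdom ?mul0r.
rewrite addr0 -[RHS]big_filter; apply/perm_big/uniq_perm; rewrite ?filter_uniq ?fset_uniq // => x.
by rewrite mem_filter; case: (boolP (x \in msupp a)) => // /sub ->.
Qed.

Lemma gr_supp_mul a b g : g \in msupp (a * b) ->
  exists x y, [/\ x \in msupp a, y \in msupp b & g = (x * y)%g].
Proof.
rewrite -mcoeff_neq0 gr_coefM => nz.
have [/hasP[x xa]|/hasPn no] := boolP (has (fun x => (x^-1 * g)%g \in msupp b) (msupp a)).
  by move=> yb; exists x, (x^-1 * g)%g; rewrite mulKVg.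
case/negP: nz; rewrite big_seq big1 // => x /no /mcoeff_outdom ->; exact: mulr0.
Qed.

Lemma gr_coef1 g : (1 : RG)@_g = (g == 1%g)%:R.
Proof. by rewrite -[1]/(gr_one R G) /gr_one mcoeffU eq_sym. Qed.

Lemma gr_coef_elt g h : (gr_elt g)@_h = (g == h)%:R.
Proof. by rewrite mcoeffU. Qed.

Lemma gr_supp_elt g : msupp (gr_elt g) = [fset g]%fset.
Proof. by rewrite msuppU oner_eq0. Qed.

Lemma gr_coef_elt_mul g a h : (gr_elt g * a)@_h = a@_(g^-1 * h)%g.
Proof. by rewrite gr_coefM gr_supp_elt big_seq_fset1 gr_coef_elt eqxx mul1r. Qed.

Lemma gr_coef_mul_elt a g h : (a * gr_elt g)@_h = a@_(h * g^-1)%g.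
Proof.
have E x : a@_x * (gr_elt g)@_(x^-1 * h)%g = if x == (h * g^-1)%g then a@_x else 0.
  rewrite gr_coef_elt -(inj_eq (mulgI x)) mulKVg -[_ == h](inj_eq (mulIg g^-1%g)) mulgK.
  by case: eqP => _; rewrite ?mulr1 ?mulr0.
rewrite gr_coefM (eq_bigr _ (fun x _ => E x)) -big_mkcond /=.
have [ya | ya] := boolP ((h * g^-1)%g \in msupp a).
  rewrite (big_rem _ ya) eqxx big_seq_cond big1 /= ?addr0 // => y.
  by rewrite mem_rem_uniq ?fset_uniq // inE => /andP[/andP[/negPf->]].
rewrite big_seq_cond big1 ?(mcoeff_outdom ya) // => y /andP[ys /eqP E'].
by rewrite -E' ys in ya.
Qed.

Lemma gr_elt1 : gr_elt 1%g = 1. Proof. by []. Qed.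

Lemma gr_eltM g h : gr_elt (g * h)%g = gr_elt g * gr_elt h.
Proof. by apply: gr_ext => x; rewrite gr_coef_elt_mul !gr_coef_elt -[h == _](inj_eq (mulgI g)) mulKVg. Qed.

Lemma gr_supp_mul_elt g a x : (x \in msupp (a * gr_elt g)) = ((x * g^-1)%g \in msupp a).
Proof. by rewrite -!mcoeff_neq0 gr_coef_mul_elt. Qed.

Definition gr_restr Q a : RG := \sum_(g <- msupp a | Q g) << a@_g *g g >>.

Lemma gr_coef_restr Q a g : (gr_restr Q a)@_g = if Q g then a@_g else 0.
Proof.
rewrite /gr_restr big_mkcond raddf_sum /=.
have [ga | ga] := boolP (g \in msupp a); last first.
  rewrite (mcoeff_outdom ga) if_same big_seq big1 // => x xa; case: ifP => _; rewrite ?mcoeff0 // mcoeffU.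
  by case: eqP => // xg; rewrite -xg xa in ga.
rewrite (big_rem _ ga) /= big_seq big1 ?addr0 => [|x].
  by case: ifP => _; rewrite ?mcoeff0 ?mcoeffUU.
rewrite mem_rem_uniq ?fset_uniq // inE => /andP[/negPf xg _].
by case: ifP => _; rewrite ?mcoeff0 // mcoeffU xg.
Qed.

Lemma gr_supp_restr Q a g : (g \in msupp (gr_restr Q a)) = Q g && (g \in msupp a).
Proof. by rewrite -!mcoeff_neq0 gr_coef_restr; case: (Q g); rewrite ?eqxx. Qed.

Lemma gr_restr_id Q a : {in msupp a, forall g, Q g} -> gr_restr Q a = a.
Proof.
move=> sQ; apply: gr_ext => g; rewrite gr_coef_restr; case: ifP => // nQ.
by apply/esym/mcoeff_outdom/negP=> /sQ; rewrite nQ.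
Qed.

Lemma gr_restr_mull Q1 Q2 a b :
  (forall x y, x \in msupp a -> y \in msupp b -> Q1 (x * y)%g = Q2 y) ->
  gr_restr Q1 (a * b) = a * gr_restr Q2 b.
Proof.
move=> EQ; apply: gr_ext => g; rewrite gr_coef_restr !gr_coefM.
rewrite -[LHS]/(if Q1 g then _ else _) (_ : (if Q1 g then _ else _) =
  \sum_(x <- msupp a) if Q1 g then a@_x * b@_(x^-1 * g)%g else 0); last first.
  by case: (Q1 g) => //; rewrite big1.
rewrite !big_seq; apply: eq_bigr => x xa; rewrite gr_coef_restr.
have [yb | /mcoeff_outdom ->] := boolP ((x^-1 * g)%g \in msupp b); last by rewrite !mulr0 !if_same mulr0.
by rewrite -(EQ _ _ xa yb) mulKVg; case: ifP; rewrite ?mulr0.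
Qed.

Lemma gr_restr_mulr Q1 Q2 a b :
  (forall x y, x \in msupp a -> y \in msupp b -> Q1 (x * y)%g = Q2 x) ->
  gr_restr Q1 (a * b) = gr_restr Q2 a * b.
Proof.
move=> EQ; apply: gr_ext => g; rewrite gr_coef_restr gr_coefM.
rewrite (@gr_coefMw (msupp a) (gr_restr Q2 a)) ?fset_uniq //; last by move=> x; rewrite gr_supp_restr => /andP[].
rewrite (_ : (if Q1 g then _ else _) =
  \sum_(x <- msupp a) if Q1 g then a@_x * b@_(x^-1 * g)%g else 0); last first.
  by case: (Q1 g) => //; rewrite big1.
rewrite !big_seq; apply: eq_bigr => x xa; rewrite gr_coef_restr.
have [yb | /mcoeff_outdom ->] := boolP ((x^-1 * g)%g \in msupp b); last by rewrite !mulr0 !if_same.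
by rewrite -(EQ _ _ xa yb) mulKVg; case: ifP; rewrite ?mul0r.
Qed.
End GroupRingCoefficients.

(** * Sums of coefficients over classes, and scalars *)

Section Trace.
Variables (R : comNzRingType) (G : groupType).
Local Notation RG := (group_ring R G).
Implicit Types (a b : RG) (Q : pred G).

Definition gr_trace Q a : R := mmap idfun (fun g => (Q g)%:R) a.

Lemma gr_traceU Q r g : gr_trace Q (<< r *g g >> : RG) = r * (Q g)%:R.
Proof. exact: mmapU. Qed.

Lemma gr_traceM Q a b :
  gr_trace Q (a * b) = \sum_(x <- msupp a) \sum_(y <- msupp b) a@_x * b@_y * (Q (x * y)%g)%:R.
Proof.
rewrite -[a * b]/(gr_mul a b) /gr_mul /gr_trace raddf_sum; apply: eq_bigr => x _.
by rewrite raddf_sum; apply: eq_bigr => y _; exact: mmapU.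
Qed.

Lemma gr_traceC Q a b :
  (forall x y, x \in msupp a -> y \in msupp b -> Q (x * y)%g = Q (y * x)%g) ->
  gr_trace Q (a * b) = gr_trace Q (b * a).
Proof.
move=> QC; rewrite !gr_traceM exchange_big /= !big_seq; apply: eq_bigr => y yb.
by rewrite !big_seq; apply: eq_bigr => x xa; rewrite QC // (mulrC a@_x).
Qed.

Definition gr_scalar (r : R) : RG := << r *g 1%g >>.

Lemma gr_monomE r g : (<< r *g g >> : RG) = gr_scalar r * gr_elt R g.
Proof. by rewrite [RHS]gr_mulUU mulr1 mul1g. Qed.

Lemma gr_scalarC r a : GRing.comm (gr_scalar r) a.
Proof.
rewrite /GRing.comm; elim/gr_ind: a => [|a1 a2 C1 C2|s h].
- by rewrite mul0r mulr0.
- by rewrite mulrDl mulrDr C1 C2.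
by rewrite [LHS]gr_mulUU [RHS]gr_mulUU mulrC mulg1 mul1g.
Qed.

Lemma gr_sumE a : a = \sum_(g <- msupp a) gr_scalar a@_g * gr_elt R g.
Proof. by rewrite {1}(monalgE a); apply: eq_bigr => g _; exact: gr_monomE. Qed.

Lemma gr_comm_elts a : (forall g, GRing.comm a (gr_elt R g)) -> forall b, GRing.comm a b.
Proof.
move=> ag; elim/gr_ind => [|b1 b2 C1 C2|r g]; first exact: commr0.
  exact: commrD.
by rewrite gr_monomE; apply: commrM => //; exact/commr_sym/gr_scalarC.
Qed.
End Trace.

(** * Finite subgroups and idempotents of their group rings *)

Record subgroup_embedding (G : groupType) (P : G -> Prop) (T : finGroupType) (iota : T -> G) : Prop := {
  emb_inj : injective iota;
  embM : forall x y : T, iota (x * y)%g = (iota x * iota y)%g;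
  emb_in : forall t, P (iota t);
  emb_onto : forall x, P x -> exists t, x = iota t }.

Lemma finite_subgroup_type (G : groupType) (P : G -> Prop) (L : seq G) :
  (forall x, P x -> x \in L) -> P 1%g -> (forall x y, P x -> P y -> P (x * y)%g) ->
  (forall x, P x -> P x^-1%g) -> exists (T : finGroupType) (iota : T -> G), subgroup_embedding P iota.
Proof.
move=> PL P1 PM PV; pose L' := [seq x <- L | `[< P x >]].
have L'P x : x \in L' <-> P x.
  by rewrite mem_filter; split=> [/andP[/asboolP] // | Px]; rewrite PL // andbT; apply/asboolP.
pose mk x (Px : P x) : seq_sub L' := SeqSub ((L'P x).2 Px).
have valP' (t : seq_sub L') : P (val t) by apply/L'P/(valP t).
pose m (s t : seq_sub L') := mk _ (PM _ _ (valP' s) (valP' t)).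
pose i (s : seq_sub L') := mk _ (PV _ (valP' s)).
have mA : associative m by move=> x y z; apply: val_inj; exact: mulgA.
have m1 : left_id (mk _ P1) m by move=> x; apply: val_inj; exact: mul1g.
have mV : left_inverse (mk _ P1) i m by move=> x; apply: val_inj; exact: mulVg.
pose T : finGroupType := HB.pack (seq_sub L') (Finite_isGroup.Build (seq_sub L') mA m1 mV).
exists T, (fun t : T => val (t : seq_sub L')); split=> //; first exact: val_inj.
by move=> x Px; exists (mk x Px).
Qed.

Section Embedding.
Variables (G : groupType) (P : G -> Prop) (T : finGroupType) (iota : T -> G).
Hypothesis E : subgroup_embedding P iota.

Lemma emb1 : iota 1%g = 1%g.
Proof. by apply: (mulgI (iota 1%g)); rewrite -(embM E) !mulg1. Qed.

Lemma embV x : iota x^-1%g = (iota x)^-1%g.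
Proof. by apply: (mulgI (iota x)); rewrite -(embM E) !mulgV emb1. Qed.

Lemma embX x n : iota (x ^+ n)%g = (iota x ^+ n)%g.
Proof. by elim: n => [|n IH]; rewrite ?expg0 ?emb1 // !expgS (embM E) IH. Qed.

Lemma emb_order t : elt_order (iota t) #[t]%g.
Proof.
split=> [||m /andP[m0 lt] /eqP]; first exact: order_gt0.
  by rewrite -embX expg_order emb1.
rewrite -embX -emb1 (inj_eq (emb_inj E)) -order_dvdn => /(dvdn_leq m0).
by rewrite leqNgt lt.
Qed.

Lemma emb_coefM (R : nzRingType) (a b : group_ring R G) t :
  (forall x, x \in msupp a -> P x) ->
  (a * b)@_(iota t) = \sum_(x : T) a@_(iota x) * b@_(iota (x^-1 * t)%g).
Proof.
move=> aP; rewrite (@gr_coefMw _ _ [seq iota x | x : T]).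
- rewrite big_map big_enum; apply: eq_bigr => x _; by rewrite (embM E) embV.
- by rewrite map_inj_uniq ?enum_uniq //; exact: emb_inj E.
by move=> x /aP/(emb_onto E)[y ->]; rewrite map_f ?mem_enum.
Qed.
End Embedding.

(** In a full-rank factorization of [M], idempotence makes the product of the factors in the
    opposite order an identity matrix of size the rank. *)
Lemma mxtrace_idempotent (F : fieldType) n (M : 'M[F]_n) : M *m M = M -> \tr M = (\rank M)%:R.
Proof.
move=> MM; have RC : row_base M *m col_base M = 1%:M.
  apply: (row_full_inj (col_base_full M)); apply: (row_free_inj (row_base_free M)).
  by rewrite mulmx1 mulmx_base -mulmxA -mulmxA mulmx_base mulmxA mulmx_base MM.
by rewrite -[in LHS](mulmx_base M) mxtrace_mulC RC mxtrace1.
Qed.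

(** After division by the gcd, a Bezout relation would invert in [R] any prime divisor left in
    [n]. *)
Lemma dvdn_of_adapted (R : idomainType) n r (d : R) : [pchar R] =i pred0 -> (0 < n)%N ->
  (forall p, prime p -> (p %| n)%N -> p%:R \isn't a @GRing.unit R) -> n%:R * d = r%:R -> (n %| r)%N.
Proof.
move=> /pcharf0P ch0 n0 adp E; pose g := gcdn n r.
have g0 : (0 < g)%N by rewrite gcdn_gt0 n0.
have [nE rE] : n = (n %/ g * g)%N /\ r = (r %/ g * g)%N by rewrite !divnK ?dvdn_gcdl ?dvdn_gcdr.
have n'0 : (0 < n %/ g)%N by rewrite divn_gt0 // dvdn_leq // dvdn_gcdl.
have cop : coprime (n %/ g) (r %/ g) by rewrite /coprime -(eqn_pmul2r g0) muln_gcdl -nE -rE mul1n.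
have E' : (n %/ g)%:R * d = (r %/ g)%:R.
  apply: (@mulIf _ g%:R); first by rewrite ch0 -lt0n.
  by rewrite mulrAC -!natrM -nE -rE.
have [lt | le] := ltnP 1 (n %/ g); last first.
  have -> : n = g by rewrite {1}nE; move: le n'0; case: (n %/ g)%N => [|[]] //; rewrite mul1n.
  exact: dvdn_gcdr.
have pp := pdiv_prime lt; set p := pdiv _ in pp.
have pn : (p %| n %/ g)%N := pdiv_dvd _.
have /coprimeP[|[u v] /= uv] : coprime p (r %/ g) by apply: coprime_dvdl pn cop.
  exact: prime_gt0.
case/negP: (adp p pp (dvdn_trans pn (dvdn_div (dvdn_gcdl _ _)))).
have up : p%:R * (u%:R - v%:R * ((n %/ g) %/ p)%:R * d) = 1.
  have Ep : p%:R * (v%:R * ((n %/ g) %/ p)%:R * d) = v%:R * (r %/ g)%:R.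
    by rewrite -E' -[in RHS](divnK pn) natrM -!mulrA mulrCA; congr (_ * _); rewrite mulrCA.
  rewrite mulrBr Ep.
  have le : (v * (r %/ g) <= u * p)%N by apply/ltnW; rewrite -subn_gt0 uv.
  by rewrite [p%:R * _]mulrC -!natrM -natrB // uv.
by apply/unitrP; exists (u%:R - v%:R * ((n %/ g) %/ p)%:R * d); rewrite mulrC.
Qed.

Local Notation "x %:F" := (@FracField.tofrac _ x).

(* The regular representation of the idempotent has trace [#|T| * f 1], which is also its
   rank. *)
Lemma idempotent_trivial (T : finGroupType) (R : idomainType) (f : T -> R) : [pchar R] =i pred0 ->
  (forall p, prime p -> (p %| #|T|)%N -> p%:R \isn't a @GRing.unit R) ->
  (forall t, \sum_x f x * f (x^-1 * t)%g = f t) ->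
  (forall t, f t = 0) \/ (forall t, f t = (t == 1%g)%:R).
Proof.
move=> ch0 adp ff; have T0 : (0 < #|T|)%N by apply/card_gt0P; exists 1%g.
pose M := \matrix_(i < #|T|, j < #|T|) (f ((enum_val i)^-1 * enum_val j)%g)%:F : 'M[{fraction R}]_#|T|.
have MM : M *m M = M.
  apply/matrixP=> i k; rewrite !mxE -ff rmorph_sum.
  rewrite (reindex_inj (mulgI (enum_val i)^-1%g)) (reindex (@enum_val _ T)) /=; last first.
    by exists enum_rank => x _; rewrite ?enum_valK ?enum_rankK.
  by apply: eq_bigr => j _; rewrite !mxE -rmorphM invMg invgK -[((_ * enum_val i) * _)%g]mulgA mulKVg.
have trM : \tr M = (#|T|%:R * f 1%g)%:F.
  rewrite /mxtrace (eq_bigr (fun=> (f 1%g)%:F)) => [|i _]; last by rewrite mxE mulVg.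
  by rewrite sumr_const card_ord mulr_natl rmorphMn.
have rE : #|T|%:R * f 1%g = (\rank M)%:R.
  by apply/eqP; rewrite -tofrac_eq -trM mxtrace_idempotent // rmorph_nat.
have ME t : (f t)%:F = M (enum_rank 1%g) (enum_rank t) by rewrite mxE !enum_rankK invg1 mul1g.
have := dvdn_of_adapted ch0 T0 adp rE; have [r0 _ | r0] := posnP (\rank M).
  left=> t; apply/eqP; rewrite -tofrac_eq0 ME.
  by move/eqP: r0; rewrite mxrank_eq0 => /eqP ->; rewrite mxE.
move=> /(dvdn_leq r0) ge; right=> t; apply/eqP; rewrite -tofrac_eq ME.
have uM : row_full M by rewrite /row_full eqn_leq rank_leq_row ge.
have -> : M = 1%:M by apply: (row_full_inj uM); rewrite MM mulmx1.
by rewrite mxE (inj_eq enum_rank_inj) [1%g == _]eq_sym rmorph_nat.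
Qed.

(** * Elements supported on a subgroup *)

Section Supported.
Variables (R : nzRingType) (G : groupType) (P : G -> Prop).
Hypotheses (P1 : P 1%g) (PM : forall x y, P x -> P y -> P (x * y)%g).
Local Notation RG := (group_ring R G).
Implicit Types a b : RG.

Definition supported a := forall x, x \in msupp a -> P x.

Lemma supported1 : supported 1.
Proof. by move=> x; rewrite -mcoeff_neq0 gr_coef1; case: (x =P 1%g) => [-> // |]; rewrite eqxx. Qed.

Lemma supportedM a b : supported a -> supported b -> supported (a * b).
Proof. by move=> Pa Pb _ /gr_supp_mul[x [y [/Pa Px /Pb Py ->]]]; exact: PM. Qed.

Lemma supportedB a b : supported a -> supported b -> supported (a - b).
Proof.
move=> Pa Pb x; rewrite -mcoeff_neq0 mcoeffB.
have [/Pa // | /mcoeff_outdom ->] := boolP (x \in msupp a).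
by have [/Pb // | /mcoeff_outdom ->] := boolP (x \in msupp b); rewrite subrr eqxx.
Qed.

(** The restriction of [b] to the subgroup is already a right inverse of [a], hence equals [b]. *)
Lemma supported_inverse a b : (forall x, P x -> P x^-1%g) -> supported a -> a * b = 1 -> b * a = 1 -> supported b.
Proof.
move=> PV Pa ab ba.
have E : a * gr_restr (fun x => `[< P x >]) b = 1.
  rewrite -(@gr_restr_mull _ _ (fun x => `[< P x >])) => [|x y /Pa Px _].
    by rewrite ab gr_restr_id // => x x1; apply/asboolP; exact: supported1.
  apply/asboolP/asboolP => [Pxy | Py]; last exact: PM.
  by rewrite -(mulKg x y); apply: PM => //; exact: PV.
have <- : gr_restr (fun x => `[< P x >]) b = b by rewrite -[LHS]mul1r -ba -mulrA E mulr1.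
by move=> x; rewrite gr_supp_restr => /andP[/asboolP].
Qed.
End Supported.

Section Idempotent.
Variables (R : idomainType) (G : groupType) (P : G -> Prop) (L : seq G).
Hypothesis R_adapted : G_adapted G R.
Hypotheses (PL : forall x, P x -> x \in L) (P1 : P 1%g) (PM : forall x y, P x -> P y -> P (x * y)%g)
  (PV : forall x, P x -> P x^-1%g).
Local Notation RG := (group_ring R G).
Implicit Types e f : RG.

Lemma gr_idempotent f : supported P f -> f * f = f -> f = 0 \/ f = 1.
Proof.
move=> Pf ff; have [T [iota E]] := finite_subgroup_type PL P1 PM PV.
have [ch0 adp] := R_adapted.
have out x : ~ P x -> f@_x = 0 by move=> nP; apply/mcoeff_outdom/negP=> /Pf.
case: (@idempotent_trivial T R (fun t => f@_(iota t)) ch0) => [p pp pT | t | f0 | f1].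
- have [t _ ot] := Cauchy pp (etrans (congr1 (dvdn p) (cardsT T)) pT).
  by apply: adp => //; exists (iota t); rewrite -ot; exact: emb_order E t.
- by rewrite -[in RHS]ff (emb_coefM E).
- left; apply: gr_ext => x; rewrite mcoeff0; case: (pselect (P x)) => [/(emb_onto E)[t ->] // | /out //].
right; apply: gr_ext => x; rewrite gr_coef1; case: (pselect (P x)) => [/(emb_onto E)[t ->] | nP].
  by rewrite f1 -(emb1 E) (inj_eq (emb_inj E)).
by rewrite out //; case: eqP nP => [-> /(_ P1) | ].
Qed.

Lemma gr_nilpotent_or_unit e : supported P e -> nilpotent (e * (1 - e)) ->
  nilpotent e \/ exists2 e', GRing.comm e e' & e * e' = 1.
Proof.
move=> Pe ne.
have [f [Pf ff f0 f1]] := @lift_idempotent _ (@supported R G P) e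
  (@supported1 R G P P1) (@supportedB R G P) (@supportedM R G P PM) Pe ne.
by have [/f0 | /f1] := gr_idempotent Pf ff; [left | right].
Qed.
End Idempotent.

(** * Normalizing units with torsion support *)

Record normalizing_unit (R : nzRingType) (G : groupType) (phi : G -> G) (u v : group_ring R G) : Prop := {
  nu_mulV : u * v = 1;
  nu_mulVu : v * u = 1;
  nu_conj : forall g, gr_elt R g * u = u * gr_elt R (phi g) }.

Section ReductionToTorsion.
Variables (R : idomainType) (G : groupType) (phi : G -> G) (u v : group_ring R G).
Hypotheses (R_adapted : G_adapted G R) (nu : normalizing_unit phi u v) (u1 : 1%g \in msupp u).
Local Notation RG := (group_ring R G).
Local Notation "g %:G" := (gr_elt R g) (at level 2, format "g %:G").
Implicit Types (a b : RG) (g h x y : G).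

Let uv := nu_mulV nu.
Let vu := nu_mulVu nu.
Let gu := nu_conj nu.

Lemma nu_coef g x : u@_(g^-1 * x * phi g)%g = u@_x.
Proof.
by rewrite -mulgA -gr_coef_elt_mul gu gr_coef_mul_elt mulgK.
Qed.

Lemma nu_conjV g : v * g%:G = (phi g)%:G * v.
Proof. by rewrite -[g%:G]mulr1 -uv !mulrA -(mulrA v) gu mulrA vu mul1r. Qed.

Let D : seq G := [seq (x * y^-1)%g | x <- msupp u, y <- msupp u].
Let DP x y : x \in msupp u -> y \in msupp u -> (x * y^-1)%g \in D.
Proof. by move=> xu yu; apply/allpairsP; exists (x, y). Qed.
Let DV d : d \in D -> (d^-1)%g \in D.
Proof. by case/allpairsP=> -[x y] [/= xu yu ->]; rewrite invMg invgK; exact: DP. Qed.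
Let DJ d g : d \in D -> (d ^ g)%g \in D.
Proof.
case/allpairsP=> -[x y] [/= xu yu ->].
rewrite (_ : _ ^ g = (g^-1 * x * phi g) * (g^-1 * y * phi g)^-1)%g.
  by apply: DP; rewrite -mcoeff_neq0 nu_coef mcoeff_neq0.
by rewrite conjgE !invMg invgK !mulgA mulgK.
Qed.

Local Notation K := (generated D).
Let K1 : K 1%g := generated1 D.
Let KM x y : K x -> K y -> K (x * y)%g. Proof. exact: generatedM. Qed.
Let KV x : K x -> K x^-1%g. Proof. exact: generatedV. Qed.
Let KJ x g : K x -> K (x ^ g)%g. Proof. by apply: generatedJ => d; exact: DJ. Qed.
Let Ku : supported K u.
Proof. by move=> x xu; rewrite -[x]mulg1 -[X in (x * X)%g]invg1; apply/mem_generated/DP. Qed.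

Let Kv : supported K v.
Proof. exact: supported_inverse Ku uv vu. Qed.

(* The products of [v] and [g * u] in the two orders are [phi g] and [g], and they have
   the same sum of coefficients over each [K]-class. *)
Lemma nu_conj_trace g : K g -> exists2 k, K k & phi g = (g ^ k)%g.
Proof.
move=> Kg; pose Q x := `[< exists2 k, K k & x = (g ^ k)%g >].
have Kgu : supported K (g%:G * u).
  apply: supportedM => //; move=> x; rewrite gr_supp_elt inE => /eqP -> //.
suff : Q (phi g) by move/asboolP.
have E : gr_trace Q (phi g)%:G = 1.
  rewrite -[_%:G]mul1r -vu -mulrA -gu gr_traceC; last first.
    move=> x y /Kv Kx /Kgu Ky; apply/asboolP/asboolP => -[k Kk E].
      exists (k * x)%g; first exact: KM.
      by rewrite conjgM -E conjgE !mulgA mulVg mul1g.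
    exists (k * x^-1)%g; first by apply: KM => //; exact: KV.
    by rewrite conjgM -E conjgE invgK !mulgA mulgK.
  rewrite -mulrA uv mulr1 gr_traceU mul1r.
  by have -> : Q g by apply/asboolP; exists 1%g; rewrite ?conjg1.
move: E; rewrite gr_traceU mul1r; case: (Q _) => // /eqP.
by rewrite eq_sym oner_eq0.
Qed.

(** * Homogeneous components of a normalizing unit *)

Section Grading.
Variables (A : zmodType) (dg : G -> A).
Hypotheses (dgM : forall x y, K x -> K y -> dg (x * y)%g = dg x + dg y)
  (dg0 : forall x, K x -> dg x = 0 <-> torsion x)
  (A_torsion_free : forall (a : A) n, (0 < n)%N -> a *+ n = 0 -> a = 0).
Implicit Types i j c : A.

Let dg1 : dg 1%g = 0. Proof. by apply/dg0 => //; exact: torsion1. Qed.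
Let dgV x : K x -> dg x^-1%g = - dg x.
Proof. by move=> Kx; apply/eqP; rewrite -addr_eq0 -dgM ?mulVg ?dg1 //; exact: KV. Qed.
Let dgJ x y : K x -> K y -> dg (x ^ y)%g = dg x.
Proof.
by move=> Kx Ky; rewrite conjgE !dgM ?dgV //; [rewrite addrCA addNr addr0 | exact: KV | exact: KM].
Qed.
Let dg_phi g : K g -> K (phi g) /\ dg (phi g) = dg g.
Proof. by move=> Kg; have [k Kk ->] := nu_conj_trace Kg; split; [exact: KJ | exact: dgJ]. Qed.

Definition hcomp c a : RG := gr_restr (fun x => `[< K x >] && (dg x == c)) a.

Let hcompP c a x : x \in msupp (hcomp c a) -> [/\ K x, dg x = c & x \in msupp a].
Proof. by rewrite gr_supp_restr => /andP[/andP[/asboolP Kx /eqP xc] xa]. Qed.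

Let Khcomp c a : supported K (hcomp c a).
Proof. by move=> x /hcompP[]. Qed.

Let hcomp_mull c i a b : supported K a -> (forall x, x \in msupp a -> dg x = i) -> supported K b ->
  hcomp c (a * b) = a * hcomp (c - i) b.
Proof.
move=> Ka ai Kb; apply: gr_restr_mull => x y xa yb.
have [Kx Ky] := (Ka x xa, Kb y yb); rewrite !asboolT //; last exact: KM.
by rewrite dgM // (ai x xa) addrC; apply/eqP/eqP => [<- | ->]; rewrite ?addrK ?subrK.
Qed.

Let hcomp_mulr c j a b : supported K a -> supported K b -> (forall x, x \in msupp b -> dg x = j) ->
  hcomp c (a * b) = hcomp (c - j) a * b.
Proof.
move=> Ka Kb bj; apply: gr_restr_mulr => x y xa yb.
have [Kx Ky] := (Ka x xa, Kb y yb); rewrite !asboolT //; last exact: KM.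
by rewrite dgM // (bj y yb); apply/eqP/eqP => [<- | ->]; rewrite ?addrK ?subrK.
Qed.

Local Notation X := (hcomp^~ u).
Local Notation Y := (hcomp^~ v).

Let Kelt g : K g -> supported K g%:G.
Proof. by move=> Kg x; rewrite gr_supp_elt inE => /eqP ->. Qed.
Let dg_elt g : forall x, x \in msupp g%:G -> dg x = dg g.
Proof. by move=> x; rewrite gr_supp_elt inE => /eqP ->. Qed.

(** On [K], [phi] preserves degrees, so the relation for [u] splits into its components. *)
Let conjX g i : K g -> g%:G * X i = X i * (phi g)%:G.
Proof.
move=> Kg; have [Kp dp] := dg_phi Kg.
have := congr1 (hcomp (i + dg g)) (gu g).
rewrite (hcomp_mull _ (Kelt Kg) (@dg_elt g)) // (hcomp_mulr _ _ (Kelt Kp) (@dg_elt (phi g))) //.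
by rewrite dp addrK.
Qed.

Let conjY g j : K g -> Y j * g%:G = (phi g)%:G * Y j.
Proof.
move=> Kg; have [Kp dp] := dg_phi Kg.
have := congr1 (hcomp (j + dg g)) (nu_conjV g).
rewrite (hcomp_mull _ (Kelt Kp) (@dg_elt (phi g))) // (hcomp_mulr _ _ (Kelt Kg) (@dg_elt g)) //.
by rewrite dp addrK.
Qed.

Let conj_sum a : v * a * u = \sum_(g <- msupp a) gr_scalar G a@_g * (phi g)%:G.
Proof.
rewrite [in LHS](gr_sumE a) [v * _]mulr_sumr mulr_suml; apply: eq_bigr => g _.
by rewrite mulrA -[v * _]gr_scalarC -!mulrA gu [v * (u * _)]mulrA vu mul1r.
Qed.

Let conjX_lin a i : supported K a -> a * X i = X i * (v * a * u).
Proof.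
move=> Ka; rewrite conj_sum {1}(gr_sumE a) mulr_suml mulr_sumr !big_seq.
apply: eq_bigr => g /Ka Kg.
by apply: comm_conjl; [exact: gr_scalarC | exact: conjX].
Qed.

Let conjY_lin a j : supported K a -> Y j * a = v * a * u * Y j.
Proof.
move=> Ka; rewrite conj_sum {1}(gr_sumE a) [LHS]mulr_sumr [RHS]mulr_suml !big_seq.
apply: eq_bigr => g /Ka Kg.
by apply: comm_conjr; [exact: gr_scalarC | exact: conjY].
Qed.

(** Conjugation by [u] fixes [u] and [v]; they are substituted for [a] in the linear form of the
    relations. *)
Let uX i : GRing.comm u (X i). Proof. by rewrite /GRing.comm conjX_lin // vu mul1r. Qed.
Let vX i : GRing.comm v (X i). Proof. by rewrite /GRing.comm conjX_lin // -mulrA vu mulr1. Qed.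
Let vY j : GRing.comm v (Y j). Proof. by rewrite /GRing.comm conjY_lin // -[v * v * u]mulrA vu mulr1. Qed.

Let dX i : forall x, x \in msupp (X i) -> dg x = i. Proof. by move=> x /hcompP[]. Qed.
Let dY i : forall x, x \in msupp (Y i) -> dg x = i. Proof. by move=> x /hcompP[]. Qed.

Let XX i j : GRing.comm (X i) (X j).
Proof.
have := congr1 (hcomp (i + j)) (uX j).
by rewrite (hcomp_mulr _ Ku (@Khcomp _ _) (@dX j)) (hcomp_mull _ (@Khcomp _ _) (@dX j) Ku) addrK.
Qed.
Let XY i j : GRing.comm (X i) (Y j).
Proof.
have := congr1 (hcomp (i + j)) (vX i).
by rewrite (hcomp_mulr _ Kv (@Khcomp _ _) (@dX i)) (hcomp_mull _ (@Khcomp _ _) (@dX i) Kv) addrAC subrr add0r => /commr_sym.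
Qed.
Let YY i j : GRing.comm (Y i) (Y j).
Proof.
have := congr1 (hcomp (i + j)) (vY j).
by rewrite (hcomp_mulr _ Kv (@Khcomp _ _) (@dY j)) (hcomp_mull _ (@Khcomp _ _) (@dY j) Kv) addrK.
Qed.

Let sX := undup [seq dg x | x <- msupp u].
Let sY := undup [seq dg x | x <- msupp v].

Let hcomp_out w i : i \notin undup [seq dg x | x <- msupp w] -> hcomp i w = 0.
Proof.
move=> iw; apply: gr_ext => x; rewrite mcoeff0; apply/mcoeff_outdom/negP=> /hcompP[_ xi xw].
by case/negP: iw; rewrite mem_undup -xi map_f.
Qed.

Let sumX : u = \sum_(i <- sX) X i.
Proof.
apply: gr_ext => x; rewrite raddf_sum /=.
under eq_bigr => i _ do rewrite gr_coef_restr.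
have [xu | xu] := boolP (x \in msupp u); last first.
  by rewrite (mcoeff_outdom xu) big1 // => i _; rewrite if_same.
have dx : dg x \in sX by rewrite mem_undup map_f.
rewrite (bigD1_seq (dg x)) ?undup_uniq //= asboolT ?eqxx /=; last exact: Ku.
by rewrite big1 ?addr0 // => i /negPf ni; rewrite eq_sym ni ?andbF.
Qed.

Let hcomp_sum c (s : seq A) (F : A -> RG) : hcomp c (\sum_(i <- s) F i) = \sum_(i <- s) hcomp c (F i).
Proof.
apply: gr_ext => x; rewrite gr_coef_restr !raddf_sum /=.
under [RHS]eq_bigr => i _ do rewrite gr_coef_restr.
by case: ifP => // _; rewrite big1.
Qed.

Let convXY c : \sum_(i <- sX) X i * Y (c - i) = hcomp c 1.
Proof.
rewrite -uv {2}sumX mulr_suml hcomp_sum; apply: eq_bigr => i _.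
by rewrite (hcomp_mull _ (@Khcomp _ _) (@dX i)).
Qed.

Let hcomp1 c : hcomp c 1 = if c == 0 then 1 else 0.
Proof.
apply: gr_ext => x; rewrite gr_coef_restr gr_coef1 eq_sym.
have [-> | x1] := eqVneq x 1%g; last by rewrite !if_same; case: ifP; rewrite ?mcoeff0 // gr_coef1 (negPf x1).
by rewrite dg1 asboolT //=; case: ifP; rewrite ?mcoeff0 // gr_coef1 eqxx.
Qed.

Let nilXY i j : i + j != 0 -> nilpotent (X i * Y j).
Proof.
apply: (@nilpotent_products A RG X Y sX sY) => //.
- exact: undup_uniq.
- exact: hcomp_out.
- exact: hcomp_out.
by move=> c c0; rewrite convXY hcomp1 (negPf c0).
Qed.

Let e i := X i * Y (- i).

Let sum_e : \sum_(i <- sX) e i = 1.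
Proof. by have := convXY 0; rewrite hcomp1 eqxx => <-; apply: eq_bigr => i _; rewrite sub0r. Qed.

Let ZF (k : A + A) := match k with inl i => X i | inr j => Y j end.
Let ZZ k l : GRing.comm (ZF k) (ZF l).
Proof. case: k => i; case: l => j; by [exact: XX | exact: XY | exact/commr_sym/XY | exact: YY]. Qed.
Let be i : bicentral ZF (e i).
Proof. by apply: bicentralM; [exact: (@bicentral_gen _ _ ZF (inl i)) | exact: (@bicentral_gen _ _ ZF (inr _))]. Qed.

Let nil_ee i j : i != j -> nilpotent (e i * e j).
Proof.
(* Regrouped in this way, the two factors have the nonzero degrees [i - j] and [j - i]. *)
move=> ij; have -> : e i * e j = (X i * Y (- j)) * (X j * Y (- i)).
  by rewrite /e -!mulrA [Y (- i) * (X j * _)]mulrA -XY -mulrA YY [X j * (Y _ * _)]mulrA XY -!mulrA.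
apply: nilpotentM; last by apply: nilXY; rewrite subr_eq0.
apply: (bicentralC ZZ); apply: bicentralM;
  by [exact: (@bicentral_gen _ _ ZF (inl _)) | exact: (@bicentral_gen _ _ ZF (inr _))].
Qed.

Let nil_sum (s : seq A) (Q : pred A) (F : A -> RG) :
  (forall i, Q i -> bicentral ZF (F i)) -> (forall i, Q i -> nilpotent (F i)) ->
  nilpotent (\sum_(i <- s | Q i) F i).
Proof.
move=> bF nF; elim: s => [|i s IH]; first by rewrite big_nil; exact: nilpotent0.
rewrite big_cons; case: ifP => // Qi; apply: nilpotentD (nF i Qi) IH.
by apply: (bicentralC ZZ); [exact: bF | exact: bicentral_sum].
Qed.

Let idem_e i : i \in sX -> nilpotent (e i * (1 - e i)).
Proof.
move=> iX; have {1}<- := sum_e; rewrite (bigD1_seq i) ?undup_uniq //= addrC addrK mulr_sumr.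
by apply: nil_sum => j ji; [exact: bicentralM | apply: nil_ee; rewrite eq_sym].
Qed.

(** [e i] has degree 0, so its support is torsion and, by Dietzmann's lemma, generates a finite
    group. *)
Let nil_or_unit i : i \in sX -> nilpotent (e i) \/ exists2 e', GRing.comm (e i) e' & e i * e' = 1.
Proof.
move=> iX; have Ke : supported K (e i) by apply: supportedM.
have te (x : G) : x \in msupp (e i) -> K x /\ torsion x.
  move=> xe; have Kx := Ke x xe; split=> //; apply/dg0 => //.
  have [y [z [/hcompP[Ky yi _] /hcompP[Kz zi _] ->]]] := gr_supp_mul xe.
  by rewrite dgM // yi zi subrr.
have [C [eC CK CJ]] := torsion_conj_closure DJ te.
have [L CL] := generated_torsion_finite (fun (c d : G) cC dC => CJ c d cC (CK d dC).1) (fun (c : G) cC => (CK c cC).2).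
apply: (@gr_nilpotent_or_unit R G (generated C) L R_adapted CL) => //.
- exact: generated1.
- by move=> x y; exact: generatedM.
- by move=> x; exact: generated_finiteV CL.
- by move=> x /eC; exact: mem_generated.
exact: idem_e.
Qed.

Let exists_unit : exists i w, [/\ X i * w = 1, w * X i = 1 & ~ nilpotent (e i)].
Proof.
have [/hasP[i iX /asboolP nn]|/hasPn no] := boolP (has (fun i => `[< ~ nilpotent (e i) >]) sX).
  case: (nil_or_unit iX) => // -[e' ce E]; exists i, (Y (- i) * e').
  by have [E1 E2] := comm_unit_inverse (XY i (- i)) ce E; split.
suff [n] : nilpotent (1 : RG) by rewrite expr1n => /eqP; rewrite oner_eq0.
rewrite -sum_e big_seq; apply: nil_sum => // i iX.
by apply: contrapT => ni; move/asboolP: (no i iX).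
Qed.

(* Translating the unit [X i] by [g] and [phi g] gives a unit [X j]; if [j != i], then [X
   j * Y (- i)] is nilpotent, hence so are [Y (- i)] and [e i]. *)
Lemma exists_homogeneous_unit : exists i w, [/\ X i * w = 1, w * X i = 1
  & forall g, g%:G * X i = X i * (phi g)%:G].
Proof.
have [i [w [Xw wX nn]]] := exists_unit; exists i, w; split=> // g.
have [s1 s1X] : exists s, s \in msupp (X i).
  apply: contrapT => no; have X0 : X i = 0.
    by apply: gr_ext => x; rewrite mcoeff0; apply/mcoeff_outdom/negP=> xX; apply: no; exists x.
  by move/eqP: Xw; rewrite X0 mul0r eq_sym oner_eq0.
have [Ks1 ds1 s1u] := hcompP s1X.
pose t x := (g^-1 * x * phi g)%g.
have tu x : (t x \in msupp u) = (x \in msupp u) by rewrite -!mcoeff_neq0 nu_coef.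
pose j := dg (t s1).
have dgE x y : x \in msupp u -> y \in msupp u -> (dg x == dg y) <-> torsion (x * y^-1)%g.
  move=> /Ku Kx /Ku Ky; have Kxy : K (x * y^-1)%g by apply: KM => //; exact: KV.
  rewrite -(dg0 Kxy) dgM ?dgV //; last exact: KV.
  by split=> [/eqP -> | /eqP]; rewrite ?subrr // subr_eq0.
have tE x : x \in msupp u -> (dg (t x) == j) = (dg x == i).
  move=> xu; have E : (t x * (t s1)^-1 = (x * s1^-1) ^ g)%g.
    by rewrite conjgE !invMg invgK !mulgA mulgK.
  rewrite /j -ds1; apply/idP/idP => /dgE tt; apply/dgE; rewrite ?tu //.
    have {tt} := tt _ _; rewrite !tu E => /(_ xu s1u)/(torsionJ g^-1%g).
    by rewrite conjgK.
  by rewrite E; apply: torsionJ; exact: tt.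
have EX : (g^-1)%g%:G * X i * (phi g)%:G = X j.
  apply: gr_ext => x; rewrite gr_coef_mul_elt gr_coef_elt_mul !gr_coef_restr invgK.
  pose y := (g * (x * (phi g)^-1))%g; have xE : x = t y by rewrite /t mulKg mulgKV.
  rewrite -/y xE nu_coef.
  have [yu | /mcoeff_outdom ->] := boolP (y \in msupp u); last by rewrite !if_same.
  by rewrite tE // !asboolT //; apply: Ku; rewrite ?tu.
have gV h : h^-1%g%:G * h%:G = 1 by rewrite -gr_eltM mulVg.
have Vg h : h%:G * h^-1%g%:G = 1 by rewrite -gr_eltM mulgV.
have [ij | ij] := eqVneq j i; first by rewrite ij in EX; rewrite -{1}EX !mulrA Vg mul1r.
case: nn; rewrite /e XY; apply: nilpotentM; first exact/commr_sym/XY.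
have nXY : nilpotent (X j * Y (- i)) by apply: nilXY; rewrite subr_eq0.
case: nXY => n; rewrite exprMn_comm // => E; exists n.
pose w' := (phi g)^-1%g%:G * w * g%:G.
have w'X : w' * X j = 1.
  by rewrite -EX /w' -!mulrA [g%:G * (_ * _)]mulrA Vg mul1r [w * (_ * _)]mulrA wX mul1r gV.
have w'Xn m : w' ^+ m * X j ^+ m = 1.
  elim: m => [|m IH]; first by rewrite mulr1.
  by rewrite exprSr exprS mulrA -[_ * w' * _]mulrA w'X mulr1.
by rewrite -[LHS]mul1r -(w'Xn n) -mulrA E mulr0.
Qed.

(** Dividing the homogeneous unit by an element of its support moves it to degree 0, that is, to
    torsion elements of [D]. *)
Lemma torsion_unit_graded : exists (s : G) (w w' : RG), normalizing_unit (fun g => s * phi g * s^-1)%g w w' /\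
  supported (fun x => x \in D /\ torsion x) w.
Proof.
have [i [w [Xw wX gX]]] := exists_homogeneous_unit.
have [s ss] : exists s, s \in msupp (X i).
  apply: contrapT => no; have X0 : X i = 0.
    by apply: gr_ext => x; rewrite mcoeff0; apply/mcoeff_outdom/negP=> xX; apply: no; exists x.
  by move/eqP: Xw; rewrite X0 mul0r eq_sym oner_eq0.
have [Ks ds su] := hcompP ss.
have gV h : h^-1%g%:G * h%:G = 1 by rewrite -gr_eltM mulVg.
have Vg h : h%:G * h^-1%g%:G = 1 by rewrite -gr_eltM mulgV.
exists s, (X i * s^-1%g%:G), (s%:G * w); split; first split=> [||g].
- by rewrite mulrA -[X i * _ * _]mulrA gV mulr1.
- by rewrite mulrA -[s%:G * _ * _]mulrA wX mulr1.
- by rewrite mulrA gX !gr_eltM !mulrA -[X i * _ * s%:G]mulrA gV mulr1.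
move=> x; rewrite gr_supp_mul_elt invgK => /hcompP[Kxs dxs xsu].
have Dx : x \in D by rewrite -(mulgK s x); exact: DP.
have Kx := mem_generated Dx; split=> //; apply/dg0 => //.
by apply: (addIr (dg s)); rewrite add0r -dgM // dxs.
Qed.
End Grading.

Lemma torsion_unit : exists (s : G) (w w' : RG) (C : seq G),
  [/\ normalizing_unit (fun g => s * phi g * s^-1)%g w w', supported (fun x => x \in C) w,
      forall c, c \in C -> torsion c & forall c g, c \in C -> (c ^ g)%g \in C].
Proof.
have [A [dg [dgM dg0 Atf]]] := torsion_free_quotient DJ DV.
have [s [w [w' [nw Dw]]]] := torsion_unit_graded dgM dg0 Atf.
pose C := [seq d <- D | `[< torsion d >]].
have CP c : c \in C <-> c \in D /\ torsion c.
  by rewrite mem_filter; split=> [/andP[/asboolP] | [-> tc]] //; rewrite andbT; apply/asboolP.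
exists s, w, w', C; split=> // [x /Dw /CP // | c /CP[] // | c g /CP[Dc tc]].
by apply/CP; split; [exact: DJ | exact: torsionJ].
Qed.
End ReductionToTorsion.

Local Close Scope ring_scope.
Local Open Scope group_scope.

(** * From the infinite group to a finite group of affine maps *)

Section FiniteReduction.
Variables (R : idomainType) (G : groupType) (P : G -> Prop) (T : finGroupType) (iota : T -> G).
Hypotheses (R_adapted : G_adapted G R) (E : subgroup_embedding P iota).
Hypotheses (PJ : forall x g, P x -> P (x ^ g)).
Variables (psi : G -> G) (w w' : group_ring R G).
Hypotheses (nw : normalizing_unit psi w w') (Pw : supported P w).

Let pre x : {t : T | P x -> x = iota t}.
Proof.
apply: cid; case: (pselect (P x)) => [/(emb_onto E)[t ->] | nP]; first by exists t.
by exists 1.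
Qed.
Let preK x : P x -> iota (projT1 (pre x)) = x. Proof. by move/(projT2 (pre x)). Qed.
Let iota_inj := emb_inj E.

Let conjT g (t : T) : T := projT1 (pre (iota t ^ g)).
Let conjTE g t : iota (conjT g t) = iota t ^ g.
Proof. by apply: preK; apply: PJ; exact: emb_in E t. Qed.

Lemma nu_morph g h : psi (g * h) = psi g * psi h.
Proof.
have inj : injective (gr_elt R (G := G)).
  move=> x y /(congr1 (fun a : group_ring R G => a@_y)%R); rewrite !gr_coef_elt eqxx.
  by case: eqP => // _ /eqP; rewrite eq_sym oner_eq0.
apply: inj; rewrite -[LHS]mul1r -(nu_mulVu nw) -mulrA -(nu_conj nw) !gr_eltM -mulrA (nu_conj nw h).
by rewrite (mulrA (gr_elt R g)) (nu_conj nw g) !mulrA (nu_mulVu nw) mul1r.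
Qed.

Let k g : T := projT1 (pre (g^-1 * psi g)).
Let kE g : psi g = g * iota (k g).
Proof.
(* For [x] in the support of [w], both [x ^ g] and [g^-1 * x * psi g] lie in [P], and their quotient
   is [g^-1 * psi g]. *)
apply: (mulgI g^-1); rewrite mulKg preK //.
have [x xw] : exists x, x \in msupp w.
  apply: contrapT => no; have w0 : w = 0%R.
    by apply: gr_ext => x; rewrite mcoeff0; apply/mcoeff_outdom/negP=> xX; apply: no; exists x.
  by have /eqP := nu_mulV nw; rewrite w0 mul0r eq_sym oner_eq0.
have Py : P (g^-1 * x * psi g) by apply: Pw; rewrite -mcoeff_neq0 (nu_coef nw) mcoeff_neq0.
rewrite (_ : g^-1 * _ = (x ^ g)^-1 * (g^-1 * x * psi g)); last by rewrite conjgE !invMg invgK !mulgA mulgK mulgKV.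
have [t Et] := emb_onto E Py; have [s Es] := emb_onto E (PJ g (Pw xw)).
by rewrite Es Et -(embV E) -(embM E); exact: emb_in E _.
Qed.

Let aff g (t : T) : T := conjT g t * k g.
Let affE g t : iota (aff g t) = g^-1 * iota t * psi g.
Proof. by rewrite (embM E) conjTE kE conjgE !mulgA. Qed.

Let aff_inj g : injective (aff g).
Proof. by move=> s t /(congr1 iota); rewrite !affE => /mulIg/mulgI/iota_inj. Qed.

Let tau g : {perm T} := perm (@aff_inj g).
Let tauM g h : tau (g * h) = tau g * tau h.
Proof.
apply/permP => t; rewrite permM !permE; apply: iota_inj.
by rewrite !affE nu_morph invMg !mulgA.
Qed.
Let tau1 : tau 1 = 1.
Proof. by apply: (mulgI (tau 1)); rewrite -tauM !mulg1. Qed.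
Let tauV g : tau g^-1 = (tau g)^-1.
Proof. by apply: (mulgI (tau g)); rewrite -tauM !mulgV tau1. Qed.

(** An affine permutation determines its translation part, its value at 1, and then its linear part;
    so the cocycle and the action descend to the image of [tau]. *)
Let tau_k g h : tau g = tau h -> k g = k h.
Proof.
move=> gh; have := congr1 (fun s : {perm T} => s 1) gh; rewrite !permE /aff.
have c1 x : conjT x 1 = 1 by apply: iota_inj; rewrite conjTE (emb1 E) conj1g.
by rewrite !c1 !mul1g.
Qed.
Let tau_conj g h t : tau g = tau h -> conjT g t = conjT h t.
Proof.
move=> gh; have := congr1 (fun s : {perm T} => s t) gh; rewrite !permE /aff (tau_k gh).
exact: mulIg.
Qed.

Lemma inner_of_finite p (z : T) : prime p -> #[z] = p ->
  (forall (K : {group T}), z \notin K -> forall g x, x \in K -> exists2 y, y \in K & iota x ^ g = iota y) ->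
  exists t, forall g, psi g = g ^ t.
Proof.
move=> pp oz Kz.
have [||||Gam [j Ej]] := @finite_subgroup_type {perm T} (fun s => exists g, s = tau g) (enum {perm T}).
- by move=> s _; rewrite mem_enum.
- by exists 1; rewrite tau1.
- by move=> _ _ [g ->] [h ->]; exists (g * h); rewrite tauM.
- by move=> _ [g ->]; exists g^-1; rewrite tauV.
(* A chosen preimage in [G]; it is multiplicative only after applying [tau]. *)
pose rep (s : Gam) : G := projT1 (cid (emb_in Ej s)).
have repE s : j s = tau (rep s) by exact: (projT2 (cid (emb_in Ej s))).
have jM (r s : Gam) : tau (rep (r * s)) = tau (rep r * rep s) by rewrite -repE (embM Ej) !repE tauM.
have memb (t : T) : {s : Gam | j s = tau (iota t)}.
  by apply: cid; have [s Es] := emb_onto Ej (ex_intro _ (iota t) erefl); exists s.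
pose al (s : Gam) := conjT (rep s); pose i t := projT1 (memb t).
have iE t : tau (rep (i t)) = tau (iota t) by rewrite -repE; exact: projT2 (memb t).
have alM s : {morph al s : x y / x * y}.
  by move=> x y; apply: iota_inj; rewrite (embM E) !conjTE (embM E) conjMg.
have alA r s x : al (r * s) x = al s (al r x).
  by rewrite /al (tau_conj _ (jM r s)); apply: iota_inj; rewrite !conjTE conjgM.
have al_id x : al 1 x = x.
  have -> : al 1 x = conjT 1 x by apply: tau_conj; rewrite -repE (emb1 Ej) tau1.
  by apply: iota_inj; rewrite conjTE conjg1.
have iM : {morph i : x y / x * y}.
  move=> x y; apply: (emb_inj Ej); rewrite (embM Ej) !repE !iE.
  by rewrite (embM E) tauM.
have al_i t x : al (i t) x = x ^ t.
  rewrite /al (tau_conj _ (iE t)); apply: iota_inj.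
  by rewrite conjTE !conjgE !(embM E) (embV E).
have i_al s x : i (al s x) = i x ^ s.
  apply: (emb_inj Ej); rewrite repE iE conjTE conjgE !tauM tauV.
  by rewrite conjgE !(embM Ej) (embV Ej) !repE iE.
pose CA := ConjAction alM alA al_id iM al_i i_al.
pose c s := k (rep s); pose u t := (w@_(iota t))%R; pose v t := (w'@_(iota t))%R.
have P1 : P 1 by rewrite -(emb1 E); exact: emb_in E 1.
have PM x y : P x -> P y -> P (x * y).
  by move=> /(emb_onto E)[a ->] /(emb_onto E)[b ->]; rewrite -(embM E); exact: emb_in E _.
have PV x : P x -> P x^-1.
  by move=> /(emb_onto E)[a ->]; rewrite -(embV E); exact: emb_in E _.
have Pw' : supported P w' := supported_inverse P1 PM PV Pw (nu_mulV nw) (nu_mulVu nw).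
have cuv : twisted_unit CA c u v.
  split=> [r s | s x | s x | t | t].
  - rewrite /c (tau_k (jM r s)); apply: iota_inj; rewrite (embM E) [iota (act_by _ _ _)]conjTE.
    apply: (mulgI (rep r * rep s)); rewrite -kE nu_morph !kE conjgE !mulgA mulgK.
    by rewrite -!mulgA.
  - by rewrite /u -[X in (_@_X)%R]/(iota (aff _ _)) affE (nu_coef nw).
  - rewrite /v !(embV E) (_ : iota (act_by CA s x * c s) = (rep s)^-1 * iota x * psi (rep s)); last exact: affE.
    by rewrite !invMg invgK -gr_coef_elt_mul -(nu_conjV nw) gr_coef_mul_elt mulgK.
  - by rewrite -(emb_coefM E) ?(nu_mulV nw) ?gr_coef1 -?(emb1 E) ?(inj_eq iota_inj).
  - by rewrite -(emb_coefM E) ?(nu_mulVu nw) ?gr_coef1 -?(emb1 E) ?(inj_eq iota_inj).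
have [K s x zK xK | r pr rT | x Ex] := twisted_fixed_point pp oz _ _ cuv.
- have [y yK Ey] := Kz K zK (rep s) x xK.
  by rewrite (_ : act_by CA s x = y) //; apply: iota_inj; rewrite -Ey -conjTE.
- have [t _ ot] := Cauchy pr (etrans (congr1 (dvdn r) (cardsT T)) rT).
  by apply: R_adapted.2 => //; exists (iota t); rewrite -ot; exact: emb_order E t.
(* A common fixed point satisfies [g^-1 * x * psi g = x], that is, [psi g = g ^ x]. *)
exists (iota x) => g.
have [s Es] := emb_onto Ej (ex_intro _ g erefl).
have Eg : aff (rep s) x = aff g x.
  by have := congr1 (fun q : {perm T} => q x) Es; rewrite repE !permE.
have := congr1 iota (Ex s); rewrite -[act_by CA s x * c s]/(aff (rep s) x) Eg affE => Ei.
by rewrite conjgE -{2}Ei !mulgA mulgK mulVg mul1g.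
Qed.
End FiniteReduction.

(** * The intersection of the finite non-normal subgroups *)

Section FiniteNonnormalCore.
Variables (G : groupType).
Implicit Types (K : set G) (x g : G).

Lemma subgroupP K : subgroup K <->
  [/\ K 1, forall x y, K x -> K y -> K (x * y) & forall x, K x -> K x^-1].
Proof.
have inK x : (x \in mem K) = `[< K x >] by [].
split=> [sK | [K1 KM KV]].
  split=> [|x y Kx Ky|x Kx]; apply/asboolP.
  - exact: sK.1.
  - by rewrite -inK; apply: (group_closedM sK); rewrite inK asboolT.
  - by rewrite -inK; apply: (group_closedV sK); rewrite inK asboolT.
split=> [|x y /asboolP Kx /asboolP Ky]; apply/asboolP => //.
by apply: KM => //; exact: KV.
Qed.

Lemma normal_conj K x g : normal_in_group K -> K x -> K (x ^ g).
Proof. by move=> nK Kx; rewrite -(nK g); exists x. Qed.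

Lemma conj_set_subgroup K g : subgroup K -> subgroup (conj_set K g).
Proof.
move=> /subgroupP[K1 KM KV]; apply/subgroupP; split=> [|_ _ [x Kx <-] [y Ky <-]|_ [x Kx <-]].
- by exists 1; rewrite ?conj1g.
- by exists (x * y); rewrite ?conjMg //; exact: KM.
- by exists x^-1; rewrite ?conjVg //; exact: KV.
Qed.

Lemma conj_setK K g : conj_set (conj_set K g) g^-1 = K.
Proof.
apply/seteqP; split=> [_ [_ [x Kx <-] <-] | x Kx]; first by rewrite conjgK.
by exists (x ^ g); rewrite ?conjgK //; exists x.
Qed.

Lemma conj_nonnormal K g : finite_nonnormal_subgroup K -> finite_nonnormal_subgroup (conj_set K g).
Proof.
move=> [sK fK nK]; split; [exact: conj_set_subgroup | exact: finite_image | move=> nKg; apply: nK => h].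
have KgK : conj_set K g = K by rewrite -{2}(conj_setK K g) nKg.
by rewrite -KgK.
Qed.

Lemma coreJ x g : finite_nonnormal_core G x -> finite_nonnormal_core G (x ^ g).
Proof.
move=> cx K fK; have [y Ky] := cx _ (conj_nonnormal g^-1 fK).
by move=> <-; rewrite conjgKV.
Qed.

Lemma torsion_of_finite_subgroup K x : subgroup K -> finite_set K -> K x -> torsion x.
Proof.
move=> /subgroupP[K1 KM _] /finite_seqP[L KL] Kx; apply: (@torsion_of_finite _ L) => n.
have: K (x ^+ n) by elim: n => [|n IH]; rewrite ?expg0 // expgS; exact: KM.
by rewrite KL.
Qed.

Section Inner.
Variable R : idomainType.
Hypotheses (R_adapted : G_adapted G R)
  (ex_nonnormal : exists K : set G, finite_nonnormal_subgroup K)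
  (core_nontrivial : finite_nonnormal_core G <> [set 1%g]%classic).

Lemma nontrivial_core_element : exists2 r, finite_nonnormal_core G r & r <> 1.
Proof.
apply: contrapT => no; apply: core_nontrivial; apply/seteqP; split=> [x cx | _ ->] /=.
  by apply: contrapT => x1; apply: no; exists x.
by move=> K [/subgroupP[]].
Qed.

(* The finite normal subgroup [P] contains both the support of [w] and a nontrivial
   element of the core, whose power [z] of prime order detects the finite subgroups that
   need not be normal. *)
Lemma torsion_unit_inner (psi : G -> G) (w w' : group_ring R G) (C : seq G) :
  normalizing_unit psi w w' -> supported (fun x => x \in C) w ->
  (forall c, c \in C -> torsion c) -> (forall c g, c \in C -> c ^ g \in C) ->
  exists t, forall g, psi g = g ^ t.
Proof.
move=> nw wC Ct CJ; have [K0 fK0] := ex_nonnormal; have [sK0 finK0 _] := fK0.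
have /finite_seqP[L0 KL0] := finK0; have [r cr r1] := nontrivial_core_element.
pose Cr := [seq x <- L0 | `[< finite_nonnormal_core G x >]].
have CrP x : x \in Cr <-> finite_nonnormal_core G x.
  rewrite mem_filter; split=> [/andP[/asboolP] // | cx]; rewrite asboolT //=.
  by have := cx _ fK0; rewrite KL0.
pose P := generated (C ++ Cr).
have CCJ x g : x \in C ++ Cr -> x ^ g \in C ++ Cr.
  rewrite !mem_cat => /orP[xC | /CrP cx]; first by rewrite CJ.
  by apply/orP; right; apply/CrP; exact: coreJ.
have CCt x : x \in C ++ Cr -> torsion x.
  rewrite mem_cat => /orP[/Ct // | /CrP cx].
  exact: torsion_of_finite_subgroup sK0 finK0 (cx _ fK0).
have [L PL] := generated_torsion_finite (fun c d cC _ => CCJ c d cC) CCt.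
have PV x : P x -> P x^-1 by exact: generated_finiteV PL.
have PJ x g : P x -> P (x ^ g) by apply: generatedJ => a; exact: CCJ.
have [T [iota E]] := finite_subgroup_type PL (generated1 _) (@generatedM _ _) PV.
have Pw : supported P w by move=> x /wC xC; apply: mem_generated; rewrite mem_cat xC.
have [rT Er] : exists t, r = iota t.
  by apply: (emb_onto E); apply: mem_generated; rewrite mem_cat; apply/orP; right; apply/CrP.
have rT1 : (1 < #[rT])%N.
  rewrite ltn_neqAle order_gt0 andbT eq_sym order_eq1; apply/eqP=> rT1.
  by apply: r1; rewrite Er rT1 (emb1 E).
pose p := pdiv #[rT]; pose z := rT ^+ (#[rT] %/ p).
have oz : #[z] = p.
  have pn := pdiv_dvd #[rT]; rewrite orderXdiv; last by rewrite -{2}(divnK pn) dvdn_mulr.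
  by rewrite divnA // mulKn // order_gt0.
apply: (inner_of_finite R_adapted E PJ nw Pw (pdiv_prime rT1) oz) => K zK g x xK.
pose KG : set G := ([set iota t | t in [set t : T | t \in K]])%classic.
have sKG : subgroup KG.
  apply/subgroupP; split=> [|_ _ [a aK <-] [b bK <-]|_ [a aK <-]].
  - by exists 1; rewrite ?(emb1 E) //=; exact: group1.
  - by exists (a * b); rewrite ?(embM E) //=; exact: groupM.
  - by exists a^-1; rewrite ?(embV E) //=; rewrite groupV.
(* A non-normal image would contain the core element [r], so [K] would contain its power [z]. *)
have nKG : normal_in_group KG.
  apply: contrapT => nK; case/negP: zK.
  have /(cr KG) : finite_nonnormal_subgroup KG by split=> //; exact/finite_image/finite_finset.
  case=> a /= aK; rewrite Er => /(emb_inj E) Ea; rewrite /z -Ea; exact: groupX.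
have [|y yK Ey] := normal_conj (x := iota x) g nKG; first by exists x.
by exists y.
Qed.

Lemma normalizing_unit_inner (phi : G -> G) (u v : group_ring R G) :
  normalizing_unit phi u v -> exists t, forall g, phi g = g ^ t.
Proof.
move=> nu; have [s0 s0u] : exists x, x \in msupp u.
  apply: contrapT => no; have u0 : u = 0%R.
    by apply: gr_ext => x; rewrite mcoeff0; apply/mcoeff_outdom/negP=> xX; apply: no; exists x.
  by have /eqP := nu_mulV nu; rewrite u0 mul0r eq_sym oner_eq0.
have nu' : normalizing_unit (fun g => s0 * phi g * s0^-1) (u * gr_elt R s0^-1)%R (gr_elt R s0 * v)%R.
  split=> [||g].
  - by rewrite mulrA -[(u * _ * _)%R]mulrA -gr_eltM mulVg gr_elt1 mulr1 (nu_mulV nu).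
  - by rewrite mulrA -[(_ * v * _)%R]mulrA (nu_mulVu nu) mulr1 -gr_eltM mulgV.
  - by rewrite mulrA (nu_conj nu) -!mulrA -!gr_eltM mulgA mulKg.
have u1 : 1 \in msupp (u * gr_elt R s0^-1)%R by rewrite gr_supp_mul_elt invgK mul1g.
have [s [w [w' [C [nw wC Ct CJ]]]]] := torsion_unit R_adapted nu' u1.
have [t phiE] := torsion_unit_inner nw wC Ct CJ; exists (t * (s * s0)) => g.
by rewrite conjgM -phiE conjgE invMg !mulgA !mulgKV mulVg mul1g.
Qed.
End Inner.
End FiniteNonnormalCore.
Local Close Scope group_scope.

(** * The normalizer of the group among the units *)

Lemma group_unitJ (R : nzRingType) (G : groupType) (x h : G) :
  (group_unit R (x ^ h) = group_unit R x ^ group_unit R h)%g.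
Proof.
rewrite !conjgE !group_unitM; congr (_ * _)%g; apply: (mulgI (group_unit R h)).
by rewrite -group_unitM !mulgV; exact: val_inj.
Qed.

Theorem theorem3p3 (G : groupType) (R : idomainType)
  (ex_nonnormal : exists K : set G, finite_nonnormal_subgroup K)
  (core_nontrivial : finite_nonnormal_core G <> [set 1%g]%classic)
  (R_adapted : G_adapted G R) :
  normalizer_property R G.
Proof.
rewrite /normalizer_property; apply/seteqP; split=> [U nU | _ [c cC [_ [h _ <-] <-]]]; last first.
  have cJ x : (x ^ (c * group_unit R h) = x ^ group_unit R h)%g.
    by rewrite conjgM (_ : x ^ c = x)%g // conjgE -(cC x) mulKg.
  apply/seteqP; split=> [_ [_ [x _ <-] <-] | _ [x _ <-]].
    by exists (x ^ h)%g; rewrite // cJ group_unitJ.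
  exists (group_unit R (x ^ h^-1)%g); first by exists (x ^ h^-1)%g.
  by rewrite cJ -group_unitJ conjgKV.
have phiP g : {g' | (group_unit R g ^ U)%g = group_unit R g'}.
  apply: cid; have : (conj_set (group_in_units R G) U) (group_unit R g ^ U)%g.
    by exists (group_unit R g) => //; exists g.
  by rewrite nU => -[g' _ <-]; exists g'.
pose phi g := projT1 (phiP g).
have phiE g : (group_unit R g * U = U * group_unit R (phi g))%g.
  by rewrite -(projT2 (phiP g)) conjgE mulgA mulgV mul1g.
have nu : normalizing_unit phi (val U) (val U^-1%g).
  split=> [||g]; first by have /(congr1 val) := mulgV U.
    by have /(congr1 val) := mulVg U.
  by have /(congr1 val) := phiE g.
have [t phit] := normalizing_unit_inner R_adapted ex_nonnormal core_nontrivial nu.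
have gu1 : group_unit R (1 : G)%g = 1%g by exact: val_inj.
(* [U] and [t] induce the same automorphism of [G], so this quotient commutes with [G], hence with
   the whole group ring. *)
exists (U * group_unit R t^-1)%g; last first.
  by exists (group_unit R t); [exists t | rewrite -mulgA -group_unitM mulVg gu1 mulg1].
move=> V; apply: val_inj; apply: gr_comm_elts => g; apply: esym.
rewrite -[LHS]/(gr_elt R g * (val U * gr_elt R t^-1%g))%R mulrA (nu_conj nu) phit.
by rewrite -[RHS]/(val U * gr_elt R t^-1%g * gr_elt R g)%R -!mulrA -!gr_eltM conjgE mulgA mulgK.
Qed.
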